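(* Let $M$ be an even-dimensional complex manifold and let $\boldsymbol\Omega\subset\Omega^{2,0}(M)$ be a trisymplectic structure on $M$. Then there is a holomorphic $SL(2)$-web $(M,S_t)$, $t\in\mathbb{CP}^1$, on $M$ such that each sub-bundle $S_t$ is the null-space of a certain $\Omega_t\in\boldsymbol\Omega$.
   Context: Trisymplectic structure on a complex manifold $M$: a 3-dimensional space $\boldsymbol\Omega$ of closed holomorphic 2-forms such that for every $x\in M$ the evaluation $\boldsymbol\Omega(x)$ is a 3-dimensional space of 2-forms on $T_xM$ with: (i) $\boldsymbol\Omega(x)$ contains a non-degenerate form; (ii) every nonzero degenerate form in $\boldsymbol\Omega(x)$ has rank $\frac12\dim T_xM$; (iii) the set of degenerate forms lies in a non-degenerate quadric in $\boldsymbol\Omega(x)$. The null-space of a $(p,0)$-form $\eta$ is $\{v\in T^{1,0}M : \iota_v\eta=0\}$. Holomorphic $SL(2)$-web: a family $S_t\subset TM$, $t\in\mathbb{CP}^1$, of holomorphic sub-bundles of rank $n$, where $\dim_{\mathbb C}M=2n$, such that (i) each $S_t$ is involutive; (ii) $S_t\cap S_{t'}=0$ for $t\neq t'$; (iii) the projections $P_{t,t'}:TM\to S_t\hookrightarrow TM$ onto $S_t$ along $S_{t'}$ generate a sub-bundle of rank 4 in $\mathrm{End}(TM)$ closed under multiplication; (iv) each fiber of this sub-bundle is isomorphic to the algebra $\mathrm{Mat}(2)$ of $2\times2$ complex matrices.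
   Formalization: Condition (iii) is taken with one non-degenerate quadric in Ω, the same for all x; with quadrics varying with x the claim fails, e.g. on C^4 for the span of exp(z1)dz1∧dz2, dz3∧dz4, dz1∧dz4+dz2∧dz3. *)

(* Defs.v *)
From HB Require Import structures.
From mathcomp Require Import all_boot all_order all_algebra.
From mathcomp Require Import all_classical all_reals.
From mathcomp Require Import topology normedtype derive.
From mathcomp Require Export complex.

Set Implicit Arguments.
Unset Strict Implicit.
Unset Printing Implicit Defensive.

Import Order.TTheory GRing.Theory Num.Theory.
Import numFieldNormedType.Exports.

Local Open Scope classical_set_scope.
Local Open Scope ring_scope.

Record chart (K : numClosedFieldType) (m : nat) (X : topologicalType) := Chart {
  cdom : set X;
  ccod : set 'rV[K]_m;
  cmap : X -> 'rV[K]_m;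
  cinv : 'rV[K]_m -> X;
  cdom_open : open cdom;
  ccod_open : open ccod;
  cmap_cod : forall x, cdom x -> ccod (cmap x);
  cinv_dom : forall y, ccod y -> cdom (cinv y);
  cmapK : forall x, cdom x -> cinv (cmap x) = x;
  cinvK : forall y, ccod y -> cmap (cinv y) = y;
  cmap_continuous : forall x, cdom x -> {for x, continuous cmap};
  cinv_continuous : forall y, ccod y -> {for y, continuous cinv}
}.

(* Differentiability is over K, i.e. complex differentiability when K = R[i];
   on an open set this is holomorphy.  Each point x carries a preferred chart
   [chart_at x]; the (holomorphic) tangent space T_xM is 'rV[K]_m, vectors being
   read in [chart_at x]. *)
Record manifold (K : numClosedFieldType) (m : nat) := Manifold {
  points :> topologicalType;
  atlas : set (chart K m points);
  chart_at : points -> chart K m points;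
  chart_at_atlas : forall x, atlas (chart_at x);
  chart_at_dom : forall x, cdom (chart_at x) x;
  atlas_holomorphic : forall c d, atlas c -> atlas d ->
    forall x, cdom c x -> cdom d x ->
      differentiable (cmap d \o cinv c) (cmap c x);
  points_hausdorff : hausdorff_space points;
  points_second_countable : @second_countable points
}.

Section Tensors.
Context {K : numClosedFieldType} {m : nat} {M : manifold K m}.
Implicit Types (c d : chart K m M) (x : M) (U : set M).

(* Row vectors: v in the chart c becomes v *m trans c d x in the chart d. *)
Definition trans c d x : 'M[K]_m :=
  jacobian (cmap d \o cinv c) (cmap c x).

(* Sections of TM, of Lambda^2 T*M (a bilinear form a on T_xM is the matrix a
   with a(u, v) = u *m a *m v^T) and of End(TM) (an endomorphism A acts by
   v |-> v *m A) are functions on M; the following are their expressions in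
   the coordinates of the chart c, meaningful on [ccod c]. *)
Definition vect_in c (X : M -> 'rV[K]_m) (y : 'rV[K]_m) : 'rV[K]_m :=
  let x := cinv c y in X x *m trans (chart_at x) c x.

Definition form_in c (w : M -> 'M[K]_m) (y : 'rV[K]_m) : 'M[K]_m :=
  let x := cinv c y in
  let J := trans c (chart_at x) x in J *m w x *m J^T.

Definition endo_in c (A : M -> 'M[K]_m) (y : 'rV[K]_m) : 'M[K]_m :=
  let x := cinv c y in
  trans c (chart_at x) x *m A x *m trans (chart_at x) c x.

(* [rep] is one of vect_in, form_in, endo_in. *)
Definition holomorphic_on (a b : nat)
    (rep : chart K m M -> (M -> 'M[K]_(a, b)) -> 'rV[K]_m -> 'M[K]_(a, b))
    (U : set M) (s : M -> 'M[K]_(a, b)) :=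
  forall c, atlas c -> forall y, ccod c y -> U (cinv c y) ->
    differentiable (rep c s) y.

Definition subbundle (a b : nat)
    (rep : chart K m M -> (M -> 'M[K]_(a, b)) -> 'rV[K]_m -> 'M[K]_(a, b))
    (r : nat) (E : M -> {vspace 'M[K]_(a, b)}) :=
  forall x0, exists U, [/\ open U, U x0 &
    exists F : 'I_r -> M -> 'M[K]_(a, b),
      (forall i, holomorphic_on rep U (F i)) /\
      (forall x, U x -> basis_of (E x) [tuple F i x | i < r])].

(* [X, Y] = DY.X - DX.Y in the coordinates of [chart_at x], in which the
   coordinates of the vectors X x and Y x are X x and Y x themselves. *)
Definition lie_bracket (X Y : M -> 'rV[K]_m) x : 'rV[K]_m :=
  let c := chart_at x in
  'D_(X x) (vect_in c Y) (cmap c x) - 'D_(Y x) (vect_in c X) (cmap c x).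

Definition involutive_subbundle (S : M -> {vspace 'rV[K]_m}) :=
  forall U (X Y : M -> 'rV[K]_m), open U ->
    holomorphic_on vect_in U X -> holomorphic_on vect_in U Y ->
    (forall x, U x -> X x \in S x /\ Y x \in S x) ->
    forall x, U x -> lie_bracket X Y x \in S x.

Definition holomorphic_2form (w : M -> 'M[K]_m) :=
  (forall x, (w x)^T = - w x) /\ holomorphic_on form_in setT w.

Definition closed_2form (w : M -> 'M[K]_m) :=
  forall c, atlas c -> forall y, ccod c y -> forall i j k : 'I_m,
    let d l := 'D_(delta_mx 0 l) (form_in c w) y in
    d i j k + d j k i + d k i j = 0.

End Tensors.

(* {v | iota_v a = 0}: the covector iota_v a = a(v, -) is v *m a. *)
Definition null_space (K : numClosedFieldType) (m : nat) (a : 'M[K]_m) :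
    {vspace 'rV[K]_m} :=
  lker (linfun (mulmxr a : 'rV[K]_m -> 'rV[K]_m)).

Section Space3.
Context {K : numClosedFieldType} {V : lmodType K}.

Definition lincomb3 (w : 'I_3 -> V) (c : 'rV[K]_3) : V :=
  \sum_(i < 3) c 0 i *: w i.

Definition basis3 (A : set V) (w : 'I_3 -> V) :=
  (forall c, lincomb3 w c = 0 -> c = 0) /\ A = range (lincomb3 w).

Definition space3 (A : set V) := exists w, basis3 A w.

Definition nondegenerate_quadric (A Z : set V) :=
  exists (w : 'I_3 -> V) (Q : 'M[K]_3),
    [/\ basis3 A w, Q^T = Q, Q \in unitmx &
        Z = lincomb3 w @` [set c | c *m Q *m c^T = 0]].

End Space3.

Definition eval_forms (K : numClosedFieldType) (m : nat) (M : manifold K m)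
    (Omega : set (M -> 'M[K]_m)) (x : M) : set 'M[K]_m :=
  [set w x | w in Omega].

Definition degenerate (K : numClosedFieldType) (m : nat) (a : 'M[K]_m) :=
  (\rank a < m)%N.

(* Evaluation identifies Omega with Omega(x), and the quadric Z containing the
   degenerate forms is a quadric in Omega, the same for all x.  If it could
   depend on x, no SL(2)-web would exist in general: on C^4 the forms
   exp(z1) dz1/\dz2, dz3/\dz4 and dz1/\dz4 + dz2/\dz3 span a space for which
   the pointwise quadrics 2 exp(z1) a b + 2 c^2 = 0 vary with z1, and the
   everywhere degenerate forms are the multiples of the first two. *)
Definition trisymplectic (K : numClosedFieldType) (n : nat)
    (M : manifold K n.*2) (Omega : set (M -> 'M[K]_(n.*2))) :=
  [/\ space3 Omega,
      forall w, Omega w -> holomorphic_2form w /\ closed_2form w &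
      exists2 Z, nondegenerate_quadric Omega Z & forall x : M,
        [/\ space3 (eval_forms Omega x),
            exists2 a, eval_forms Omega x a & ~ degenerate a,
            forall a, eval_forms Omega x a -> a != 0 -> degenerate a ->
              \rank a = n &
            [set a | eval_forms Omega x a /\ degenerate a]
              `<=` eval_forms Z x]].

Definition CP1 (K : numClosedFieldType) :=
  {L : {vspace 'rV[K]_2} | \dim L == 1%N}.

Definition spanned_by (K : numClosedFieldType) (V : vectType K)
    (E : {vspace V}) (A : set V) :=
  (forall v, A v -> v \in E) /\
  (forall F : {vspace V}, (forall v, A v -> v \in F) -> (E <= F)%VS).

Definition isomorphic_Mat2 (K : numClosedFieldType) (m : nat)
    (E : {vspace 'M[K]_m}) :=
  exists f : {linear 'M[K]_2 -> 'M[K]_m},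
    [/\ injective f, forall A B, f (A *m B) = f A *m f B,
        f 1%:M = 1%:M & forall C, C \in E <-> exists A, C = f A].

Section Web.
Context {K : numClosedFieldType} {n : nat} {M : manifold K n.*2}.
Implicit Type S : CP1 K -> M -> {vspace 'rV[K]_(n.*2)}.

(* [daddv_pi U V] is the projection onto U along V. *)
Definition web_proj S (t t' : CP1 K) (x : M) : 'M[K]_(n.*2) :=
  lin1_mx (daddv_pi (S t x) (S t' x)).

Definition SL2_web S :=
  [/\ forall t, subbundle vect_in n (S t),
      forall t, involutive_subbundle (S t),
      forall t t' x, t != t' -> (S t x :&: S t' x = 0)%VS &
      exists2 E : M -> {vspace 'M[K]_(n.*2)}, subbundle endo_in 4 E &
        forall x,
        [/\ spanned_by (E x)
              [set a | exists t t', t != t' /\ a = web_proj S t t' x],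
            forall a b, a \in E x -> b \in E x -> a *m b \in E x &
            isomorphic_Mat2 (E x)]].

End Web.

(* Main.v *)
(** In a basis adapted to the quadric, the degenerate forms of Omega(x) lie on
    the conic of the forms s^2 w0 + s t w1 + t^2 w2, and by an eigenvalue argument
    on the tangent lines every form of the conic is degenerate, hence of rank n,
    whereas w1 is not on the conic.  Put N = w0 w1^-1 and N' = w2 w1^-1.  As the
    pencil s^2 N + s t + t^2 N' has constant rank n and independent kernels,
    N^2 = N'^2 = 0 and N N' + N' N = 1, so that N N', N, N', N' N are matrix units
    spanning a copy of Mat(2), in which the projections along the kernels S_(s:t)
    of the pencil are explicit.  Closedness of the forms makes S_(s:t) involutive.
    The transition maps enter through their Jacobians, whose holomorphy follows
    from Goursat's theorem and Cauchy's formula for the derivative on a square: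
    differentiating the formula 2 pi i df(z)v = \oint f(z + k v) / k^2 dk under the
    integral sign shows that z |-> df(z)v is differentiable. *)
From HB Require Import structures.
Require Import Defs.
From mathcomp Require Import all_boot all_order all_algebra.
From mathcomp Require Import all_classical all_reals.
From mathcomp Require Import topology normedtype derive landau.
From mathcomp Require Import measure lebesgue_measure lebesgue_integral.
From mathcomp Require Import ring lra.

Set Implicit Arguments.
Unset Strict Implicit.
Unset Printing Implicit Defensive.

Import Order.TTheory GRing.Theory Num.Theory.
Import numFieldNormedType.Exports.

Local Open Scope classical_set_scope.
Local Open Scope ring_scope.

(** * Differentiable matrix-valued functions *)

(** Holomorphy means complex differentiability at each point, so a transition map comes with no
    regularity of its Jacobian. Jacobians cannot be avoided: a local frame of S_t is made of vectors
    that are constant in one chart and must be read in another. This is the analytic input; it is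
    isolated as a hypothesis on the field, and the geometry is done over an arbitrary
    [numClosedFieldType], where the limit s -> 0 in the pencil is taken algebraically. N and N'
    escape the difficulty, because a quotient of two forms is in every chart the quotient of their
    coordinate matrices.

    Three facts make the construction global. Lying off the conic, w1 is invertible at every point
    of M; the conic is the same at all points, so that the adapted basis has constant coefficients
    and consists of closed forms; the projections have constant coefficients in N N', N, N', N' N.
    That the rank n is exactly half of the dimension is what makes kernel and image of N coincide.
    Vectors being rows, null-spaces are left kernels. *)

Lemma differentiable_near (K : numFieldType) (V W : normedModType K)
    (f : V -> W) (x : V) : differentiable f x ->
  forall e : K, 0 < e ->
    \forall h \near (0 : V), `|f (x + h) - f x - 'd f x h| <= e * `|h|.
Proof.
move=> /diff_locally /eqaddoP H e e0; have := H e e0.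
by apply: filterS => h; rewrite !fctE /= [h + x]addrC opprD addrA.
Qed.

Lemma differentiable_of_near (K : numFieldType) (V W : normedModType K)
    (f : V -> W) (L : {linear V -> W}) (x : V) : continuous L ->
  (forall e : K, 0 < e ->
    \forall h \near (0 : V), `|f (x + h) - f x - L h| <= e * `|h|) ->
  differentiable f x.
Proof.
move=> Lc H; have E : f \o shift x = cst (f x) + L +o_ 0 id.
  apply/eqaddoP => e e0; have := H e e0.
  by apply: filterS => h; rewrite !fctE /= [h + x]addrC opprD addrA.
have dE := diff_unique Lc E.
by apply/diff_locallyP; rewrite dE.
Qed.


Section MatrixCalculus.
Variables (K : numFieldType) (V : normedModType K).
Implicit Types (x : V).

Lemma diff_of_near (W : normedModType K) (f : V -> W) (L : {linear V -> W}) x :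
  continuous L ->
  (forall e : K, 0 < e ->
    \forall h \near (0 : V), `|f (x + h) - f x - L h| <= e * `|h|) ->
  'd f x = L :> (V -> W).
Proof.
move=> Lc H; apply: diff_unique => //; apply/eqaddoP => e e0; have := H e e0.
by apply: filterS => h; rewrite !fctE /= [h + x]addrC opprD addrA.
Qed.

(** Charts are total functions with arbitrary values off their domains, so two coordinate
    expressions agree at best near a point; this transports differentiability along such local
    equalities. *)
Lemma near_eq_diff (W : normedModType K) (f g : V -> W) x :
  (\forall y \near x, f y = g y) -> differentiable f x ->
  differentiable g x /\ 'd g x = 'd f x :> (V -> W).
Proof.
move=> fg fd; have gn (e : K) : 0 < e ->
    \forall h \near (0 : V), `|g (x + h) - g x - 'd f x h| <= e * `|h|.
  move=> e0; rewrite -(nbhs_singleton fg).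
  have fg' : \forall h \near (0 : V), f (x + h) = g (x + h).
    have := fg; rewrite (near_shift 0) subr0.
    by apply: filterS => h; rewrite /= addrC.
  by apply: filterS2 (differentiable_near fd e0) fg' => h + <-.
have dc := diff_continuous fd.
by split; [exact: differentiable_of_near dc gn|exact: diff_of_near dc gn].
Qed.

Lemma differentiable_bigsum (W : normedModType K) (I : Type) (r : seq I)
    (P : pred I) (f : I -> V -> W) x : (forall i, differentiable (f i) x) ->
  differentiable (fun y => \sum_(i <- r | P i) f i y) x.
Proof.
move=> fd; elim: r => [|i r IH].
  have -> : (fun y => \sum_(i <- [::] | P i) f i y) = cst 0.
    by apply/funext => y; rewrite big_nil.
  exact: differentiable_cst.
have -> : (fun y => \sum_(j <- i :: r | P j) f j y) =
   if P i then f i + (fun y => \sum_(j <- r | P j) f j y)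
   else fun y => \sum_(j <- r | P j) f j y.
  by apply/funext => y; rewrite big_cons; case: (P i).
by case: (P i) => //; exact: differentiableD.
Qed.

Lemma differentiable_bigprod (I : Type) (r : seq I)
    (P : pred I) (f : I -> V -> K) x : (forall i, differentiable (f i) x) ->
  differentiable (fun y => \prod_(i <- r | P i) f i y) x.
Proof.
move=> fd; elim: r => [|i r IH].
  have -> : (fun y => \prod_(i <- [::] | P i) f i y) = cst 1.
    by apply/funext => y; rewrite big_nil.
  exact: differentiable_cst.
have -> : (fun y => \prod_(j <- i :: r | P j) f j y) =
   if P i then f i * (fun y => \prod_(j <- r | P j) f j y)
   else fun y => \prod_(j <- r | P j) f j y.
  by apply/funext => y; rewrite big_cons; case: (P i).
by case: (P i) => //; exact: differentiableM.
Qed.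

Lemma differentiable_entry a b (A : V -> 'M[K]_(a, b)) x i j :
  differentiable A x -> differentiable (fun y => A y i j) x.
Proof.
move=> Ad; apply: (@differentiable_comp _ _ _ _ A (fun M : 'M[K]_(a, b) => M i j)).
  exact: Ad.
exact: differentiable_coord.
Qed.

Lemma diff_entry a b (A : V -> 'M[K]_(a, b)) x v i j :
  differentiable A x -> 'd (fun y => A y i j) x v = ('d A x v) i j.
Proof.
move=> Ad; pose pr := fun M : 'M[K]_(a, b) => M i j.
have prl : linear pr by move=> k y z; rewrite /pr !mxE.
pose lin := GRing.isLinear.Build _ _ _ _ _ prl.
pose pr' : {linear 'M[K]_(a, b) -> K} := HB.pack pr lin.
have prd M : differentiable pr M := differentiable_coord M i j.
have prc : continuous pr' by move=> M; exact: differentiable_continuous.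
have := @diff_comp _ _ _ _ A pr x Ad (prd (A x)).
have -> : 'd pr (A x) = pr :> (_ -> _) by exact: (diff_lin (f := pr') (A x) prc).
by move=> /(congr1 (fun h => h v)).
Qed.

Lemma differentiable_matrix a b (A : V -> 'M[K]_(a, b)) x :
  (forall i j, differentiable (fun y => A y i j) x) -> differentiable A x.
Proof.
move=> Ad.
have -> : A = fun y => \sum_i \sum_j A y i j *: delta_mx i j.
  by apply/funext => y; exact: matrix_sum_delta.
apply: differentiable_bigsum => i; apply: differentiable_bigsum => j.
exact: differentiableZl.
Qed.

Lemma differentiable_mulmx a b c (A : V -> 'M[K]_(a, b)) (B : V -> 'M[K]_(b, c)) x :
  differentiable A x -> differentiable B x ->
  differentiable (fun y => A y *m B y) x.
Proof.
move=> Ad Bd; apply: differentiable_matrix => i j.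
have -> : (fun y => (A y *m B y) i j) = fun y => \sum_k A y i k * B y k j.
  by apply/funext => y; rewrite mxE.
apply: differentiable_bigsum => k.
by apply: differentiableM; exact: differentiable_entry.
Qed.

Lemma differentiable_det a (A : V -> 'M[K]_a) x :
  differentiable A x -> differentiable (fun y => \det (A y)) x.
Proof.
move=> Ad; apply: differentiable_bigsum => s.
apply: differentiableM; first exact: differentiable_cst.
by apply: differentiable_bigprod => i; exact: differentiable_entry.
Qed.

Lemma differentiable_adjugate a (A : V -> 'M[K]_a) x :
  differentiable A x -> differentiable (fun y => \adj (A y)) x.
Proof.
move=> Ad; apply: differentiable_matrix => i j.
have -> : (fun y => (\adj (A y)) i j) =
    fun y => (-1) ^+ (j + i) * \det (row' j (col' i (A y))).
  by apply/funext => y; rewrite mxE.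
apply: differentiableM; first exact: differentiable_cst.
apply: differentiable_det; apply: differentiable_matrix => k l.
have -> : (fun y => (row' j (col' i (A y))) k l) = fun y => A y (lift j k) (lift i l).
  by apply/funext => y; rewrite !mxE.
exact: differentiable_entry.
Qed.

Lemma near_unitmx a (A : V -> 'M[K]_a) x : {for x, continuous (fun y => \det (A y))} ->
  A x \in unitmx -> \forall y \near x, A y \in unitmx.
Proof.
move=> dc; rewrite unitmxE unitfE => Ax.
have /cvgrPdist_lt /(_ `|\det (A x)|) := dc; rewrite normr_gt0 => /(_ Ax).
apply: filterS => y; rewrite unitmxE unitfE; apply: contraTneq => ->.
by rewrite subr0 ltxx.
Qed.

(** Cramer's formula describes [invmx] only on invertible matrices, an open condition, whence the
    passage through a neighbourhood. *)
Lemma differentiable_invmx a (A : V -> 'M[K]_a) x :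
  differentiable A x -> A x \in unitmx ->
  differentiable (fun y => invmx (A y)) x.
Proof.
move=> Ad Au; have dd := differentiable_det Ad.
have near_u := near_unitmx (differentiable_continuous dd) Au.
apply: (near_eq_diff (f := fun y => (\det (A y))^-1 *: \adj (A y)) _ _).1.
  by apply: filterS near_u => y yu; rewrite /invmx yu.
apply: differentiable_matrix => i j.
have -> : (fun y => ((\det (A y))^-1 *: \adj (A y)) i j) =
    fun y => (\det (A y))^-1 * (\adj (A y)) i j.
  by apply/funext => y; rewrite mxE.
apply: differentiableM; last by apply: differentiable_entry; exact: differentiable_adjugate.
apply: differentiableV; first exact: dd.
by move: Au; rewrite unitmxE unitfE.
Qed.

End MatrixCalculus.

(** * Holomorphy of the derivative *)

(* The instances giving R[i] its topology would otherwise compete with those of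
   the generic numClosedFieldType, through which R[i] is viewed in the theorem. *)
Module HolomorphicDerivative.

Import ComplexField.Normc.

Local Notation Re := complex.Re.
Local Notation Im := complex.Im.

#[non_forgetful_inheritance] HB.instance Definition _ (R : realType) :=
  PseudoPointedMetric.copy R[i] (R[i] : numClosedFieldType)^o.
#[non_forgetful_inheritance] HB.instance Definition _ (R : realType) :=
  GRing.ComAlgebra.copy R[i] (R[i] : numClosedFieldType)^o.
#[non_forgetful_inheritance] HB.instance Definition _ (R : realType) :=
  Vector.copy R[i] (R[i] : numClosedFieldType)^o.
#[non_forgetful_inheritance] HB.instance Definition _ (R : realType) :=
  NormedModule.copy R[i] (R[i] : numClosedFieldType)^o.

(** * Modulus and topology of R[i] in real terms *)

Section ComplexBasics.
Variable R : realType.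
Local Notation C := R[i].
Local Notation "x %:C" := (real_complex R x).
Implicit Types z w : C.

(** The norm of R[i] takes its values in R[i] itself. Estimates are made with the real-valued
    [normc], and this identity passes from one to the other. *)
Lemma normr_normc z : `|z| = (normc z)%:C.
Proof. by case: z => a b; rewrite normc_def. Qed.

Lemma normc_ge0 z : 0 <= normc z.
Proof. by case: z => a b; exact: sqrtr_ge0. Qed.

Lemma ltcR_norm z (e : R) : (`|z| < e%:C) = (normc z < e).
Proof. by rewrite normr_normc ltcR. Qed.

Lemma normc_real (x : R) : normc x%:C = `|x|.
Proof. by rewrite /= expr0n /= addr0 sqrtr_sqr. Qed.

Lemma normci : normc ('i%C : C) = 1.
Proof. by rewrite /= expr0n expr1n /= add0r sqrtr1. Qed.

Lemma normc_Re z : `|Re z| <= normc z.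
Proof. by rewrite -lecR -normr_normc normc_ge_Re. Qed.

Lemma normc_Im z : `|Im z| <= normc z.
Proof.
case: z => a b; rewrite /= -[leLHS]sqrtr_sqr ler_sqrt ?addr_ge0 ?sqr_ge0 //.
by rewrite lerDr sqr_ge0.
Qed.

Lemma normc_le_ReIm z : normc z <= `|Re z| + `|Im z|.
Proof.
rewrite {1}[z]complexE (le_trans (le_normcD _ _)) // normcM normci mul1r.
by rewrite !normc_real.
Qed.

Lemma complex_gt0P (e : C) : 0 < e -> exists2 r : R, 0 < r & e = r%:C.
Proof. by case: e => a b; rewrite ltcE /= => /andP[/eqP -> ?]; exists a. Qed.

Lemma nbhs_complexP (z : C) (P : C -> Prop) :
  (\forall w \near z, P w) <->
  exists2 d : R, 0 < d & forall w, normc (w - z) < d -> P w.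
Proof.
split=> [/nbhs_ballP[e /= /complex_gt0P[d d0 ->] H]|[d d0 H]].
  exists d => // w wd; apply: H; rewrite -ball_normE /=.
  by rewrite distrC ltcR_norm.
apply/nbhs_ballP; exists d%:C => /=; first by rewrite ltcR.
by move=> w; rewrite -ball_normE /= distrC ltcR_norm; exact: H.
Qed.

Lemma cvg_complexP (T : Type) (F : set_system T) (FF : Filter F)
    (f : T -> C) (l : C) :
  f x @[x --> F] --> l <->
  forall e : R, 0 < e -> \forall x \near F, normc (l - f x) < e.
Proof.
rewrite cvgrPdist_lt; split=> [H e e0|H _ /complex_gt0P[e e0 ->]].
  have /H : 0 < e%:C by rewrite ltcR.
  by apply: filterS => x; rewrite ltcR_norm.
by apply: filterS (H e e0) => x; rewrite ltcR_norm.
Qed.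

Lemma continuous_Re : continuous (@Re R : C -> R).
Proof.
move=> z; apply/(@cvgrPdist_lt _ _ _ (nbhs z)) => e e0.
apply/nbhs_complexP; exists e => // w.
apply: le_lt_trans; rewrite distrC; apply: le_trans (normc_Re _).
by case: w z => [? ?] [? ?].
Qed.

Lemma continuous_Im : continuous (@Im R : C -> R).
Proof.
move=> z; apply/(@cvgrPdist_lt _ _ _ (nbhs z)) => e e0.
apply/nbhs_complexP; exists e => // w.
apply: le_lt_trans; rewrite distrC; apply: le_trans (normc_Im _).
by case: w z => [? ?] [? ?].
Qed.

End ComplexBasics.

(** * Real integrals over a segment *)

Section RealIntegral.
Variable R : realType.
Implicit Types (f g : R -> R) (a b c : R).

(** Two-sided continuity is asked even at the end points: the integrands are restrictions of
    functions continuous in the plane, and this form composes without subspace topologies. *)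
Definition continuous_seg (T : topologicalType) a b (f : R -> T) :=
  forall x, a <= x <= b -> {for x, continuous f}.

Local Notation mu := (@lebesgue_measure R).

Lemma continuous_seg_integrable a b f :
  continuous_seg a b f -> mu.-integrable `[a, b] (EFin \o f).
Proof.
move=> fc; apply: continuous_compact_integrable; first exact: segment_compact.
apply: continuous_in_subspaceT => x; rewrite inE /= in_itv /=; exact: fc.
Qed.

Lemma continuous_seg_sub (T : topologicalType) a b c d (f : R -> T) :
  a <= c -> d <= b -> continuous_seg a b f -> continuous_seg c d f.
Proof.
move=> ac db fc x /andP[cx xd]; apply: fc.
by rewrite (le_trans ac) // (le_trans xd).
Qed.

Definition rint f a b : R := \int[mu]_(x in `[a, b]) f x.

Lemma rintD f g a b : continuous_seg a b f -> continuous_seg a b g ->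
  rint (fun x => f x + g x) a b = rint f a b + rint g a b.
Proof. by move=> *; rewrite /rint RintegralD //; exact: continuous_seg_integrable. Qed.

Lemma rintZ k f a b : continuous_seg a b f ->
  rint (fun x => k * f x) a b = k * rint f a b.
Proof. by move=> *; rewrite /rint RintegralZl //; exact: continuous_seg_integrable. Qed.

Lemma eq_rint f g a b : (forall x, a <= x <= b -> f x = g x) ->
  rint f a b = rint g a b.
Proof.
by move=> fg; apply: eq_Rintegral => x; rewrite inE /= in_itv; exact: fg.
Qed.

Lemma rint_cst k a b : a <= b -> rint (fun=> k) a b = k * (b - a).
Proof.
rewrite le_eqVlt /rint Rintegral_cst //= lebesgue_measure_itv /= lte_fin.
by case/predU1P=> [->|->//]; rewrite ltxx subrr.
Qed.

Lemma rint_split f a b c : a <= c <= b -> continuous_seg a b f ->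
  rint f a b = rint f a c + rint f c b.
Proof.
move=> /andP[ac cb] fc; rewrite /rint.
have fi := continuous_seg_integrable fc.
(* Splitting at c gives [a, c] and ]c, b]; adding the point c to the second interval does not change
   its integral. *)
have := @Rintegral_itvB R f (BLeft a) (BRight b) c fi.
rewrite !bnd_simp => /(_ ac cb) E.
rewrite -(Rintegral_itv_obnd_cbnd (r := c)) -?E; first by rewrite addrC subrK.
apply: (@integrableS _ _ _ mu `[c, b]) => //.
  by apply: subset_itvr; rewrite bnd_simp.
by apply: continuous_seg_integrable; apply: continuous_seg_sub fc.
Qed.

Lemma le_rint f g a b : continuous_seg a b f -> continuous_seg a b g ->
  (forall x, a <= x <= b -> f x <= g x) -> rint f a b <= rint g a b.
Proof.
by move=> fc gc fg; apply: le_Rintegral => //; exact: continuous_seg_integrable.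
Qed.

Lemma normr_rint f M a b : a <= b -> continuous_seg a b f ->
  (forall x, a <= x <= b -> `|f x| <= M) -> `|rint f a b| <= M * (b - a).
Proof.
move=> ab fc fM; rewrite ler_norml -mulNr -!rint_cst //.
have cc k : continuous_seg a b (fun=> k : R) by move=> x _; exact: cvg_cst.
by apply/andP; split; apply: le_rint => // x /fM; rewrite ler_norml => /andP[].
Qed.

End RealIntegral.

(** * Complex-valued integrals over a segment *)

Section ComplexIntegral.
Variable R : realType.
Local Notation C := R[i].
Local Notation "x %:C" := (real_complex R x).
Implicit Types (f g : R -> C) (a b c : R).

Definition cint f a b : C := (rint (fun x => Re (f x)) a b)%:C +
  'i%C * (rint (fun x => Im (f x)) a b)%:C.

Lemma continuous_seg_Re f a b :
  continuous_seg a b f -> continuous_seg a b (fun x => Re (f x)).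
Proof. move=> fc x /fc fx; apply: continuous_comp => //; exact: continuous_Re. Qed.

Lemma continuous_seg_Im f a b :
  continuous_seg a b f -> continuous_seg a b (fun x => Im (f x)).
Proof. move=> fc x /fc fx; apply: continuous_comp => //; exact: continuous_Im. Qed.

Lemma eq_cint f g a b : (forall x, a <= x <= b -> f x = g x) ->
  cint f a b = cint g a b.
Proof.
by move=> fg; rewrite /cint; congr (_%:C + _ * _%:C); apply: eq_rint => x /fg ->.
Qed.

Lemma cintD f g a b : continuous_seg a b f -> continuous_seg a b g ->
  cint (fun x => f x + g x) a b = cint f a b + cint g a b.
Proof.
move=> fc gc; rewrite /cint.
have -> : (fun x => Re (f x + g x)) = (fun x => Re (f x) + Re (g x)).
  by apply/funext => x; case: (f x) (g x) => [? ?] [? ?].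
have -> : (fun x => Im (f x + g x)) = (fun x => Im (f x) + Im (g x)).
  by apply/funext => x; case: (f x) (g x) => [? ?] [? ?].
rewrite !rintD; try exact: continuous_seg_Re; try exact: continuous_seg_Im.
by rewrite !rmorphD /=; ring.
Qed.

Lemma cintZ k f a b : continuous_seg a b f ->
  cint (fun x => k * f x) a b = k * cint f a b.
Proof.
move=> fc; rewrite /cint.
have fR := continuous_seg_Re fc; have fI := continuous_seg_Im fc.
have kR r (h : R -> R) : continuous_seg a b h ->
    continuous_seg a b (fun x => r * h x).
  by move=> hc x /hc hx; apply: cvgM => //; exact: cvg_cst.
have -> : (fun x => Re (k * f x)) =
    (fun x => Re k * Re (f x) + - Im k * Im (f x)).
  by apply/funext => x; case: (f x) k => [? ?] [? ?] /=; rewrite mulNr.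
have -> : (fun x => Im (k * f x)) = (fun x => Re k * Im (f x) + Im k * Re (f x)).
  by apply/funext => x; case: (f x) k => [? ?] [? ?] /=.
rewrite !rintD ?rintZ //; try exact: kR.
rewrite {5}[k]complexE !rmorphD !rmorphM rmorphN /=.
have := sqr_i R; set ii := 'i%C; set p := _%:C; set q := _%:C.
set u := _%:C; set v := _%:C => i2.
have -> : (u + ii * v) * (p + ii * q) =
   u * p + ii ^+ 2 * v * q + ii * (u * q + v * p) by ring.
by rewrite i2; ring.
Qed.

Lemma cintN f a b : continuous_seg a b f ->
  cint (fun x => - f x) a b = - cint f a b.
Proof.
by move=> fc; rewrite -mulN1r -cintZ //; apply: eq_cint => x _; rewrite mulN1r.
Qed.

Lemma cintB f g a b : continuous_seg a b f -> continuous_seg a b g ->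
  cint (fun x => f x - g x) a b = cint f a b - cint g a b.
Proof.
move=> fc gc; rewrite -(cintN gc).
have gNc : continuous_seg a b (fun x => - g x).
  move=> x /gc gx.
  exact: (continuousN gx).
rewrite -(cintD fc gNc).
by [].
Qed.

Lemma cint_cst (k : C) a b : a <= b -> cint (fun=> k) a b = k * (b - a)%:C.
Proof.
move=> ab; rewrite /cint !rint_cst // [in RHS](complexE k) !rmorphM /=.
by rewrite mulrDl mulrA.
Qed.

Lemma cint_split f a b c : a <= c <= b -> continuous_seg a b f ->
  cint f a b = cint f a c + cint f c b.
Proof.
move=> acb fc; rewrite /cint !(rint_split acb).
- by rewrite !rmorphD /=; ring.
- exact: continuous_seg_Im.
- exact: continuous_seg_Re.
Qed.

(** Real and imaginary parts are bounded separately, whence the factor 2, which reappears in the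
    later constants 4 and 16. *)
Lemma normc_cint f (M : R) a b : a <= b -> continuous_seg a b f ->
  (forall x, a <= x <= b -> normc (f x) <= M) ->
  normc (cint f a b) <= 2 * M * (b - a).
Proof.
move=> ab fc fM; rewrite (le_trans (le_normcD _ _)) // normcM normci mul1r.
rewrite !normc_real -mulrA mulr_natl mulr2n lerD //; apply: normr_rint => //.
- exact: continuous_seg_Re.
- by move=> x /fM; apply: le_trans; exact: normc_Re.
- exact: continuous_seg_Im.
- by move=> x /fM; apply: le_trans; exact: normc_Im.
Qed.

End ComplexIntegral.

(** * Goursat's theorem on rectangles *)

Section Goursat.
Variable R : realType.
Local Notation C := R[i].
Local Notation "x %:C" := (real_complex R x).
Implicit Types (F G : C -> C) (a b c d x y : R) (z w : C).

(** A C-linear endomorphism of C is the multiplication by its value at 1. *)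
Lemma differentiable_complex F z : differentiable F z ->
  exists D : C, forall e : R, 0 < e -> exists2 r : R, 0 < r &
    forall w, normc (w - z) < r ->
      normc (F w - F z - D * (w - z)) <= e * normc (w - z).
Proof.
move=> dF; exists ('d F z 1) => e e0.
have e0' : 0 < e%:C by rewrite ltcR.
have /nbhs_complexP[r r0 H] := differentiable_near dF e0'.
exists r => // w wr; have := H (w - z); rewrite subr0 => /(_ wr).
rewrite [z + _]addrC subrK -{1}[w - z]mulr1 -[_ * 1]/(_ *: 1) linearZ /=.
by rewrite -[_ *: _]/(_ * _) [(w - z) * _]mulrC !normr_normc -rmorphM lecR.
Qed.

Lemma continuous_horizontal y : continuous (fun x => (x +i* y)%C : C).
Proof.
move=> x; apply/cvg_complexP => e e0; near=> t.
suff -> : (x +i* y)%C - (t +i* y)%C = (x - t)%:C.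
  rewrite normc_real; near: t.
  by have /cvgrPdist_lt := @cvg_id _ (nbhs x); exact.
by apply/eqP; rewrite eq_complex /=; apply/andP; split; apply/eqP; ring.
Unshelve. all: by end_near. Qed.

Lemma continuous_vertical x : continuous (fun y => (x +i* y)%C : C).
Proof.
move=> y; apply/cvg_complexP => e e0; near=> t.
suff -> : (x +i* y)%C - (x +i* t)%C = 'i%C * (y - t)%:C.
  rewrite normcM normci mul1r normc_real; near: t.
  by have /cvgrPdist_lt := @cvg_id _ (nbhs y); exact.
by apply/eqP; rewrite eq_complex /=; apply/andP; split; apply/eqP; ring.
Unshelve. all: by end_near. Qed.

Definition continuous_hside F y a b := forall x, a <= x <= b ->
  {for (x +i* y)%C, continuous F}.

Definition continuous_vside F x c d := forall y, c <= y <= d ->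
  {for (x +i* y)%C, continuous F}.

Lemma continuous_hsideP F y a b : continuous_hside F y a b ->
  continuous_seg a b (fun x => F (x +i* y)%C).
Proof.
move=> Fc x /Fc Fx; apply: continuous_comp; first exact: continuous_horizontal.
exact: Fx.
Qed.

Lemma continuous_vsideP F x c d : continuous_vside F x c d ->
  continuous_seg c d (fun y => F (x +i* y)%C).
Proof.
move=> Fc y /Fc Fy; apply: continuous_comp; first exact: continuous_vertical.
exact: Fy.
Qed.

Lemma continuous_segB (f g : R -> C) a b : continuous_seg a b f ->
  continuous_seg a b g -> continuous_seg a b (fun x => f x - g x).
Proof.
by move=> fc gc x xab; exact: (continuousB (fc x xab) (gc x xab)).
Qed.

Lemma continuous_segD (f g : R -> C) a b : continuous_seg a b f ->
  continuous_seg a b g -> continuous_seg a b (fun x => f x + g x).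
Proof.
by move=> fc gc x xab; exact: (continuousD (fc x xab) (gc x xab)).
Qed.

(** The counterclockwise integral of F(z) dz along the boundary of [a, b] x [c, d], opposite sides
    being paired in one integrand. *)
Definition rectint F a b c d : C :=
  cint (fun x => F (x +i* c)%C - F (x +i* d)%C) a b +
  'i%C * cint (fun y => F (b +i* y)%C - F (a +i* y)%C) c d.

Definition continuous_sides F a b c d :=
  [/\ continuous_hside F c a b, continuous_hside F d a b,
      continuous_vside F a c d & continuous_vside F b c d].

(** The two smaller rectangles run through their common side x = m in opposite directions. *)
Lemma rectint_split_x F a b c d m : a <= m <= b ->
  continuous_sides F a b c d -> continuous_vside F m c d ->
  rectint F a b c d = rectint F a m c d + rectint F m b c d.
Proof.
move=> amb [/continuous_hsideP Hc /continuous_hsideP Hd].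
move=> /continuous_vsideP Va /continuous_vsideP Vb /continuous_vsideP Vm.
rewrite /rectint (cint_split amb (continuous_segB Hc Hd)).
rewrite (cintB Vb Va) (cintB Vb Vm) (cintB Vm Va).
set p := cint _ a m; set q := cint _ m b.
set u := cint _ c d; set v := cint _ c d; set t := cint _ c d; ring.
Qed.

Lemma rectint_split_y F a b c d m : c <= m <= d ->
  continuous_sides F a b c d -> continuous_hside F m a b ->
  rectint F a b c d = rectint F a b c m + rectint F a b m d.
Proof.
move=> cmd [/continuous_hsideP Hc /continuous_hsideP Hd].
move=> /continuous_vsideP Va /continuous_vsideP Vb /continuous_hsideP Hm.
rewrite /rectint (cint_split cmd (continuous_segB Vb Va)).
rewrite (cintB Hc Hd) (cintB Hc Hm) (cintB Hm Hd).
set p := cint _ c m; set q := cint _ m d.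
set u := cint _ a b; set v := cint _ a b; set t := cint _ a b; ring.
Qed.

Lemma rectintD F G a b c d :
  continuous_sides F a b c d -> continuous_sides G a b c d ->
  rectint (fun z => F z + G z) a b c d = rectint F a b c d + rectint G a b c d.
Proof.
move=> [/continuous_hsideP Fc /continuous_hsideP Fd].
move=> /continuous_vsideP Fa /continuous_vsideP Fb.
move=> [/continuous_hsideP Gc /continuous_hsideP Gd].
move=> /continuous_vsideP Ga /continuous_vsideP Gb.
rewrite /rectint (cintB (continuous_segD Fc Gc) (continuous_segD Fd Gd)).
rewrite (cintB (continuous_segD Fb Gb) (continuous_segD Fa Ga)).
rewrite (cintD Fc Gc) (cintD Fd Gd) (cintD Fa Ga) (cintD Fb Gb).
rewrite (cintB Fc Fd) (cintB Fb Fa) (cintB Gc Gd) (cintB Gb Ga).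
set i := 'i%C; ring.
Qed.

Lemma rectintZ F k a b c d : continuous_sides F a b c d ->
  rectint (fun z => k * F z) a b c d = k * rectint F a b c d.
Proof.
move=> [/continuous_hsideP Fc /continuous_hsideP Fd].
move=> /continuous_vsideP Fa /continuous_vsideP Fb.
rewrite /rectint [RHS]mulrDr [k * ('i%C * _)]mulrCA; congr (_ + 'i%C * _).
  rewrite -cintZ; last exact: continuous_segB.
  by apply: eq_cint => x _; rewrite mulrBr.
rewrite -cintZ; last exact: continuous_segB.
by apply: eq_cint => x _; rewrite mulrBr.
Qed.

(** An affine function differs by a constant between opposite sides, so both integrals are explicit
    and cancel; this takes the place of a primitive. *)
Lemma rectint_affine (k l : C) a b c d : a <= b -> c <= d ->
  rectint (fun z => k + l * z) a b c d = 0.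
Proof.
move=> ab cd; rewrite /rectint.
rewrite (@eq_cint _ _ (fun=> l * 'i%C * (c - d)%:C)); last first.
  move=> x _; rewrite opprD addrACA subrr add0r -mulrBr -mulrA; congr (_ * _).
  by apply/eqP; rewrite eq_complex /=; apply/andP; split; apply/eqP; ring.
rewrite [X in 'i%C * X](@eq_cint _ _ (fun=> l * (b - a)%:C)); last first.
  move=> x _; rewrite opprD addrACA subrr add0r -mulrBr; congr (_ * _).
  by apply/eqP; rewrite eq_complex /=; apply/andP; split; apply/eqP; ring.
rewrite !cint_cst // -opprB rmorphN /=.
set i := 'i%C; set u := _%:C; set v := _%:C; ring.
Qed.

Lemma normc_rectint F (M : R) a b c d : a <= b -> c <= d ->
  continuous_sides F a b c d ->
  (forall x, a <= x <= b ->
    normc (F (x +i* c)%C) <= M /\ normc (F (x +i* d)%C) <= M) ->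
  (forall y, c <= y <= d ->
    normc (F (a +i* y)%C) <= M /\ normc (F (b +i* y)%C) <= M) ->
  normc (rectint F a b c d) <= 4 * M * ((b - a) + (d - c)).
Proof.
move=> ab cd [/continuous_hsideP Fc /continuous_hsideP Fd].
move=> /continuous_vsideP Fa /continuous_vsideP Fb hM vM.
rewrite (le_trans (le_normcD _ _)) // normcM normci mul1r.
have -> : 4 * M = 2 * (M + M) by ring.
rewrite [leRHS]mulrDr; apply: lerD.
  apply: (normc_cint ab (continuous_segB Fc Fd)) => x /hM[Mc Md].
  by apply: le_trans (le_normcD _ _) _; rewrite normcN; exact: lerD.
apply: (normc_cint cd (continuous_segB Fb Fa)) => y /vM[Ma Mb].
by apply: le_trans (le_normcD _ _) _; rewrite normcN; exact: lerD.
Qed.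

Lemma nested_intervals (u v : nat -> R) :
  (forall n, u n <= u n.+1) -> (forall n, v n.+1 <= v n) ->
  (forall n, u n <= v n) -> exists t : R, forall n, u n <= t <= v n.
Proof.
move=> uS vS uv.
have uk n k : u n <= u (n + k)%N.
  by elim: k => [|k IH]; rewrite ?addn0 // addnS (le_trans IH).
have vk n k : v (n + k)%N <= v n.
  by elim: k => [|k IH]; rewrite ?addn0 // addnS (le_trans _ IH).
have ub n k : u n <= v k.
  by rewrite (le_trans (uk n k)) // (le_trans (uv _)) // addnC vk.
exists (sup (range u)) => n; apply/andP; split.
  by apply: ub_le_sup; [exists (v 0%N) => _ [k _ <-]|exists n].
by apply: ge_sup; [exists (u 0%N), 0%N|move=> _ [k _ <-]].
Qed.

Definition differentiable_rect F a b c d := forall x y,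
  a <= x <= b -> c <= y <= d -> differentiable F (x +i* y)%C.

Lemma differentiable_rect_sub F a b c d a' b' c' d' :
  a <= a' -> b' <= b -> c <= c' -> d' <= d ->
  differentiable_rect F a b c d -> differentiable_rect F a' b' c' d'.
Proof.
move=> aa bb cc dd FD x y /andP[? ?] /andP[? ?]; apply: FD; apply/andP; split.
- exact: le_trans aa _.
- exact: le_trans bb.
- exact: le_trans cc _.
- exact: le_trans dd.
Qed.

Lemma differentiable_rect_sides F a b c d : a <= b -> c <= d ->
  differentiable_rect F a b c d -> continuous_sides F a b c d.
Proof.
move=> ab cd FD; split=> t tab; apply: differentiable_continuous;
  by apply: FD => //; rewrite lexx ?ab ?cd.
Qed.

(** One of four terms is at least a quarter of their sum. It is stated for plain reals, to keep
    integrals out of the linear arithmetic. *)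
Lemma quarter_gt (s p1 p2 p3 p4 : R) : s <= p1 + p2 + (p3 + p4) ->
  4 * p1 < s -> 4 * p2 < s -> 4 * p3 < s -> 4 * p4 < s -> False.
Proof. by lra. Qed.

(** Rectangles are given by a corner and their dimensions, so that each of the four quarters has
    dimensions exactly w / 2 and h / 2 and only the corner has to be chosen in the iteration. *)
Lemma rectint_halve F a c (w h : R) : 0 <= w -> 0 <= h ->
  differentiable_rect F a (a + w) c (c + h) -> exists a' c',
  [/\ a <= a' /\ a' + w / 2 <= a + w, c <= c' /\ c' + h / 2 <= c + h &
   normc (rectint F a (a + w) c (c + h)) <=
   4 * normc (rectint F a' (a' + w / 2) c' (c' + h / 2))].
Proof.
move=> w0 h0 FD; pose m := a + w / 2; pose k := c + h / 2.
have mw : m + w / 2 = a + w by rewrite /m; field.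
have kh : k + h / 2 = c + h by rewrite /k; field.
have w2 : 0 <= w / 2 by rewrite divr_ge0.
have h2 : 0 <= h / 2 by rewrite divr_ge0.
have am : a <= m by rewrite lerDl.
have mb : m <= a + w by rewrite -mw lerDl.
have ck : c <= k by rewrite lerDl.
have kd : k <= c + h by rewrite -kh lerDl.
have ab := le_trans am mb; have cd := le_trans ck kd.
have E : rectint F a (a + w) c (c + h) =
    rectint F a m c k + rectint F a m k (c + h) +
    (rectint F m (a + w) c k + rectint F m (a + w) k (c + h)).
  have FDl : differentiable_rect F a m c (c + h).
    exact: differentiable_rect_sub FD.
  have FDr : differentiable_rect F m (a + w) c (c + h).
    exact: differentiable_rect_sub FD.
  have Hl := differentiable_rect_sides am cd FDl.
  have Hr := differentiable_rect_sides mb cd FDr.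
  have amb : a <= m <= a + w by rewrite am.
  have ckd : c <= k <= c + h by rewrite ck.
  have Vm : continuous_vside F m c (c + h) by case: Hl.
  have Hlk : continuous_hside F k a m.
    by move=> x xam; apply: differentiable_continuous; apply: FDl.
  have Hrk : continuous_hside F k m (a + w).
    by move=> x xam; apply: differentiable_continuous; apply: FDr.
  rewrite (rectint_split_x amb (differentiable_rect_sides ab cd FD) Vm).
  by rewrite (rectint_split_y ckd Hl Hlk) (rectint_split_y ckd Hr Hrk).
have N : normc (rectint F a (a + w) c (c + h)) <=
    normc (rectint F a m c k) + normc (rectint F a m k (c + h)) +
    (normc (rectint F m (a + w) c k) + normc (rectint F m (a + w) k (c + h))).
  by rewrite E; apply: le_trans (le_normcD _ _) _; apply: lerD; exact: le_normcD.
set I := normc _ in N *.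
have [H1|H1] := leP I (4 * normc (rectint F a m c k)).
  by exists a, c; rewrite !lexx.
have [H2|H2] := leP I (4 * normc (rectint F a m k (c + h))).
  by exists a, k; rewrite kh !lexx.
have [H3|H3] := leP I (4 * normc (rectint F m (a + w) c k)).
  by exists m, c; rewrite mw !lexx.
have [H4|H4] := leP I (4 * normc (rectint F m (a + w) k (c + h))).
  by exists m, k; rewrite mw kh !lexx.
by case: (quarter_gt N H1 H2 H3 H4).
Qed.

Lemma scale_cancel (q e t : R) : q != 0 ->
  q * q * (4 * (e * (t / q)) * (t / q)) = e * (4 * t ^+ 2).
Proof. by move=> q0; field. Qed.

(** By repeated bisection the chosen quarters shrink to a point z, where F is affine up to an error
    e |u - z|. The affine part integrates to 0; on the n-th rectangle, of half-perimeter T / 2^n,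
    the error contributes at most 4 e (T / 2^n)^2. The factor 4^n lost in n bisections leaves 4 e
    T^2, for every e > 0. *)
Lemma Goursat_rect F a b c d : a <= b -> c <= d ->
  differentiable_rect F a b c d -> rectint F a b c d = 0.
Proof.
move=> ab cd FD.
pose w (n : nat) := (b - a) / 2 ^+ n; pose h (n : nat) := (d - c) / 2 ^+ n.
have w_ge0 n : 0 <= w n by rewrite divr_ge0 ?subr_ge0 ?exprn_ge0.
have h_ge0 n : 0 <= h n by rewrite divr_ge0 ?subr_ge0 ?exprn_ge0.
have wS n : w n.+1 = w n / 2 by rewrite /w exprSr invfM mulrA.
have hS n : h n.+1 = h n / 2 by rewrite /h exprSr invfM mulrA.
pose ins n (s : R * R) := [/\ a <= s.1, s.1 + w n <= b, c <= s.2 & s.2 + h n <= d].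
pose J n (s : R * R) := rectint F s.1 (s.1 + w n) s.2 (s.2 + h n).
pose good n (s t : R * R) := [/\ s.1 <= t.1 /\ t.1 + w n.+1 <= s.1 + w n,
  s.2 <= t.2 /\ t.2 + h n.+1 <= s.2 + h n & normc (J n s) <= 4 * normc (J n.+1 t)].
have step (p : nat * (R * R)) : exists t, ins p.1 p.2 -> good p.1 p.2 t.
  (* The choice function has to be total; for a corner whose rectangle leaves the given one, (0, 0)
     is a dummy value. *)
  have [[i1 i2 i3 i4]|Ni] := pselect (ins p.1 p.2); last by exists (0, 0).
  have FD' : differentiable_rect F p.2.1 (p.2.1 + w p.1) p.2.2 (p.2.2 + h p.1).
    exact: differentiable_rect_sub FD.
  have [x [y [Hx Hy HJ]]] := rectint_halve (w_ge0 p.1) (h_ge0 p.1) FD'.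
  by exists (x, y) => _; rewrite /good /J wS hS.
have [nxt nxtP] := choice step.
pose s := fix s n := if n is k.+1 then nxt (k, s k) else (a, c).
have insS n : ins n (s n).
  elim: n => [|n [i1 i2 i3 i4]].
    by rewrite /ins /= /w /h expr0 !divr1 !(addrC _ (_ - _)) !subrK !lexx.
  have [[g1 g2] [g3 g4] _] := nxtP (n, s n) (And4 i1 i2 i3 i4).
  split=> /=; [exact: le_trans i1 g1|exact: le_trans g2 i2|
    exact: le_trans i3 g3|exact: le_trans g4 i4].
have sP n : good n (s n) (s n.+1) by apply: (nxtP (n, s n)).
have [zx zxP] : exists t : R, forall n, (s n).1 <= t <= (s n).1 + w n.
  apply: nested_intervals => n; last by rewrite lerDl.
    by case: (sP n) => -[].
  by case: (sP n) => -[].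
have [zy zyP] : exists t : R, forall n, (s n).2 <= t <= (s n).2 + h n.
  apply: nested_intervals => n; last by rewrite lerDl.
    by case: (sP n) => _ -[].
  by case: (sP n) => _ -[].
have JE n : normc (rectint F a b c d) <= 4 ^+ n * normc (J n (s n)).
  elim: n => [|n IH].
    by rewrite /J /w /h /= expr0 !divr1 mul1r !(addrC _ (_ - _)) !subrK.
  rewrite (le_trans IH) // exprSr -mulrA ler_pM2l ?exprn_gt0 //.
  by case: (sP n).
have Fz : differentiable F (zx +i* zy)%C.
  have := zxP 0%N; have := zyP 0%N; rewrite /= /w /h expr0 !divr1.
  by rewrite !(addrC _ (_ - _)) !subrK => ? ?; apply: FD.
have [D DP] := differentiable_complex Fz.
set z := (zx +i* zy)%C in Fz DP; pose T := (b - a) + (d - c).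
have T0 : 0 <= T by rewrite addr_ge0 ?subr_ge0.
have whT n : w n + h n = T / 2 ^+ n by rewrite -mulrDl.
suff H e : 0 < e -> normc (rectint F a b c d) <= e * (4 * T ^+ 2).
  apply/eq0_normc/eqP; rewrite eq_le normc_ge0 andbT.
  apply/ler_addgt0Pr => e e0; rewrite add0r.
  (* Adding 1 keeps the divisor positive when the rectangle is reduced to a point and T = 0. *)
  have p0 : 0 < 4 * T ^+ 2 + 1 by rewrite ltr_pwDr // mulr_ge0 ?sqr_ge0.
  have := H (e / (4 * T ^+ 2 + 1)) (divr_gt0 e0 p0); move/le_trans; apply.
  by rewrite mulrAC ler_pdivrMr // ler_pM2l // lerDl.
move=> e0; have [r r0 rP] := DP e e0.
have [n nP] : exists n, T / 2 ^+ n < r.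
  have [n nP] : exists n, T / r < n%:R.
    by exists (Num.bound (T / r)); rewrite archi_boundP ?divr_ge0 // ltW.
  exists n; rewrite ltr_pdivrMr ?exprn_gt0 // mulrC -ltr_pdivrMr //.
  rewrite (lt_trans nP) // -natrX ltr_nat ltn_expl //.
have close x y : (s n).1 <= x <= (s n).1 + w n -> (s n).2 <= y <= (s n).2 + h n ->
    normc ((x +i* y)%C - z) <= T / 2 ^+ n.
  move=> /andP[x1 x2] /andP[y1 y2]; have /andP[u1 u2] := zxP n.
  have /andP[v1 v2] := zyP n; rewrite -whT.
  apply: (le_trans (normc_le_ReIm _)); apply: lerD; rewrite /= ler_norml; lra.
pose E (u : C) := F u - (F z + D * (u - z)).
have EP x y : (s n).1 <= x <= (s n).1 + w n -> (s n).2 <= y <= (s n).2 + h n ->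
    normc (E (x +i* y)%C) <= e * (T / 2 ^+ n).
  move=> xP yP; have cl := close x y xP yP.
  rewrite /E opprD addrA (le_trans (rP _ _)) ?(le_lt_trans cl) //.
  by rewrite ler_pM2l.
have [i1 i2 i3 i4] := insS n.
have wn := w_ge0 n; have hn := h_ge0 n.
have xw : (s n).1 <= (s n).1 + w n by rewrite lerDl.
have yh : (s n).2 <= (s n).2 + h n by rewrite lerDl.
have FDn : differentiable_rect F (s n).1 ((s n).1 + w n) (s n).2 ((s n).2 + h n).
  exact: differentiable_rect_sub FD.
have Fs := differentiable_rect_sides xw yh FDn.
pose A u := (- F z + D * z) + (- D) * u.
have Ad u : differentiable A u.
  apply: differentiableD; first exact: differentiable_cst.
  apply: differentiableM; [exact: differentiable_cst|exact: ex_diff].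
have As : continuous_sides A (s n).1 ((s n).1 + w n) (s n).2 ((s n).2 + h n).
  apply: (differentiable_rect_sides xw yh); move=> ? ? _ _; exact: Ad.
have JnE : J n (s n) = rectint E (s n).1 ((s n).1 + w n) (s n).2 ((s n).2 + h n).
  have -> : E = (fun u => F u + A u) by apply/funext => u; rewrite /E /A; ring.
  by rewrite (rectintD Fs As) (rectint_affine _ _ xw yh) addr0.
have Es : continuous_sides E (s n).1 ((s n).1 + w n) (s n).2 ((s n).2 + h n).
  have -> : E = (fun u => F u + A u) by apply/funext => u; rewrite /E /A; ring.
  apply: (differentiable_rect_sides xw yh) => x y xP yP.
  apply: differentiableD; [exact: FDn|exact: Ad].
have JnB : normc (J n (s n)) <= 4 * (e * (T / 2 ^+ n)) * (T / 2 ^+ n).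
  rewrite JnE -[X in _ <= _ * X]whT.
  have := normc_rectint (M := e * (T / 2 ^+ n)) xw yh Es.
  have addKB (p q : R) : p + q - p = q by ring.
  rewrite !addKB; apply=> t tP.
    by split; apply: EP => //; rewrite lexx ?xw ?yh.
  by split; apply: EP => //; rewrite lexx ?xw ?yh.
apply: (le_trans (JE n)).
rewrite (le_trans (ler_wpM2l _ JnB)) ?exprn_ge0 //.
have -> : 4 ^+ n = 2 ^+ n * 2 ^+ n :> R by rewrite -exprMn; congr (_ ^+ _); ring.
have n0 : 2 ^+ n != 0 :> R by rewrite expf_neq0 ?pnatr_eq0.
by rewrite (scale_cancel _ _ n0).
Qed.

End Goursat.

(** * Cauchy's formula for the derivative on a square *)

Section Cauchy.
Variable R : realType.
Local Notation C := R[i].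
Local Notation "x %:C" := (real_complex R x).
Implicit Types (F G : C -> C) (a b c d x y : R) (z w : C).

(** The strips left of a' and right of b', then the pieces below c' and above d', are cut off one
    after the other. None of the four contains p, so Goursat's theorem annihilates each; every cut
    misses p, so F is continuous along it although it may be singular at p. *)
Lemma rectint_excise F (p : C) a b c d a' b' c' d' :
  a <= a' < Re p -> Re p < b' <= b -> c <= c' < Im p -> Im p < d' <= d ->
  (forall x y, a <= x <= b -> c <= y <= d -> (x +i* y)%C != p ->
    differentiable F (x +i* y)%C) ->
  rectint F a b c d = rectint F a' b' c' d'.
Proof.
move=> /andP[aa' a'p] /andP[pb' bb'] /andP[cc' c'p] /andP[pd' dd'] FD.
have xne x y : x != Re p -> (x +i* y)%C != p.
  by apply: contra => /eqP <-.
have yne x y : y != Im p -> (x +i* y)%C != p.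
  by apply: contra => /eqP <-.
have a'b' := lt_trans a'p pb'; have c'd' := lt_trans c'p pd'.
have ca x y : a <= x <= b -> c <= y <= d -> (x +i* y)%C != p ->
    {for (x +i* y)%C, continuous F}.
  by move=> xP yP /(FD _ _ xP yP) /differentiable_continuous.
have cv x c0 d0 : a <= x <= b -> c <= c0 -> d0 <= d -> x != Re p ->
    continuous_vside F x c0 d0.
  move=> xP cc0 dd0 xp y /andP[y1 y2]; apply: (ca) => //; last exact: xne.
  by rewrite (le_trans cc0) // (le_trans y2).
have ch y a0 b0 : c <= y <= d -> a <= a0 -> b0 <= b -> y != Im p ->
    continuous_hside F y a0 b0.
  move=> yP aa0 bb0 yp x /andP[x1 x2]; apply: (ca) => //; last exact: yne.
  by rewrite (le_trans aa0) // (le_trans x2).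
have ineq : [/\ a <= b', a' <= b, c <= d' & c' <= d].
  split; [exact: le_trans aa' (ltW a'b')|exact: le_trans (ltW a'b') bb'|
    exact: le_trans cc' (ltW c'd')|exact: le_trans (ltW c'd') dd'].
case: ineq => ab' a'b cd' c'd.
have ab := le_trans ab' bb'; have cd := le_trans cd' dd'.
have na : a != Re p by rewrite lt_eqF // (le_lt_trans aa').
have na' : a' != Re p by rewrite lt_eqF.
have nb' : b' != Re p by rewrite gt_eqF.
have nb : b != Re p by rewrite gt_eqF // (lt_le_trans pb').
have nc : c != Im p by rewrite lt_eqF // (le_lt_trans cc').
have nc' : c' != Im p by rewrite lt_eqF.
have nd' : d' != Im p by rewrite gt_eqF.
have nd : d != Im p by rewrite gt_eqF // (lt_le_trans pd').
have Ba : a <= a <= b by rewrite lexx ab.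
have Ba' : a <= a' <= b by rewrite aa' a'b.
have Bb' : a <= b' <= b by rewrite ab' bb'.
have Bb : a <= b <= b by rewrite ab lexx.
have Bc : c <= c <= d by rewrite lexx cd.
have Bc' : c <= c' <= d by rewrite cc' c'd.
have Bd' : c <= d' <= d by rewrite cd' dd'.
have Bd : c <= d <= d by rewrite cd lexx.
have Ba'' : a' <= b' <= b by rewrite (ltW a'b') bb'.
have Bc'' : c' <= d' <= d by rewrite (ltW c'd') dd'.
have lx := @lexx _ R.
rewrite (rectint_split_x Ba' (And4 (ch _ _ _ Bc (lx _) (lx _) nc)
  (ch _ _ _ Bd (lx _) (lx _) nd) (cv _ _ _ Ba (lx _) (lx _) na)
  (cv _ _ _ Bb (lx _) (lx _) nb)) (cv _ _ _ Ba' (lx _) (lx _) na')).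
rewrite (rectint_split_x Ba'' (And4 (ch _ _ _ Bc aa' (lx _) nc)
  (ch _ _ _ Bd aa' (lx _) nd) (cv _ _ _ Ba' (lx _) (lx _) na')
  (cv _ _ _ Bb (lx _) (lx _) nb)) (cv _ _ _ Bb' (lx _) (lx _) nb')).
rewrite (rectint_split_y Bc' (And4 (ch _ _ _ Bc aa' bb' nc)
  (ch _ _ _ Bd aa' bb' nd) (cv _ _ _ Ba' (lx _) (lx _) na')
  (cv _ _ _ Bb' (lx _) (lx _) nb')) (ch _ _ _ Bc' aa' bb' nc')).
rewrite (rectint_split_y Bc'' (And4 (ch _ _ _ Bc' aa' bb' nc')
  (ch _ _ _ Bd aa' bb' nd) (cv _ _ _ Ba' cc' (lx _) na')
  (cv _ _ _ Bb' cc' (lx _) nb')) (ch _ _ _ Bd' aa' bb' nd')).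
rewrite (@Goursat_rect _ F a a' c d) //; last first.
  move=> x y /andP[x1 x2] yP; apply: (FD) => //.
    by rewrite x1 (le_trans x2).
  by apply: xne; rewrite lt_eqF // (le_lt_trans x2).
rewrite (@Goursat_rect _ F b' b c d) //; last first.
  move=> x y /andP[x1 x2] yP; apply: (FD) => //.
    by rewrite x2 (le_trans ab').
  by apply: xne; rewrite gt_eqF // (lt_le_trans pb').
rewrite (@Goursat_rect _ F a' b' c c') ?(ltW a'b') //; last first.
  move=> x y /andP[x1 x2] /andP[y1 y2]; apply: (FD).
  - by rewrite (le_trans aa') // (le_trans x2).
  - by rewrite y1 (le_trans y2).
  - by apply: yne; rewrite lt_eqF // (le_lt_trans y2).
rewrite (@Goursat_rect _ F a' b' d' d) ?(ltW a'b') //; last first.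
  move=> x y /andP[x1 x2] /andP[y1 y2]; apply: (FD).
  - by rewrite (le_trans aa') // (le_trans x2).
  - by rewrite y2 (le_trans cd').
  - by apply: yne; rewrite gt_eqF // (lt_le_trans pd').
by rewrite !add0r !addr0.
Qed.

(** The contour is the boundary of a square of side 2 about 0 instead of a circle: Goursat's theorem
    for rectangles then applies as it is, without a parametrization of arcs. *)
Definition square_int F : C := rectint F (-1) 1 (-1) 1.

Definition square (z : C) := (-1 <= Re z <= 1) /\ (-1 <= Im z <= 1).

Lemma lerN11 : -1 <= 1 :> R. Proof. by lra. Qed.

Lemma square_normc z : square z -> normc z <= 2.
Proof.
move=> [zR zI]; rewrite (le_trans (normc_le_ReIm _)) //.
have : `|Re z| <= 1 by rewrite ler_norml.
have : `|Im z| <= 1 by rewrite ler_norml.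
by lra.
Qed.

Definition contour (z : C) := square z /\ (`|Re z| = 1 \/ `|Im z| = 1).

Lemma contour_normc z : contour z -> 1 <= normc z.
Proof.
by move=> [_ [<-|<-]]; [exact: normc_Re|exact: normc_Im].
Qed.

Lemma contour_neq0 z : contour z -> z != 0.
Proof.
move=> /contour_normc; apply: contraTneq => ->.
by rewrite /= expr0n /= addr0 sqrtr0 -ltNge ltr01.
Qed.

Lemma contour_sides (P : C -> Prop) : (forall z, contour z -> P z) ->
  (forall x, -1 <= x <= 1 -> P (x +i* (-1))%C /\ P (x +i* 1)%C) /\
  (forall y, -1 <= y <= 1 -> P ((-1) +i* y)%C /\ P (1 +i* y)%C).
Proof.
have N := lerN11.
by move=> cP; split=> t tP; split; apply: cP; split=> /=;
  rewrite ?normrN ?normr1 /square /= ?lexx ?lerN11; auto.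
Qed.

Definition continuous_contour F := forall z, contour z -> {for z, continuous F}.

Lemma continuous_contour_sides F : continuous_contour F ->
  continuous_sides F (-1) 1 (-1) 1.
Proof.
move=> /contour_sides[hP vP].
split=> t tP; [exact: (hP t tP).1|exact: (hP t tP).2|exact: (vP t tP).1|].
exact: (vP t tP).2.
Qed.

Lemma square_intD F G : continuous_contour F -> continuous_contour G ->
  square_int (fun z => F z + G z) = square_int F + square_int G.
Proof.
move=> /continuous_contour_sides Fc /continuous_contour_sides Gc.
exact: rectintD.
Qed.

Lemma square_intZ k F : continuous_contour F ->
  square_int (fun z => k * F z) = k * square_int F.
Proof. by move=> /continuous_contour_sides Fc; exact: rectintZ. Qed.

Lemma normc_square_int F (M : R) : continuous_contour F ->
  (forall z, contour z -> normc (F z) <= M) -> normc (square_int F) <= 16 * M.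
Proof.
move=> /continuous_contour_sides Fc /contour_sides[hM vM].
have := normc_rectint lerN11 lerN11 Fc hM vM.
by have -> : 4 * M * (1 - -1 + (1 - -1)) = 16 * M by ring.
Qed.

Lemma eq_square_int F G : (forall z, contour z -> F z = G z) ->
  square_int F = square_int G.
Proof.
move=> /contour_sides[hE vE]; rewrite /square_int /rectint; congr (_ + _ * _).
  by apply: eq_cint => x /hE[-> ->].
by apply: eq_cint => x /vE[-> ->].
Qed.

Lemma continuous_contourV : continuous_contour (fun z => z^-1).
Proof. by move=> z /contour_neq0 z0; apply: continuousV. Qed.

Lemma differentiable_inv z : z != 0 -> differentiable (fun w : C => w^-1) z.
Proof. move=> z0; apply: differentiableV => //; exact: ex_diff. Qed.

Lemma continuous_contour_M F G : continuous_contour F ->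
  continuous_contour G -> continuous_contour (fun z => F z * G z).
Proof. by move=> Fc Gc z cz; exact: (continuousM (Fc z cz) (Gc z cz)). Qed.

Lemma continuous_contour_cst k : continuous_contour (fun=> k).
Proof. by move=> z _; exact: cst_continuous. Qed.

Lemma continuous_contourZ (k : C) F : continuous_contour F ->
  continuous_contour (fun z => k * F z).
Proof.
by move=> Fc; exact: (@continuous_contour_M (fun=> k) F (@continuous_contour_cst k) Fc).
Qed.

Lemma continuous_contourD F G : continuous_contour F ->
  continuous_contour G -> continuous_contour (fun z => F z + G z).
Proof. by move=> Fc Gc z cz; exact: (continuousD (Fc z cz) (Gc z cz)). Qed.

(* Their values are 2 pi i and 0; only [winding1 != 0] is needed. *)
Definition winding1 : C := square_int (fun z => z^-1).
Definition winding2 : C := square_int (fun z => z^-1 * z^-1).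

(** On paired opposite sides 1/z contributes i h(x) and h(y), with h(x) = 2 / (x^2 + 1). The
    imaginary part of the integral is thus twice the integral of h over [-1, 1], and h >= 1
    there. *)
Lemma winding1_neq0 : winding1 != 0.
Proof.
pose h (x : R) := 2 / (x ^+ 2 + 1).
have d0 (x : R) : x ^+ 2 + 1 != 0 by rewrite gt_eqF // ltr_wpDl ?sqr_ge0.
have hc : continuous_seg (-1) 1 h.
  move=> x _; have sq : {for x, continuous (fun t : R => t ^+ 2 + 1)}.
    apply: continuousD; last exact: cst_continuous.
    by apply: (@continuousM _ _ id id); exact: cvg_id.
  apply: (@continuousM _ _ (fun=> 2)); first exact: cst_continuous.
  exact: continuousV.
have hE x : h x = 2 / (x ^+ 2 + 1) by [].
have E1 x : (x +i* (-1))%C^-1 - (x +i* 1)%C^-1 = (0 +i* h x)%C :> C.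
  apply/eqP; rewrite eq_complex /= hE; apply/andP.
  by split; apply/eqP; rewrite ?sqrrN expr1n; field; exact: d0.
have E2 y : (1 +i* y)%C^-1 - ((-1) +i* y)%C^-1 = (h y +i* 0)%C :> C.
  apply/eqP; rewrite eq_complex /= hE; apply/andP.
  by split; apply/eqP; rewrite ?sqrrN expr1n; field; rewrite ?(addrC 1); exact: d0.
have E : Im winding1 = 2 * rint h (-1) 1.
  rewrite /winding1 /square_int /rectint.
  rewrite (eq_cint (g := fun x => (0 +i* h x)%C)) => [|x _]; last exact: E1.
  rewrite [X in 'i%C * X](eq_cint (g := fun y => (h y +i* 0)%C)) => [|y _]; last exact: E2.
  by rewrite /cint /=; ring.
apply/eqP => W0; move: E; rewrite W0 /=.
have : 1 * (1 - -1) <= rint h (-1) 1.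
  rewrite -(rint_cst _ lerN11); apply: le_rint => //.
    by move=> x _; exact: cst_continuous.
  move=> x /andP[x1 x2]; rewrite /h ler_pdivlMr ?ltr_wpDl ?sqr_ge0 // mul1r.
  by have : x ^+ 2 <= 1; [nra|lra].
by lra.
Qed.

(** With D = phi'(0), the function [chi] is (phi(z) - phi(0) - D z) / z^2, expanded into the three
    terms of the formula. It is holomorphic off 0 and at most e / |z| near 0. After excision of all
    but a square of half-side n its integral is at most 16 e, whatever n, so it vanishes. *)
Lemma cauchy_deriv (phi : C -> C) :
  (forall z, square z -> differentiable phi z) ->
  'd phi 0 1 * winding1 =
    square_int (fun z => phi z * (z^-1 * z^-1)) - phi 0 * winding2.
Proof.
move=> phiD.
have s0 : square 0 by split => /=; rewrite oppr_le0 ler01.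
have phic : continuous_contour phi.
  by move=> z [sz _]; apply: differentiable_continuous; exact: phiD.
have i1c := continuous_contourV.
have i2c := continuous_contour_M i1c i1c.
set D := 'd phi 0 1.
pose chi z := phi z * (z^-1 * z^-1) + (- phi 0 * (z^-1 * z^-1) + - D * z^-1).
have chiE : square_int chi = square_int (fun z => phi z * (z^-1 * z^-1)) +
    (- phi 0 * winding2 + - D * winding1).
  have c1 := continuous_contour_M phic i2c.
  have c2 := continuous_contourZ (k := - phi 0) i2c.
  have c3 := continuous_contourZ (k := - D) i1c.
  rewrite /chi (square_intD c1 (continuous_contourD c2 c3)) (square_intD c2 c3).
  by rewrite (square_intZ _ i2c) (square_intZ _ i1c).
have aux (s p q d v : C) : 0 = s + (- p * q + - d * v) -> d * v = s - p * q.
  move=> E; apply/eqP; rewrite -subr_eq0 -oppr_eq0; apply/eqP.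
  by rewrite [RHS]E; ring.
suff chi0 : square_int chi = 0 by exact: aux (etrans (esym chi0) chiE).
have chiD z : square z -> z != 0 -> differentiable chi z.
  move=> sz z0; have d1 := differentiable_inv z0.
  have d2 := differentiableM d1 d1.
  have dk k F : differentiable F z -> differentiable (fun w => k * F w) z.
    by move=> dF; exact: (differentiableM (differentiable_cst k z) dF).
  exact: (differentiableD (differentiableM (phiD z sz) d2)
    (differentiableD (dk (- phi 0) _ d2) (dk (- D) _ d1))).
have chib (e : R) : 0 < e -> normc (square_int chi) <= 16 * e.
  move=> e0; have e0' : 0 < e%:C by rewrite ltcR.
  have /nbhs_complexP[r r0 H] := differentiable_near (phiD 0 s0) e0'.
  (* 1 / 2 keeps the small square inside the large one; r / 4 keeps it in the disc of radius r, as
     |z| <= 2 n on it. *)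
  pose n := Num.min (1 / 2) (r / 4).
  have n0 : 0 < n by rewrite lt_min !divr_gt0.
  have n1 : n <= 1 by rewrite ge_min; apply/orP; left; lra.
  have nr : 2 * n < r.
    have : n <= r / 4 by rewrite ge_min lexx orbT.
    by move: r0; clear; move: n => {}n; lra.
  have in_square x y : -1 <= x <= 1 -> -1 <= y <= 1 -> square (x +i* y)%C by [].
  rewrite /square_int (@rectint_excise chi 0 _ _ _ _ (- n) n (- n) n) /=; last first.
  - by move=> x y xP yP; apply: chiD.
  - by rewrite n0 n1.
  - by rewrite oppr_lt0 n0 lerN2 n1.
  - by rewrite n0 n1.
  - by rewrite oppr_lt0 n0 lerN2 n1.
  have small z : `|Re z| <= n -> `|Im z| <= n -> n <= normc z ->
      normc (chi z) <= e / n /\ {for z, continuous chi}.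
    move=> zR zI nz; have z0 : z != 0.
      apply: contraTneq nz => ->.
      by rewrite /= expr0n /= addr0 sqrtr0 -ltNge.
    split; last first.
      apply: differentiable_continuous; apply: chiD => //.
      by split; rewrite -ler_norml; [exact: le_trans zR n1|exact: le_trans zI n1].
    have zr : normc z < r.
      by rewrite (le_lt_trans (normc_le_ReIm z)) // (le_lt_trans _ nr) //
        mulr_natl mulr2n lerD.
    have := H z; rewrite subr0 => /(_ zr); rewrite add0r.
    have -> : 'd phi 0 z = z * D.
      by rewrite -{1}[z]mulr1 -[_ * 1]/(_ *: 1) linearZ.
    have -> : chi z = (phi z - phi 0 - z * D) * (z^-1 * z^-1).
      by rewrite /chi; field.
    rewrite !normr_normc -rmorphM lecR !normcM normcV => B.
    have zp := lt_le_trans n0 nz.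
    apply: le_trans (ler_wpM2r _ B) _; first by rewrite mulr_ge0 ?invr_ge0 ?ltW.
    rewrite mulrA mulfK ?gt_eqF // ler_pM2l // lef_pV2 ?posrE //.
  have N : - n <= n by rewrite ge0_cp // ltW.
  have hs y : `|y| = n -> forall x, - n <= x <= n ->
      normc (chi (x +i* y)%C) <= e / n /\ {for (x +i* y)%C, continuous chi}.
    move=> yn x xP; apply: (small (x +i* y)%C).
    - by rewrite ler_norml.
    - by rewrite /= yn.
    - by rewrite -[leLHS]yn; exact: (normc_Im (x +i* y)%C).
  have vs x : `|x| = n -> forall y, - n <= y <= n ->
      normc (chi (x +i* y)%C) <= e / n /\ {for (x +i* y)%C, continuous chi}.
    move=> xn y yP; apply: (small (x +i* y)%C).
    - by rewrite /= xn.
    - by rewrite ler_norml.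
    - by rewrite -[leLHS]xn; exact: (normc_Re (x +i* y)%C).
  have an : `|n| = n by rewrite gtr0_norm.
  have aNn : `|- n| = n by rewrite normrN.
  have cs : continuous_sides chi (- n) n (- n) n.
    split=> t tP; [exact: (hs _ aNn t tP).2|exact: (hs _ an t tP).2|
      exact: (vs _ aNn t tP).2|exact: (vs _ an t tP).2].
  have := normc_rectint N N cs (fun x xP => conj (hs _ aNn x xP).1 (hs _ an x xP).1)
    (fun y yP => conj (vs _ aNn y yP).1 (vs _ an y yP).1).
  suff -> : 4 * (e / n) * (n - - n + (n - - n)) = 16 * e by [].
  by field; rewrite gt_eqF.
apply/eq0_normc/eqP; rewrite eq_le normc_ge0 andbT.
apply/ler_addgt0Pr => e e0; rewrite add0r.
have := chib (e / 16); rewrite divr_gt0 // => /(_ isT).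
by have -> : 16 * (e / 16) = e by field.
Qed.

End Cauchy.

(** * Real-valued norm of a complex normed module *)

Section RealNorm.
Variable R : realType.
Local Notation C := R[i].
Local Notation "x %:C" := (real_complex R x).
Variable V : normedModType C.
Implicit Types (x y : V) (k : C).

Definition rnorm x : R := Re `|x|.

Lemma rnormE x : `|x| = (rnorm x)%:C.
Proof. by rewrite RRe_real // normr_real. Qed.

Lemma rnorm_ge0 x : 0 <= rnorm x.
Proof. by rewrite -lecR -rnormE normr_ge0. Qed.

Lemma rnormD x y : rnorm (x + y) <= rnorm x + rnorm y.
Proof. by rewrite -lecR rmorphD /= -!rnormE ler_normD. Qed.

Lemma rnormZ k x : rnorm (k *: x) = normc k * rnorm x.
Proof.
by apply: (@complexI R); rewrite rmorphM /= -!rnormE normrZ normr_normc.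
Qed.

Lemma rnormN x : rnorm (- x) = rnorm x.
Proof. by rewrite /rnorm normrN. Qed.

Lemma rnorm_eq0 x : rnorm x = 0 -> x = 0.
Proof. by move=> x0; apply/eqP; rewrite -normr_eq0 rnormE x0. Qed.

Lemma nbhs_rnormP x (P : V -> Prop) :
  (\forall y \near x, P y) <->
  exists2 d : R, 0 < d & forall y, rnorm (y - x) < d -> P y.
Proof.
split=> [/nbhs_ballP[e /= /complex_gt0P[d d0 ->] H]|[d d0 H]].
  exists d => // w wd; apply: H; rewrite -ball_normE /=.
  by rewrite distrC rnormE ltcR.
apply/nbhs_ballP; exists d%:C => /=; first by rewrite ltcR.
by move=> w; rewrite -ball_normE /= distrC rnormE ltcR; exact: H.
Qed.

End RealNorm.

(** * Mean value inequality along a segment *)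

Section MeanValue.
Variable R : realType.
Local Notation C := R[i].
Local Notation "x %:C" := (real_complex R x).

Lemma is_derive_near (h : R -> R) (t l : R) :
  (forall e : R, 0 < e -> \forall s \near 0, `|h (s + t) - h t - s * l| <= e * `|s|) ->
  is_derive t 1 h l.
Proof.
move=> H; have hl : s^-1 *: ((h \o shift t) (s *: 1) - h t) @[s --> 0^'] --> l.
  apply/cvgrPdist_le => e e0; rewrite near_withinE.
  apply: filterS (H e e0) => s sP s0 /=.
  have -> : s *: 1 = s :> R by exact: mulr1.
  rewrite distrC -[l](mulKf s0) -[_ *: _]/(_ * _) -mulrBr normrM normfV.
  by rewrite ler_pdivrMl ?normr_gt0 // [leRHS]mulrC.
by apply: DeriveDef; [apply/cvg_ex; exists l|exact: cvg_lim].
Qed.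

Lemma real_mean_value (h dh : R -> R) (M : R) :
  (forall t : R, 0 <= t <= 1 -> is_derive t 1 h (dh t)) ->
  (forall t : R, 0 <= t <= 1 -> `|dh t| <= M) -> `|h 1 - h 0| <= M.
Proof.
move=> hd dM.
have hc : {within `[0, 1], continuous h}.
  apply: continuous_in_subspaceT => t; rewrite inE /= in_itv /= => /hd dt.
  by apply/differentiable_continuous/derivable1_diffP; case: dt.
have hd' (t : R) : t \in `]0, 1[ -> is_derive t 1 h (dh t).
  by rewrite in_itv /= => /andP[t0 t1]; apply: hd; rewrite !ltW.
have [c] := MVT ltr01 hd' hc; rewrite in_itv /= => /andP[c0 c1] ->.
by rewrite subr0 mulr1; apply: dM; rewrite !ltW.
Qed.

Variable V : normedModType C.

(** The mean value theorem fails for complex values; it is applied to the real and the imaginary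
    part on the segment, whence the factor 2. *)
Lemma complex_mean_value (g : V -> C) (z u : V) (M : R) :
  (forall t : R, 0 <= t <= 1 -> differentiable g (z + t%:C *: u)) ->
  (forall t : R, 0 <= t <= 1 -> normc ('d g (z + t%:C *: u) u) <= M) ->
  normc (g (z + u) - g z) <= 2 * M.
Proof.
move=> gd gM; pose dg (t : R) : C := 'd g (z + t%:C *: u) u.
have key (e t : R) : 0 < e -> 0 <= t <= 1 -> \forall s \near (0 : R),
    normc (g (z + (s + t)%:C *: u) - g (z + t%:C *: u) - s%:C * dg t) <= e * `|s|.
  move=> e0 tP; have p0 : 0 < rnorm u + 1 by rewrite ltr_wpDl ?rnorm_ge0.
  have e0' : 0 < (e / (rnorm u + 1))%:C by rewrite ltcR divr_gt0.
  have /nbhs_rnormP[d d0 H] := differentiable_near (gd t tP) e0'.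
  near=> s; have sd : rnorm (s%:C *: u - 0) < d.
    rewrite subr0 rnormZ normc_real.
    suff : `|s| < d / (rnorm u + 1).
      rewrite ltr_pdivlMr // => /le_lt_trans; apply.
      by rewrite ler_wpM2l // lerDl.
    near: s; apply/nbhs_normP; exists (d / (rnorm u + 1)); first exact: divr_gt0.
    by move=> s; rewrite /= sub0r normrN.
  have := H _ sd.
  have -> : z + t%:C *: u + s%:C *: u = z + (s + t)%:C *: u.
    by rewrite -addrA -scalerDl -rmorphD /= [t + s]addrC.
  have -> : 'd g (z + t%:C *: u) (s%:C *: u) = s%:C * dg t by rewrite linearZ.
  rewrite normr_normc rnormE -rmorphM lecR rnormZ normc_real => /le_trans; apply.
  rewrite mulrCA mulrC ler_wpM2r //.
  rewrite mulrAC ler_pdivrMr //.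
  by apply: ler_wpM2l; [exact: ltW|rewrite lerDl].
(* [p] stands for [Re] and for [Im]. *)
have part (p : C -> R) : (forall x y, p (x - y) = p x - p y) ->
    (forall (r : R) x, p (r%:C * x) = r * p x) ->
    (forall x, `|p x| <= normc x) -> `|p (g (z + u)) - p (g z)| <= M.
  move=> pB pZ pn.
  have := @real_mean_value (fun t => p (g (z + t%:C *: u))) (fun t => p (dg t)) M.
  rewrite scale1r scale0r addr0; apply=> t tP; last first.
    by rewrite (le_trans (pn _)) // gM.
  apply: is_derive_near => e e0; apply: filterS (key e t e0 tP) => s.
  by apply: le_trans; rewrite -pZ -!pB.
rewrite (le_trans (normc_le_ReIm _)) // mulr_natl mulr2n.
have -> : Re (g (z + u) - g z) = Re (g (z + u)) - Re (g z).
  by case: (g (z + u)) (g z) => [? ?] [? ?].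
have -> : Im (g (z + u) - g z) = Im (g (z + u)) - Im (g z).
  by case: (g (z + u)) (g z) => [? ?] [? ?].
apply: lerD; apply: part.
- by case=> [? ?] [? ?].
- by move=> r [x y] /=; ring.
- exact: normc_Re.
- by case=> [? ?] [? ?].
- by move=> r [x y] /=; ring.
- exact: normc_Im.
Unshelve. all: by end_near. Qed.

End MeanValue.

(** * Cauchy estimates: the differential is locally Lipschitz *)

Section CauchyEstimates.
Variable R : realType.
Local Notation C := R[i].
Local Notation "x %:C" := (real_complex R x).
Variable V : normedModType C.
Implicit Types (f g : V -> C) (z u v : V).
Local Notation w1 := (@winding1 R).
Local Notation w2 := (@winding2 R).

(** On a complex line the differential in the direction v is an ordinary derivative in one variable;
    the one-variable formula thus reaches functions on any normed module. *)
Lemma line_differentiable f z v (k : C) : differentiable f (z + k *: v) ->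
  differentiable (fun l : C => f (z + l *: v)) k /\
  'd (fun l : C => f (z + l *: v)) k 1 = 'd f (z + k *: v) v.
Proof.
move=> fd; pose h (l : C) := z + l *: v.
have hd : is_diff k h (fun l => l *: v).
  by apply: is_diff_eq; rewrite add0r.
have [hD hE] := hd; split; first exact: (@differentiable_comp _ _ _ _ h f k hD fd).
by rewrite (@diff_comp _ _ _ _ h f k hD fd) /= hE scale1r.
Qed.

Lemma line_cauchy f z v :
  (forall k, square k -> differentiable f (z + k *: v)) ->
  'd f z v * w1 =
    square_int (fun k => f (z + k *: v) * (k^-1 * k^-1)) - f z * w2.
Proof.
move=> fd.
have phiD k (sk : square k) := (line_differentiable (fd k sk)).
have := cauchy_deriv (fun k sk => (phiD k sk).1).
have s0 : square (0 : C) by split => /=; rewrite oppr_le0 ler01.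
by rewrite (phiD 0 s0).2 scale0r addr0.
Qed.

(** In Cauchy's formula for a function bounded by M, 16 M bounds the contour integral, where |k^-2|
    <= 1, [normc w2] times M bounds the term at the centre, and [w1] is the factor of the
    derivative. *)
Definition cauchy_const : R := (16 + normc w2) / normc w1.

Lemma normc_w1_gt0 : 0 < normc w1.
Proof.
rewrite lt_neqAle normc_ge0 andbT eq_sym; apply: contraNneq (winding1_neq0 R).
by move=> /eq0_normc ->.
Qed.

Lemma cauchy_const_ge0 : 0 <= cauchy_const.
Proof. by rewrite divr_ge0 ?addr_ge0 ?normc_ge0. Qed.

Lemma contour_comp_continuous f z v :
  (forall k, square k -> differentiable f (z + k *: v)) ->
  continuous_contour (fun k => f (z + k *: v)).
Proof.
move=> fd k [sk _]; apply: differentiable_continuous.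
exact: (line_differentiable (fd k sk)).1.
Qed.

Lemma continuous_contourV2 : continuous_contour (fun k : C => k^-1 * k^-1).
Proof. exact: (continuous_contour_M (@continuous_contourV R) (@continuous_contourV R)). Qed.

Lemma square_int_remainder (F : C -> C) (c : C) (M : R) :
  continuous_contour F -> 0 <= M ->
  (forall k, contour k -> normc (F k) <= M) -> normc c <= M ->
  normc (square_int (fun k => F k * (k^-1 * k^-1)) - c * w2)
    <= (16 + normc w2) * M.
Proof.
move=> Fc M0 FM cM; rewrite mulrDl; apply: le_trans (le_normcD _ _) _.
apply: lerD; last by rewrite normcN normcM mulrC ler_wpM2l ?normc_ge0.
apply: normc_square_int; first exact: (continuous_contour_M Fc continuous_contourV2).
move=> k ck; rewrite !normcM normcV -[leRHS]mulr1.
have k1 : (normc k)^-1 <= 1.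
  by rewrite invf_le1 ?(lt_le_trans ltr01) // contour_normc.
have k0 : 0 <= (normc k)^-1 by rewrite invr_ge0 normc_ge0.
apply: ler_pM; rewrite ?normc_ge0 ?mulr_ge0 ?FM //.
by rewrite -[leRHS]mulr1; apply: ler_pM.
Qed.

Lemma square_intB (F G : C -> C) : continuous_contour F -> continuous_contour G ->
  square_int F - square_int G = square_int (fun k => F k - G k).
Proof.
move=> Fc Gc; have GNc : continuous_contour (fun k => - 1 * G k).
  exact: continuous_contourZ.
rewrite -mulN1r -(square_intZ _ Gc) -(square_intD Fc GNc).
by apply: eq_square_int => k _; rewrite mulN1r.
Qed.

Lemma square0 : square (0 : C).
Proof. by split => /=; rewrite oppr_le0 ler01. Qed.

(** Cauchy's formula is linear in the function, so a bound for a difference along two parallel lines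
    passes to the derivatives. For g = f it turns a Lipschitz bound for f into one for its
    differential. *)
Lemma line_diff_bound f g z z' v (M : R) :
  (forall k, square k -> differentiable f (z + k *: v)) ->
  (forall k, square k -> differentiable g (z' + k *: v)) ->
  (forall k, square k -> normc (f (z + k *: v) - g (z' + k *: v)) <= M) ->
  normc ('d f z v - 'd g z' v) <= cauchy_const * M.
Proof.
move=> fd gd fgM.
have M0 : 0 <= M by apply: le_trans (fgM 0 square0); exact: normc_ge0.
rewrite mulrAC ler_pdivlMr ?normc_w1_gt0 // -normcM mulrBl.
have fc := contour_comp_continuous fd; have gc := contour_comp_continuous gd.
rewrite (line_cauchy fd) (line_cauchy gd).
have -> (a b c d : C) : a - c * w2 - (b - d * w2) = a - b - (c - d) * w2.
  by ring.
rewrite square_intB; last 2 first.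
- exact: (continuous_contour_M fc continuous_contourV2).
- exact: (continuous_contour_M gc continuous_contourV2).
have -> : (fun k => f (z + k *: v) * (k^-1 * k^-1) -
    g (z' + k *: v) * (k^-1 * k^-1)) =
    (fun k : C => (f (z + k *: v) - g (z' + k *: v)) * (k^-1 * k^-1)).
  by apply/funext => k; rewrite mulrBl.
apply: square_int_remainder.
- by move=> k ck; exact: (continuousB (fc k ck) (gc k ck)).
- exact: M0.
- by move=> k [sk _]; exact: fgM.
- by have := fgM 0 square0; rewrite !scale0r !addr0.
Qed.

Lemma line_bound f z v (M : R) :
  (forall k, square k -> differentiable f (z + k *: v)) ->
  (forall k, square k -> normc (f (z + k *: v)) <= M) ->
  normc ('d f z v) <= cauchy_const * M.
Proof.
move=> fd fM; have M0 : 0 <= M by apply: le_trans (fM 0 square0); exact: normc_ge0.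
rewrite mulrAC ler_pdivlMr ?normc_w1_gt0 // -normcM (line_cauchy fd).
apply: square_int_remainder; first exact: contour_comp_continuous.
- exact: M0.
- by move=> k [sk _]; exact: fM.
- by have := fM 0 square0; rewrite !scale0r !addr0.
Qed.

(** By homogeneity an estimate on the sphere of radius r becomes an operator bound. *)
Lemma scale_bound (l : V -> C) (r M : R) u : 0 < r ->
  (forall (k : C) v, l (k *: v) = k * l v) ->
  (forall v, rnorm v = r -> normc (l v) <= M) ->
  normc (l u) <= M / r * rnorm u.
Proof.
move=> r0 lZ lM; have [u0|u0] := eqVneq (rnorm u) 0.
  have -> : u = 0 *: u by rewrite scale0r; exact: rnorm_eq0.
  by rewrite lZ mul0r rnormZ /= expr0n /= addr0 sqrtr0 mul0r mulr0.
have up : 0 < rnorm u by rewrite lt_neqAle eq_sym u0 rnorm_ge0.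
pose t := r / rnorm u; have t0 : 0 < t by rewrite divr_gt0.
have := lM (t%:C *: u).
rewrite rnormZ lZ normcM normc_real gtr0_norm // divfK // => /(_ erefl) H.
rewrite -(ler_pM2l t0) (le_trans H) //.
suff -> : t * (M / r * rnorm u) = M by [].
by rewrite /t; field; rewrite u0 gt_eqF.
Qed.

Lemma rnorm_shift z z0 (k : C) v (r s : R) : rnorm (z - z0) < r ->
  square k -> rnorm v <= s -> rnorm (z + k *: v - z0) < r + 2 * s.
Proof.
move=> zr sk vs; rewrite addrAC (le_lt_trans (rnormD _ _)) // ltr_leD //.
rewrite rnormZ; apply: ler_pM => //; rewrite ?normc_ge0 ?rnorm_ge0 //.
exact: square_normc.
Qed.

Lemma rnorm_segment z u z0 (r t : R) : rnorm (z - z0) < r ->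
  rnorm (z + u - z0) < r -> 0 <= t <= 1 -> rnorm (z + t%:C *: u - z0) < r.
Proof.
move=> zr zur /andP[t0 t1].
have -> : z + t%:C *: u - z0 = (1 - t)%:C *: (z - z0) + t%:C *: (z + u - z0).
  rewrite rmorphB rmorph1 /= scalerBl scale1r [z + u - z0]addrAC.
  rewrite [t%:C *: (z - z0 + u)]scalerDr addrA subrK.
  by rewrite addrAC.
rewrite (le_lt_trans (rnormD _ _)) // !rnormZ !normc_real.
rewrite !ger0_norm ?subr_ge0 //.
have [->|tn] := eqVneq t 0; first by rewrite subr0 mul1r mul0r addr0.
have tp : 0 < t by rewrite lt_neqAle eq_sym tn.
have : (1 - t) * rnorm (z - z0) <= (1 - t) * r.
  by rewrite ler_wpM2l ?subr_ge0 // ltW.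
have : t * rnorm (z + u - z0) < t * r by rewrite ltr_pM2l.
by lra.
Qed.

(** Continuity at z0 bounds f on a ball of radius d = 5 r. A Cauchy estimate bounds the differential
    on radius 3 r, where f is then Lipschitz by the mean value inequality; a second Cauchy estimate,
    for differences, makes the differential Lipschitz on radius r. *)
Lemma diff_lipschitz f z0 : (\forall z \near z0, differentiable f z) ->
  exists r K : R, [/\ 0 < r, 0 <= K,
    forall z, rnorm (z - z0) < r -> differentiable f z,
    forall z u, rnorm (z - z0) < r -> normc ('d f z u) <= K * rnorm u &
    forall z z' u, rnorm (z - z0) < r -> rnorm (z' - z0) < r ->
      normc ('d f z u - 'd f z' u) <= K * rnorm (z - z') * rnorm u].
Proof.
move=> fn; have fz0 := nbhs_singleton fn.
have fc := differentiable_continuous fz0.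
have fb : \forall z \near z0, normc (f z0 - f z) < 1.
  by move/cvg_complexP: fc => /(_ 1 ltr01).
have [d d0 dP] : exists2 d : R, 0 < d &
    forall z, rnorm (z - z0) < d -> differentiable f z /\ normc (f z0 - f z) < 1.
  by apply/nbhs_rnormP; near=> z; split; near: z.
(* 5 = 1 + 2 + 2: each Cauchy estimate, with |v| = r and |k| <= 2 on the square, reaches 2 r further
   out. *)
pose r := d / 5; have r0 : 0 < r by rewrite divr_gt0.
have d5 : d = r + 2 * r + 2 * r by rewrite /r; field.
pose B := normc (f z0) + 1.
have fB z : rnorm (z - z0) < d -> normc (f z) <= B.
  move=> /dP[_ fz]; have -> : f z = f z0 - (f z0 - f z) by ring.
  by rewrite (le_trans (le_normcD _ _)) // normcN lerD2l ltW.
have B0 : 0 <= B by rewrite addr_ge0 ?normc_ge0.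
pose c := cauchy_const; have c0 : 0 <= c := cauchy_const_ge0.
pose K1 := c * B / r.
have K10 : 0 <= K1 by apply: divr_ge0; [exact: mulr_ge0|exact: ltW].
have S1 z u : rnorm (z - z0) < r + 2 * r -> normc ('d f z u) <= K1 * rnorm u.
  move=> zr; apply: (scale_bound (l := 'd f z)) => // [k v|v vr].
    by rewrite linearZ.
  have zk k : square k -> rnorm (z + k *: v - z0) < d.
    by move=> sk; rewrite d5; apply: rnorm_shift; rewrite ?vr.
  apply: line_bound => k sk; first exact: (dP _ (zk k sk)).1.
  exact: fB (zk k sk).
have rd : r + 2 * r < d by rewrite d5 ltrDl mulr_gt0.
have S2 z z' : rnorm (z - z0) < r + 2 * r -> rnorm (z' - z0) < r + 2 * r ->
    normc (f z - f z') <= 2 * (K1 * rnorm (z - z')).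
  move=> zr z'r; have E : z = z' + (z - z') by rewrite addrC subrK.
  rewrite {1}E; apply: complex_mean_value => t tP.
    apply: (dP _ _).1; apply: lt_trans rd.
    by apply: rnorm_segment => //; rewrite -E.
  by apply: S1; apply: rnorm_segment => //; rewrite -E.
pose K2 := c * (2 * K1) / r.
have K20 : 0 <= K2.
  by apply: divr_ge0; [apply: mulr_ge0 => //; exact: mulr_ge0|exact: ltW].
exists r, (K1 + K2); split.
- exact: r0.
- exact: addr_ge0.
- move=> z zr; apply: (dP _ _).1; apply: lt_trans rd.
  by rewrite (lt_trans zr) // ltrDl mulr_gt0.
- move=> z u zr; rewrite (le_trans (S1 z u _)) //.
    by rewrite (lt_trans zr) // ltrDl mulr_gt0.
  by rewrite ler_wpM2r ?rnorm_ge0 // lerDl.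
- move=> z z' u zr z'r.
  have : normc ('d f z u - 'd f z' u) <=
      c * (2 * (K1 * rnorm (z - z'))) / r * rnorm u.
    apply: (scale_bound (l := fun u => 'd f z u - 'd f z' u)) => // [k v|v vr].
      have E y : 'd f y (k *: v) = k * 'd f y v by rewrite linearZ.
      by rewrite !E mulrBr.
    have zk y (k : C) : rnorm (y - z0) < r -> square k ->
        rnorm (y + k *: v - z0) < r + 2 * r.
      by move=> yr sk; apply: rnorm_shift; rewrite ?vr.
    apply: line_diff_bound => k sk.
    - by apply: (dP _ _).1; apply: lt_trans rd; exact: zk.
    - by apply: (dP _ _).1; apply: lt_trans rd; exact: zk.
    - have := S2 _ _ (zk z k zr sk) (zk z' k z'r sk).
      by rewrite opprD addrACA subrr addr0.
  move/le_trans; apply; rewrite ler_wpM2r ?rnorm_ge0 //.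
  have -> : c * (2 * (K1 * rnorm (z - z'))) / r = K2 * rnorm (z - z').
    by rewrite /K2; field; rewrite gt_eqF.
  by rewrite ler_wpM2r ?rnorm_ge0 // lerDr.
Unshelve. all: by end_near. Qed.

End CauchyEstimates.

(** * Differentiability of the differential *)

Section DerivativeDifferentiable.
Variable R : realType.
Local Notation C := R[i].
Local Notation "x %:C" := (real_complex R x).
Variable V : normedModType C.
Implicit Types (f g : V -> C) (z u v : V).
Local Notation w1 := (@winding1 R).
Local Notation w2 := (@winding2 R).

(** The mean value inequality is applied to f minus its linear part at z. *)
Lemma diff_quadratic_remainder f z u (M : R) :
  (forall t : R, 0 <= t <= 1 -> differentiable f (z + t%:C *: u)) ->
  (forall t : R, 0 <= t <= 1 ->
    normc ('d f (z + t%:C *: u) u - 'd f z u) <= M) ->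
  normc (f (z + u) - f z - 'd f z u) <= 2 * M.
Proof.
move=> fd fM; pose g w := f w - 'd f z w.
have fz : differentiable f z.
  by have := fd 0; rewrite lexx ler01 scale0r addr0; apply.
have dd w : is_diff w ('d f z) ('d f z).
  have c := diff_continuous fz.
  by apply: DiffDef; [exact: linear_differentiable|exact: diff_lin].
have gd w : differentiable f w -> is_diff w g (fun u => 'd f w u - 'd f z u).
  by move=> fw; exact: (is_diffB (differentiableP fw) (dd w)).
have -> : f (z + u) - f z - 'd f z u = g (z + u) - g z.
  have aux (a b p q : C) : a - b - q = a - (p + q) - (b - p) by ring.
  by rewrite /g linearD; exact: aux.
apply: complex_mean_value => t tP; have [gD gE] := gd _ (fd t tP); first exact: gD.
by rewrite gE; exact: fM.
Qed.

(** The candidate [L] for the derivative is Cauchy's formula with f(z0 + k v) replaced by its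
    differential in the direction u, that is, the formula differentiated under the integral sign.
    The error is then the same formula applied to the Taylor remainder f(z + u + k v) - f(z + k v) -
    df(z + k v) u at z = z0, which is O(|u|^2) uniformly in k by the Lipschitz bound. The smallness
    of v keeps all these points in the ball of radius r. *)
Lemma diff_small_directional f v z0 (r K : R) : 0 < r -> 0 <= K ->
  (forall z, rnorm (z - z0) < r -> differentiable f z) ->
  (forall z u, rnorm (z - z0) < r -> normc ('d f z u) <= K * rnorm u) ->
  (forall z z' u, rnorm (z - z0) < r -> rnorm (z' - z0) < r ->
     normc ('d f z u - 'd f z' u) <= K * rnorm (z - z') * rnorm u) ->
  rnorm v <= r / 8 -> differentiable (fun z => 'd f z v) z0.
Proof.
move=> r0 K0 fD fK fL vr.
have r8 : r / 4 + 2 * (r / 8) < r by lra.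
have zk z (k : C) : rnorm (z - z0) < r / 4 -> square k ->
    rnorm (z + k *: v - z0) < r.
  by move=> zr sk; apply: lt_trans r8; apply: rnorm_shift.
have z00 : rnorm (z0 - z0) < r / 4.
  by rewrite subrr /rnorm normr0 /= divr_gt0.
(* Continuity in k is drawn from the Lipschitz bound, differentiability of the differential being
   the very thing under proof. *)
have dc u : continuous_contour (fun k : C => 'd f (z0 + k *: v) u).
  move=> k [sk _]; apply/(@cvg_complexP _ _ (nbhs k)) => e e0.
  apply/nbhs_complexP.
  have [d d0 dP] : exists2 d : R, 0 < d &
      forall l, normc (l - k) < d -> rnorm (z0 + l *: v - z0) < r.
    have kr := zk z0 k z00 sk.
    have vp : 0 < rnorm v + 1 by rewrite ltr_wpDl ?rnorm_ge0.
    exists ((r - rnorm (z0 + k *: v - z0)) / (rnorm v + 1)).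
      by rewrite divr_gt0 ?subr_gt0.
    move=> l; rewrite ltr_pdivlMr // => lk.
    have -> : z0 + l *: v - z0 = (z0 + k *: v - z0) + (l - k) *: v.
      by rewrite !(addrC z0) !addrK scalerBl addrC subrK.
    rewrite (le_lt_trans (rnormD _ _)) // -ltrBrDl (le_lt_trans _ lk) //.
    by rewrite rnormZ ler_wpM2l ?normc_ge0 // lerDl.
  have p0 : 0 < K * rnorm v * rnorm u + 1.
    by rewrite ltr_wpDl // !mulr_ge0 ?rnorm_ge0.
  exists (Num.min d (e / (K * rnorm v * rnorm u + 1))).
    by rewrite lt_min d0 divr_gt0.
  move=> l; rewrite lt_min => /andP[ld le].
  have := fL _ _ u (zk z0 k z00 sk) (dP l ld); move/le_lt_trans; apply.
  have -> : z0 + k *: v - (z0 + l *: v) = - ((l - k) *: v).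
    by rewrite opprD addrACA subrr add0r scalerBl opprB.
  rewrite rnormN rnormZ; move: le; rewrite ltr_pdivlMr // => le.
  apply: le_lt_trans le; rewrite mulrDr mulr1.
  have -> : K * (normc (l - k) * rnorm v) * rnorm u =
    normc (l - k) * (K * rnorm v * rnorm u) by ring.
  by rewrite lerDl normc_ge0.
have dc2 u : continuous_contour (fun k : C => 'd f (z0 + k *: v) u * (k^-1 * k^-1)).
  exact: (continuous_contour_M (dc u) (@continuous_contourV2 R)).
pose L u : C := w1^-1 *
  (square_int (fun k => 'd f (z0 + k *: v) u * (k^-1 * k^-1)) - 'd f z0 u * w2).
have Llin : linear L.
  move=> a x y; have -> : a *: L x + L y = a * L x + L y by [].
  rewrite /L [a * _]mulrCA -mulrDr; congr (_ * _).
  have E z : 'd f z (a *: x + y) = a * 'd f z x + 'd f z y by rewrite linearP.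
  rewrite E; have -> : (fun k => 'd f (z0 + k *: v) (a *: x + y) * (k^-1 * k^-1)) =
    (fun k : C => a * ('d f (z0 + k *: v) x * (k^-1 * k^-1)) +
      'd f (z0 + k *: v) y * (k^-1 * k^-1)).
    by apply/funext => k; rewrite E mulrDl -mulrA.
  have ac : continuous_contour
      (fun k : C => a * ('d f (z0 + k *: v) x * (k^-1 * k^-1))).
    exact: (continuous_contourZ (dc2 x)).
  rewrite (square_intD ac (dc2 y)) (square_intZ _ (dc2 x)); ring.
pose lin := GRing.isLinear.Build _ _ _ _ _ Llin.
pose L' : {linear V -> C} := HB.pack L lin.
have w1p := @normc_w1_gt0 R.
have LK u : normc (L u) <= (16 + normc w2) * K / normc w1 * rnorm u.
  rewrite /L normcM normcV mulrC ler_pdivrMr //.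
  have -> : (16 + normc w2) * K / normc w1 * rnorm u * normc w1 =
     (16 + normc w2) * (K * rnorm u) by field; rewrite gt_eqF.
  apply: square_int_remainder.
  - exact: dc.
  - by rewrite mulr_ge0 ?rnorm_ge0.
  - by move=> k [sk _]; apply: fK; exact: zk.
  - by apply: fK; apply: (lt_trans z00); lra.
have Lc : continuous L'.
  move=> x; apply/(@cvg_complexP _ _ (nbhs x)) => e e0.
  apply/nbhs_rnormP; pose A := (16 + normc w2) * K / normc w1.
  have A0 : 0 <= A by rewrite divr_ge0 ?mulr_ge0 ?addr_ge0 ?normc_ge0.
  have p0 : 0 < A + 1 by rewrite ltr_wpDl.
  exists (e / (A + 1)); first exact: divr_gt0.
  move=> y; rewrite ltr_pdivlMr // => ye.
  rewrite -linearB -opprB linearN normcN.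
  apply: (le_lt_trans (LK _)); apply: le_lt_trans ye.
  by rewrite mulrC ler_wpM2l ?rnorm_ge0 // lerDl.
apply: (@differentiable_of_near _ _ _ _ L' _ Lc) => _ /complex_gt0P[e e0 ->].
pose A := (16 + normc w2) * (2 * K) / normc w1.
have A0 : 0 <= A by rewrite divr_ge0 ?mulr_ge0 ?addr_ge0 ?normc_ge0.
have p0 : 0 < A + 1 by rewrite ltr_wpDl.
apply/nbhs_rnormP; exists (Num.min (r / 4) (e / (A + 1))).
  by rewrite lt_min !divr_gt0.
move=> u; rewrite subr0 lt_min => /andP[ur ue].
have zu : rnorm (z0 + u - z0) < r / 4 by rewrite addrAC subrr add0r.
have lf z : rnorm (z - z0) < r / 4 -> forall k, square k -> differentiable f (z + k *: v).
  by move=> zr k sk; apply: fD; exact: zk.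
have quad z : rnorm (z - z0) < r -> rnorm (z + u - z0) < r ->
    normc (f (z + u) - f z - 'd f z u) <= 2 * (K * rnorm u * rnorm u).
  move=> zr zur; have seg t : 0 <= t <= 1 -> rnorm (z + t%:C *: u - z0) < r.
    exact: rnorm_segment.
  apply: diff_quadratic_remainder => t tP; first by apply: fD; exact: seg.
  apply: le_trans (fL _ _ _ (seg t tP) zr) _.
  rewrite ler_wpM2r ?rnorm_ge0 // ler_wpM2l // addrAC subrr add0r rnormZ normc_real.
  case/andP: tP => t0 t1; rewrite ger0_norm // -[leRHS]mul1r.
  by rewrite ler_wpM2r ?rnorm_ge0.
suff H : normc ('d f (z0 + u) v - 'd f z0 v - L u) <= A * rnorm u * rnorm u.
  rewrite normr_normc rnormE -rmorphM lecR (le_trans H) //.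
  rewrite ler_wpM2r ?rnorm_ge0 //.
  move: ue; rewrite ltr_pdivlMr // => /ltW; apply: le_trans.
  by rewrite mulrC ler_wpM2l ?rnorm_ge0 // lerDl.
have fc z (zr : rnorm (z - z0) < r / 4) := contour_comp_continuous (lf z zr).
have E : ('d f (z0 + u) v - 'd f z0 v - L u) * w1 =
  square_int (fun k => (f (z0 + u + k *: v) - f (z0 + k *: v)
    - 'd f (z0 + k *: v) u) * (k^-1 * k^-1)) - (f (z0 + u) - f z0 - 'd f z0 u) * w2.
  have Lw : L u * w1 = square_int (fun k => 'd f (z0 + k *: v) u * (k^-1 * k^-1))
      - 'd f z0 u * w2.
    by rewrite /L mulrC mulrA mulfV ?mul1r // winding1_neq0.
  have c1 := continuous_contour_M (fc _ zu) (@continuous_contourV2 R).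
  have c2 := continuous_contour_M (fc _ z00) (@continuous_contourV2 R).
  have c12 : continuous_contour (fun k => f (z0 + u + k *: v) * (k^-1 * k^-1) -
      f (z0 + k *: v) * (k^-1 * k^-1)).
    by move=> k ck; exact: (continuousB (c1 k ck) (c2 k ck)).
  rewrite !mulrBl Lw (line_cauchy (lf _ zu)) (line_cauchy (lf _ z00)).
  have -> (a b c d p q : C) : a - b - (c - d) - (p - q) = a - c - p - (b - d - q).
    by ring.
  rewrite (square_intB c1 c2) (square_intB c12 (dc2 u)); congr (_ - _).
  by apply: eq_square_int => k _; rewrite !mulrBl.
rewrite -(ler_pM2r w1p) -normcM E.
have -> : A * rnorm u * rnorm u * normc w1 =
    (16 + normc w2) * (2 * (K * rnorm u * rnorm u)).
  by rewrite /A; field; rewrite gt_eqF.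
have z0r : rnorm (z0 - z0) < r by apply: (lt_trans z00); lra.
have zur : rnorm (z0 + u - z0) < r by apply: (lt_trans zu); lra.
apply: square_int_remainder.
- move=> k ck; have fkB := continuousB (fc _ zu k ck) (fc _ z00 k ck).
  exact: (continuousB fkB (dc u k ck)).
- by rewrite !mulr_ge0 ?rnorm_ge0.
- move=> k [sk _]; rewrite (addrAC z0 u); apply: quad; first exact: zk.
  by rewrite (addrAC z0 (k *: v) u); exact: zk.
- exact: quad.
Qed.

(** The differential is linear in v, so v may be rescaled to norm at most r / 8 and the factor taken
    out again. *)
Lemma diff_directional_differentiable f v z0 :
  (\forall z \near z0, differentiable f z) ->
  differentiable (fun z => 'd f z v) z0.
Proof.
move=> /diff_lipschitz[r [K [r0 K0 fD fK fL]]].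
have p0 : 0 < rnorm v + 1 by rewrite ltr_wpDl ?rnorm_ge0.
pose t := r / 8 / (rnorm v + 1); have t0 : 0 < t by rewrite !divr_gt0.
have H : differentiable (fun z => 'd f z (t%:C *: v)) z0.
  apply: (diff_small_directional r0 K0 fD fK fL).
  rewrite rnormZ normc_real gtr0_norm // mulrAC ler_pdivrMr //.
  by rewrite ler_wpM2l ?divr_ge0 ?lerDl // ltW.
have -> : (fun z => 'd f z v) = (fun z => t%:C^-1 *: 'd f z (t%:C *: v)).
  apply/funext => z; rewrite -linearZ scalerA mulVf ?scale1r //.
  by rewrite eq_complex /= gt_eqF.
exact: differentiableZ.
Qed.

End DerivativeDifferentiable.

Section JacobianDifferentiable.
Variable R : realType.
Local Notation C := R[i].

Lemma jacobian_entry (m p : nat) (f : 'rV[C]_m -> 'rV[C]_p) z i j :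
  differentiable f z ->
  jacobian f z i j = 'd (fun y => f y 0 j) z (delta_mx 0 i).
Proof.
by move=> fd; rewrite /jacobian mxE diff_entry.
Qed.

(** The entries of the Jacobian are directional derivatives of the coordinate functions. This is all
    that the geometry takes from complex analysis. *)
Lemma jacobian_differentiable (m p : nat) (f : 'rV[C]_m -> 'rV[C]_p) z :
  (\forall y \near z, differentiable f y) ->
  differentiable (fun y => jacobian f y) z.
Proof.
move=> fd; apply: differentiable_matrix => i j.
apply: (near_eq_diff (f := fun y => 'd (fun t => f t 0 j) y (delta_mx 0 i)) _ _).1.
  by apply: filterS fd => y yd; rewrite jacobian_entry.
apply: diff_directional_differentiable; apply: filterS fd => y.
exact: differentiable_entry.
Qed.

End JacobianDifferentiable.

End HolomorphicDerivative.

(** * Tensors in charts *)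

Section ChartCalculus.
Variables (K : numClosedFieldType) (m : nat).

Lemma jacobian_near_eq (f g : 'rV[K]_m -> 'rV[K]_m) p :
  (\forall y \near p, f y = g y) -> differentiable f p ->
  jacobian f p = jacobian g p.
Proof.
by move=> fg fd; exact: (congr1 (@lin1_mx K m m) (esym (near_eq_diff fg fd).2)).
Qed.

Lemma lin1_mx_comp (f g h : {linear 'rV[K]_m -> 'rV[K]_m}) :
  (forall u, h u = g (f u)) -> lin1_mx h = lin1_mx f *m lin1_mx g.
Proof.
move=> hE; apply/row_matrixP => i.
by rewrite !rowE mulmxA !mul_rV_lin1 hE.
Qed.

Lemma conj_mulmx (T T' A B : 'M[K]_m) : T' *m T = 1%:M ->
  T *m (A *m B) *m T' = T *m A *m T' *m (T *m B *m T').
Proof.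
by move=> TT; rewrite !mulmxA -[T *m A *m T' *m T]mulmxA TT mulmx1.
Qed.

Lemma conj_addmx (T T' A B : 'M[K]_m) :
  T *m (A + B) *m T' = T *m A *m T' + T *m B *m T'.
Proof. by rewrite mulmxDr mulmxDl. Qed.

Lemma conj_scalemx (T T' A : 'M[K]_m) k :
  T *m (k *: A) *m T' = k *: (T *m A *m T').
Proof. by rewrite -scalemxAr -scalemxAl. Qed.

(** A form changes by T and its transpose, an endomorphism by T and its inverse T'. Here T' meets
    the T of the denominator, which is why a quotient of two forms changes as an endomorphism. *)
Lemma conj_quotient (T T' A B : 'M[K]_m) : T' *m T = 1%:M -> B \in unitmx ->
  T *m (A *m invmx B) *m T' *m (T *m B *m T^T) = T *m A *m T^T.
Proof.
move=> TT Bu; rewrite !mulmxA -[T *m A *m invmx B *m T' *m T]mulmxA TT mulmx1.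
by rewrite -[T *m A *m invmx B *m B]mulmxA mulVmx // mulmx1.
Qed.

Lemma jacobian_id p : jacobian (fun y : 'rV[K]_m => y) p = 1%:M.
Proof.
have [_ E] : is_diff p (fun y : 'rV[K]_m => y) (fun y => y) by exact: is_diff_id.
rewrite /jacobian E; apply/matrixP => i j.
by rewrite !mxE /= eq_sym.
Qed.

Lemma jacobian_comp (f g : 'rV[K]_m -> 'rV[K]_m) p :
  differentiable f p -> differentiable g (f p) ->
  jacobian (g \o f) p = jacobian f p *m jacobian g (f p).
Proof.
move=> fd gd; apply: lin1_mx_comp => u.
exact: (congr1 (fun h => h u) (diff_comp fd gd)).
Qed.

Variable M : manifold K m.
Implicit Types (c d e : chart K m M) (x : M) (y : 'rV[K]_m).

Lemma near_ccod c y : ccod c y -> \forall t \near y, ccod c t.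
Proof. by move=> cy; apply: open_nbhs_nbhs; split; [exact: ccod_open|]. Qed.

Lemma near_cinv c y (U : set M) : open U -> ccod c y -> U (cinv c y) ->
  \forall t \near y, U (cinv c t).
Proof.
move=> oU cy Uy; apply: (cinv_continuous cy).
by apply: open_nbhs_nbhs; split.
Qed.

Lemma transition_differentiable c d y : atlas c -> atlas d -> ccod c y ->
  cdom d (cinv c y) -> differentiable (cmap d \o cinv c) y.
Proof.
move=> ac ad cy dy; have := atlas_holomorphic ac ad (cinv_dom cy) dy.
by rewrite cinvK.
Qed.

Lemma trans_id c x : atlas c -> cdom c x -> trans c c x = 1%:M.
Proof.
move=> ac cx; rewrite -(jacobian_id (cmap c x)); apply: jacobian_near_eq.
  by apply: filterS (near_ccod (cmap_cod cx)) => y /= cy; rewrite cinvK.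
exact: atlas_holomorphic.
Qed.

Lemma trans_comp c d e x : atlas c -> atlas d -> atlas e ->
  cdom c x -> cdom d x -> cdom e x -> trans c d x *m trans d e x = trans c e x.
Proof.
move=> ac ad ae cx dx ex; rewrite /trans.
have fd := atlas_holomorphic ac ad cx dx.
have E : (cmap d \o cinv c) (cmap c x) = cmap d x by rewrite /= cmapK.
have gd : differentiable (cmap e \o cinv d) ((cmap d \o cinv c) (cmap c x)).
  by rewrite E; exact: atlas_holomorphic.
rewrite -E -(jacobian_comp fd gd).
apply/esym/jacobian_near_eq; last exact: atlas_holomorphic.
have dcx : cdom d (cinv c (cmap c x)) by rewrite cmapK.
apply: filterS (near_cinv (cdom_open d) (cmap_cod cx) dcx) => y /= dy.
by rewrite cmapK.
Qed.

Lemma trans_cinv c d y : ccod c y ->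
  trans c d (cinv c y) = jacobian (cmap d \o cinv c) y.
Proof. by move=> cy; rewrite /trans cinvK. Qed.

Local Opaque trans.

Lemma trans_inv c d x : atlas c -> atlas d -> cdom c x -> cdom d x ->
  trans c d x *m trans d c x = 1%:M.
Proof. by move=> ac ad cx dx; rewrite trans_comp // trans_id. Qed.

Lemma trans_unit c d x : atlas c -> atlas d -> cdom c x -> cdom d x ->
  trans c d x \in unitmx.
Proof. by move=> ac ad cx dx; exact: (mulmx1_unit (trans_inv ac ad cx dx)).1. Qed.

Lemma invmx_trans c d x : atlas c -> atlas d -> cdom c x -> cdom d x ->
  invmx (trans c d x) = trans d c x.
Proof.
move=> ac ad cx dx; rewrite -[RHS]mul1mx -(mulVmx (trans_unit ac ad cx dx)).
by rewrite -mulmxA trans_inv // mulmx1.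
Qed.

(** The interface to complex analysis: it holds over R[i] by [jacobian_differentiable], and the
    geometry stays over a general field. *)
Hypothesis jacobian_diff : forall (f : 'rV[K]_m -> 'rV[K]_m) p,
  (\forall y \near p, differentiable f y) -> differentiable (jacobian f) p.

Lemma trans_differentiable c d y : atlas c -> atlas d -> ccod c y ->
  cdom d (cinv c y) -> differentiable (fun t => trans c d (cinv c t)) y.
Proof.
move=> ac ad cy dy.
have dn := near_cinv (cdom_open d) cy dy; have cn := near_ccod cy.
apply: (near_eq_diff (f := jacobian (cmap d \o cinv c)) _ _).1.
  by apply: filterS cn => t ct; rewrite trans_cinv.
apply: jacobian_diff; apply: filterS2 cn dn => t ct dt.
exact: transition_differentiable.
Qed.

Lemma atlas_at x : atlas (chart_at x). Proof. exact: chart_at_atlas. Qed.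

Lemma dom_at x : cdom (chart_at x) x. Proof. exact: chart_at_dom. Qed.

Definition holomorphic_endo (A : M -> 'M[K]_m) := holomorphic_on endo_in setT A.

Lemma endo_inM c (A B : M -> 'M[K]_m) y : atlas c -> ccod c y ->
  endo_in c (fun x => A x *m B x) y = endo_in c A y *m endo_in c B y.
Proof.
move=> ac cy; rewrite /endo_in; set x := cinv c y.
have cx : cdom c x by exact: cinv_dom.
set T := trans c _ x; set T' := trans _ c x.
have TT : T' *m T = 1%:M by apply: trans_inv => //; [exact: atlas_at|exact: dom_at].
exact: conj_mulmx.
Qed.

Lemma holomorphic_endoM A B : holomorphic_endo A -> holomorphic_endo B ->
  holomorphic_endo (fun x => A x *m B x).
Proof.
move=> Ah Bh c ac y cy _.
apply: (near_eq_diff (f := fun t => endo_in c A t *m endo_in c B t) _ _).1.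
  by apply: filterS (near_ccod cy) => t ct; rewrite endo_inM.
by apply: differentiable_mulmx; [exact: Ah|exact: Bh].
Qed.

Lemma holomorphic_endoD A B : holomorphic_endo A -> holomorphic_endo B ->
  holomorphic_endo (fun x => A x + B x).
Proof.
move=> Ah Bh c ac y cy _.
have -> : endo_in c (fun x => A x + B x) = endo_in c A + endo_in c B.
  by apply/funext => t; exact: conj_addmx.
by apply: differentiableD; [exact: Ah|exact: Bh].
Qed.

Lemma holomorphic_endoZ k A : holomorphic_endo A ->
  holomorphic_endo (fun x => k *: A x).
Proof.
move=> Ah c ac y cy _.
have -> : endo_in c (fun x => k *: A x) = k *: endo_in c A.
  by apply/funext => t; exact: conj_scalemx.
by apply: differentiableZ; exact: Ah.
Qed.

Lemma form_in_unit c w y : atlas c -> ccod c y -> w (cinv c y) \in unitmx ->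
  form_in c w y \in unitmx.
Proof.
move=> ac cy wu; rewrite /form_in !unitmx_mul unitmx_tr wu.
by rewrite trans_unit //; [exact: atlas_at|exact: cinv_dom|exact: dom_at].
Qed.

Lemma endo_in_quotient c (w w' : M -> 'M[K]_m) y : atlas c -> ccod c y ->
  w' (cinv c y) \in unitmx ->
  endo_in c (fun x => w x *m invmx (w' x)) y =
    form_in c w y *m invmx (form_in c w' y).
Proof.
move=> ac cy wu; have fu := form_in_unit ac cy wu.
rewrite -[LHS]mulmx1 -(mulmxV fu) mulmxA; congr (_ *m _).
rewrite /endo_in /form_in; set x := cinv c y.
have cx : cdom c x by exact: cinv_dom.
set T := trans c _ x; set T' := trans _ c x.
have TT : T' *m T = 1%:M by apply: trans_inv => //; [exact: atlas_at|exact: dom_at].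
exact: conj_quotient.
Qed.

(** In each chart the endomorphism is the quotient of the two coordinate matrices of the forms, so
    inverting a holomorphic matrix suffices and no transition Jacobian has to be differentiated. *)
Lemma holomorphic_endo_quotient (w w' : M -> 'M[K]_m) :
  holomorphic_2form w -> holomorphic_2form w' ->
  (forall x, w' x \in unitmx) ->
  holomorphic_endo (fun x => w x *m invmx (w' x)).
Proof.
move=> [_ wh] [_ wh'] wu c ac y cy _.
apply: (near_eq_diff
  (f := fun t => form_in c w t *m invmx (form_in c w' t)) _ _).1.
  by apply: filterS (near_ccod cy) => t ct; rewrite endo_in_quotient.
apply: differentiable_mulmx; first exact: wh.
by apply: differentiable_invmx; [exact: wh'|exact: form_in_unit].
Qed.

Lemma row_free_tuple r (A : 'M[K]_(r, m)) :
  row_free A -> free [tuple row i A | i < r].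
Proof.
move=> Af; apply/freeP => k k0 i.
have : (\row_j k j) *m A = 0.
  rewrite mulmx_sum_row -[RHS]k0; apply: eq_bigr => j _.
  by rewrite mxE (nth_map j) ?size_enum_ord // nth_ord_enum.
by move/(canRL (mulmxKp Af)); rewrite mul0mx => /rowP/(_ i); rewrite !mxE.
Qed.

Lemma basis_matrix r (E : {vspace 'rV[K]_m}) : \dim E = r ->
  exists2 L : 'M[K]_(r, m), row_free L & forall i, row i L \in E.
Proof.
move=> <-; exists (\matrix_(i < \dim E) (vbasis E)`_i); last first.
  by move=> i; rewrite rowK vbasis_mem // mem_nth // size_tuple.
rewrite -kermx_eq0; apply/rowV0P => v /sub_kermxP vL.
have /basis_free /freeP F := vbasisP E.
apply/rowP => j; rewrite mxE; apply: (F (fun i => v 0 i)).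
by rewrite -[RHS]vL mulmx_sum_row; apply: eq_bigr => i _; rewrite rowK.
Qed.

(* Near x0 the sub-bundle is framed by the images under the projector P of
   a basis of S x0, transported by the chart at x0 as constant fields. *)
Lemma subbundle_image (r : nat) (S : M -> {vspace 'rV[K]_m}) (P : M -> 'M[K]_m) :
  holomorphic_endo P -> (forall x, \dim (S x) = r) ->
  (forall x v, v *m P x \in S x) -> (forall x v, v \in S x -> v *m P x = v) ->
  subbundle vect_in r S.
Proof.
move=> Ph Sr PS SP x0; pose c0 := chart_at x0.
have a0 : atlas c0 := atlas_at x0; have d0 : cdom c0 x0 := dom_at x0.
have [L Lf LS] := basis_matrix (Sr x0).
(* [G] is 1 at x0, where P fixes the rows of L, hence invertible nearby. As it factors through the
   transported rows followed by P, these stay independent there. *)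
pose G y := L *m endo_in c0 P y *m pinvmx L.
have y0 : ccod c0 (cmap c0 x0) := cmap_cod d0.
have G0 : G (cmap c0 x0) = 1%:M.
  rewrite /G /endo_in cmapK // -/c0 trans_id // mul1mx mulmx1.
  suff -> : L *m P x0 = L by rewrite mulmxVp.
  by apply/row_matrixP => i; rewrite row_mul SP.
have Gd y : ccod c0 y -> differentiable G y.
  move=> cy; apply: differentiable_mulmx; last exact: differentiable_cst.
  by apply: differentiable_mulmx; [exact: differentiable_cst|exact: Ph].
have Gn : \forall y \near cmap c0 x0, G y \in unitmx.
  apply: near_unitmx; last by rewrite G0 unitmx1.
  by apply: differentiable_continuous; apply: differentiable_det; exact: Gd.
pose U0 : set M := [set x | cdom c0 x /\ G (cmap c0 x) \in unitmx].
have Un : \forall x \near x0, U0 x.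
  have h1 : \forall x \near x0, cdom c0 x.
    by apply: open_nbhs_nbhs; split; [exact: cdom_open|].
  have h2 : \forall x \near x0, G (cmap c0 x) \in unitmx.
    exact: (cmap_continuous d0 Gn).
  by apply: filterS2 h1 h2 => x.
exists U0°; split; [exact: open_interior|exact: Un|].
have U0i x : U0° x -> U0 x by exact: interior_subset.
exists (fun i x => row i L *m trans c0 (chart_at x) x *m P x); split.
  move=> i c ac y cy Uy.
  have cn := near_ccod cy.
  have Un' := near_cinv (@open_interior _ U0) cy Uy.
  (* In the chart c the field is a constant row times the inverse Jacobian of the transition from c
     to c0, followed by P: here the Jacobians have to be holomorphic. *)
  apply: (near_eq_diff
    (f := fun t => row i L *m invmx (trans c c0 (cinv c t)) *m endo_in c P t) _ _).1.
    apply: filterS2 cn Un' => t ct /U0i[ct0 _].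
    have cx : cdom c (cinv c t) := cinv_dom ct.
    rewrite invmx_trans // /vect_in /endo_in.
    rewrite -(trans_comp a0 ac (atlas_at _) ct0 cx (dom_at _)).
    by rewrite !mulmxA.
  have [ct0 _] := U0i _ Uy.
  apply: differentiable_mulmx; last exact: Ph.
  apply: differentiable_mulmx; first exact: differentiable_cst.
  apply: differentiable_invmx; first exact: trans_differentiable.
  by apply: trans_unit => //; exact: cinv_dom.
move=> x /U0i[cx Gu].
pose T := trans c0 (chart_at x) x; pose A := L *m T *m P x.
have GE : G (cmap c0 x) = A *m (trans (chart_at x) c0 x *m pinvmx L).
  by rewrite /G /endo_in cmapK // !mulmxA.
have Af : row_free A.
  rewrite -kermx_eq0; apply/rowV0P => v /sub_kermxP vA.
  have vG : v *m G (cmap c0 x) = 0.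
    rewrite GE; transitivity (v *m A *m (trans (chart_at x) c0 x *m pinvmx L)).
      exact: mulmxA.
    by rewrite vA mul0mx.
  by rewrite -[v](mulmxK Gu) vG mul0mx.
have -> : [tuple row i L *m trans c0 (chart_at x) x *m P x | i < r] =
    [tuple row i A | i < r].
  by apply: eq_from_tnth => i; rewrite !tnth_mktuple /A !row_mul.
rewrite basisEfree row_free_tuple // size_tuple Sr leqnn andbT /=.
apply/span_subvP => v /mapP[i _ ->]; by rewrite /A row_mul PS.
Qed.

End ChartCalculus.

(** * Involutivity of null-spaces of closed forms *)

Section Involutive.
Variables (K : numClosedFieldType) (m : nat) (M : manifold K m).
Implicit Types (x : M) (y : 'rV[K]_m).

Lemma derive_entry a b (V : normedModType K) (A : V -> 'M[K]_(a, b)) p v i j :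
  differentiable A p -> ('D_v A p) i j = 'D_v (fun t => A t i j) p.
Proof.
by move=> Ad; rewrite !deriveE ?diff_entry //; exact: differentiable_entry.
Qed.

Lemma derive_mulmx a b c (V : normedModType K) (A : V -> 'M[K]_(a, b))
    (B : V -> 'M[K]_(b, c)) p v : differentiable A p -> differentiable B p ->
  'D_v (fun t => A t *m B t) p = 'D_v A p *m B p + A p *m 'D_v B p.
Proof.
move=> Ad Bd; apply/matrixP => i j.
rewrite derive_entry; last exact: differentiable_mulmx.
have -> : (fun t => (A t *m B t) i j) =
    \sum_k ((fun t => A t i k) * (fun t => B t k j)).
  by apply/funext => t; rewrite mxE fct_sumE.
have Aij k : derivable (fun t => A t i k) p v.
  by apply: diff_derivable; exact: differentiable_entry.
have Bij k : derivable (fun t => B t k j) p v.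
  by apply: diff_derivable; exact: differentiable_entry.
rewrite derive_sum => [|k]; last exact: derivableM.
rewrite !mxE -big_split /=; apply: eq_bigr => k _.
rewrite deriveM // !derive_entry // addrC; congr (_ + _).
by rewrite -[_ *: _]/(_ * _) mulrC.
Qed.

Lemma derive_dir_sum (W : normedModType K) (f : 'rV[K]_m -> W) p (v : 'rV[K]_m) :
  differentiable f p -> 'D_v f p = \sum_i v 0 i *: 'D_(delta_mx 0 i) f p.
Proof.
move=> fd; rewrite deriveE // [in LHS](row_sum_delta v) linear_sum.
by apply: eq_bigr => i _; rewrite linearZ deriveE.
Qed.

Lemma mulmx_trans_null (v : 'rV[K]_m) (T T' w : 'M[K]_m) : T' *m T = 1%:M ->
  v *m w = 0 -> v *m T' *m (T *m w *m T^T) = 0.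
Proof.
by move=> TT vw; rewrite !mulmxA -[v *m T' *m T]mulmxA TT mulmx1 vw mul0mx.
Qed.

Lemma form_in_skew (c : chart K m M) (w : M -> 'M[K]_m) y :
  (forall x, (w x)^T = - w x) -> (form_in c w y)^T = - form_in c w y.
Proof.
move=> wT; rewrite /form_in; move: (trans c _ _) => T.
by rewrite !trmx_mul trmxK wT mulNmx mulmxN mulmxA.
Qed.

Lemma mem_null_space (a : 'M[K]_m) v : (v \in null_space a) = (v *m a == 0).
Proof. by rewrite /null_space memv_ker lfunE. Qed.

(* With D l the derivative of a closed 2-form w along the l-th coordinate, the
   contraction of [X, Y] with w is the covector k |-> (D_k w)(X, Y). *)
Lemma closed_contraction (D : 'I_m -> 'M[K]_m) (u v : 'rV[K]_m) :
  (forall l, (D l)^T = - D l) ->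
  (forall i j k, D i j k + D j k i + D k i j = 0) ->
  (forall k, u *m D k *m v^T = 0) ->
  u *m (\sum_j v 0 j *: D j) - v *m (\sum_i u 0 i *: D i) = 0.
Proof.
move=> DT DC Duv.
have pair (p q : 'rV[K]_m) k : (p *m (\sum_j q 0 j *: D j)) 0 k =
    \sum_i \sum_j p 0 i * (q 0 j * D j i k).
  rewrite mxE; apply: eq_bigr => i _; rewrite summxE mulr_sumr.
  by apply: eq_bigr => j _; rewrite mxE.
apply/rowP => k; rewrite mxE [X in _ + X]mxE [RHS]mxE !pair.
rewrite [X in _ - X]exchange_big -sumrB.
transitivity ((u *m D k *m v^T) 0 0); last by rewrite Duv mxE.
have -> : (u *m D k *m v^T) 0 0 = \sum_i \sum_j u 0 i * (v 0 j * D k i j).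
  rewrite mxE exchange_big; apply: eq_bigr => j _.
  rewrite !mxE mulr_suml; apply: eq_bigr => i _.
  by rewrite -mulrA [v 0 j * _]mulrC.
apply: eq_bigr => i _; rewrite -sumrB; apply: eq_bigr => j _.
have skew : D j i k = - D j k i.
  by have /(congr1 (fun A : 'M[K]_m => A k i)) := DT j; rewrite mxE [RHS]mxE.
have -> : D k i j = - D j k i - D i j k.
  by apply/eqP; rewrite -subr_eq0 -(DC i j k); apply/eqP; ring.
by rewrite skew; ring.
Qed.

(** Differentiating X w = 0 along v gives (D_v X) w = - X (D_v w), and likewise for Y. So [X, Y] w =
    X (D_Y w) - Y (D_X w), and closedness identifies its k-th entry with (D_k w)(X, Y). This is
    zero: X (D_k w) = - (D_k X) w, and Y lies in the null-space of the skew form w. *)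
Lemma involutive_null_space (w : M -> 'M[K]_m) (S : M -> {vspace 'rV[K]_m}) :
  holomorphic_2form w -> closed_2form w ->
  (forall x, S x = null_space (w x)) -> involutive_subbundle S.
Proof.
move=> [wT wh] wc SE U X Y oU Xh Yh XYS x Ux.
rewrite SE mem_null_space; apply/eqP.
rewrite /lie_bracket; set c := chart_at x.
have ac : atlas c := atlas_at x; have cx : cdom c x := dom_at x.
set y0 := cmap c x; have cy0 : ccod c y0 := cmap_cod cx.
have xE : cinv c y0 = x by rewrite /y0 cmapK.
have Uy0 : U (cinv c y0) by rewrite xE.
pose W := form_in c w.
have tE : trans c c x = 1%:M := trans_id ac cx.
have WE : W y0 = w x by rewrite /W /form_in xE -/c tE mul1mx trmx1 mulmx1.
have VE (Z : M -> 'rV[K]_m) : vect_in c Z y0 = Z x.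
  by rewrite /vect_in xE -/c tE mulmx1.
pose X' := vect_in c X; pose Y' := vect_in c Y.
have Xd : differentiable X' y0 by exact: Xh.
have Yd : differentiable Y' y0 by exact: Yh.
have Wd : differentiable W y0 by exact: wh.
have ZW (Z : M -> 'rV[K]_m) : (forall t, U t -> Z t \in S t) ->
    differentiable (vect_in c Z) y0 -> forall v,
    'D_v (vect_in c Z) y0 *m w x = - (Z x *m 'D_v W y0).
  move=> ZS Zd v; apply/eqP; rewrite -addr_eq0 -WE -(VE Z) -derive_mulmx //.
  suff -> : 'D_v (fun t => vect_in c Z t *m W t) y0 = 'D_v (cst 0) y0.
    by rewrite derive_cst.
  have cstd : differentiable (cst 0 : 'rV[K]_m -> 'rV[K]_m) y0.
    exact: differentiable_cst.
  have Zn : \forall t \near y0, cst 0 t = vect_in c Z t *m W t.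
    apply: filterS2 (near_ccod cy0) (near_cinv oU cy0 Uy0) => t ct Ut.
    have := ZS _ Ut; rewrite SE mem_null_space => /eqP E.
    apply/esym; rewrite /cst; apply: mulmx_trans_null E.
    by apply: trans_inv => //; [exact: atlas_at|exact: dom_at|exact: cinv_dom].
  have [_ E] := near_eq_diff Zn cstd.
  have Pd := differentiable_mulmx Zd Wd.
  exact: etrans (deriveE v Pd) (etrans (congr1 (fun h => h v) E)
    (esym (deriveE v cstd))).
have XW := ZW X (fun t Ut => (XYS t Ut).1) Xd.
have YW := ZW Y (fun t Ut => (XYS t Ut).2) Yd.
rewrite mulmxBl YW XW opprK addrC.
pose D l := 'D_(delta_mx 0 l) W y0.
have DE (v : 'rV[K]_m) : 'D_v W y0 = \sum_i v 0 i *: D i by exact: derive_dir_sum.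
have DT l : (D l)^T = - D l.
  apply/matrixP => i j; rewrite mxE [RHS]mxE /D (derive_entry _ j i Wd).
  rewrite (derive_entry _ i j Wd).
  have -> : (fun t => W t j i) = - (fun t => W t i j).
    apply/funext => t; have := congr1 (fun A : 'M[K]_m => A i j) (form_in_skew c t wT).
    by rewrite mxE [in RHS]mxE.
  by apply: deriveN; apply: diff_derivable; exact: differentiable_entry.
have DC i j k : D i j k + D j k i + D k i j = 0 := wc c ac y0 cy0 i j k.
have [Xw Yw] : X x *m w x = 0 /\ Y x *m w x = 0.
  have [] := XYS x Ux; rewrite SE !mem_null_space => /eqP + /eqP.
  by split.
have DXY k : X x *m D k *m (Y x)^T = 0.
  have := XW (delta_mx 0 k); rewrite -/(D k) => /eqP.
  rewrite -addr_eq0 => /eqP /(congr1 (fun A => A *m (Y x)^T)).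
  rewrite mul0mx mulmxDl -[_ *m w x *m _]mulmxA.
  suff -> : w x *m (Y x)^T = 0 by rewrite mulmx0 add0r.
  by apply: trmx_inj; rewrite trmx_mul trmxK wT mulmxN Yw oppr0 trmx0.
rewrite !DE; exact: closed_contraction.
Qed.

End Involutive.

(** * Pencils of constant rank *)

Section PencilAlgebra.
Variable K : numClosedFieldType.

(** In characteristic 0 the nonzero numbers 1, ..., size p are more roots than a nonzero p can
    have. *)
Lemma poly_zero_off0 (p : {poly K}) :
  (forall s : K, s != 0 -> p.[s] = 0) -> p.[0] = 0.
Proof.
move=> p0; suff -> : p = 0 by rewrite horner0.
apply/eqP; apply: contraT => pn0.
have := max_poly_roots (rs := [seq i.+1%:R | i <- iota 0 (size p)]) pn0.
rewrite size_map size_iota ltnn => H; apply: H.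
  by apply/allP => _ /mapP[i _ ->]; rewrite /root p0 // pnatr_eq0.
rewrite map_inj_uniq ?iota_uniq // => i j /eqP.
by rewrite eqr_nat eqSS => /eqP.
Qed.

(** An algebraic passage to the limit s -> 0: the determinant is a polynomial in s. *)
Lemma det_pencil_off0 k (A B D : 'M[K]_k) :
  (forall s : K, s != 0 -> \det (A + s *: B + s ^+ 2 *: D) = 0) -> \det A = 0.
Proof.
pose P : 'M[{poly K}]_k :=
  \matrix_(i, j) ((A i j)%:P + (B i j)%:P * 'X + (D i j)%:P * 'X ^+ 2).
have PE s : (\det P).[s] = \det (A + s *: B + s ^+ 2 *: D).
  rewrite -[LHS]/(horner_eval s (\det P)) -det_map_mx; congr (\det _).
  apply/matrixP => i j; transitivity (P i j).[s]; first by rewrite mxE.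
  have -> : P i j = (A i j)%:P + (B i j)%:P * 'X + (D i j)%:P * 'X ^+ 2.
    by rewrite /P mxE.
  by rewrite !hornerD !hornerM !hornerC !hornerX !mxE; ring.
move=> H; have := @poly_zero_off0 (\det P).
rewrite PE scale0r expr0n scale0r !addr0; apply=> s s0.
by rewrite PE; exact: H.
Qed.

(* The bordered matrix [[L], [u / s]] A(s) [R, c] is a polynomial in s, singular
   for s != 0 because rank A(s) <= r, and its determinant at s = 0 is u c. *)
Lemma rank_pencil_kernels m r (N N' : 'M[K]_m) (u : 'rV[K]_m) (c : 'cV[K]_m) :
  \rank N = r -> (forall s : K, s != 0 -> (\rank (N + s%:M + s ^+ 2 *: N')%R <= r)%N) ->
  u *m N = 0 -> N *m c = 0 -> u *m c = 0.
Proof.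
move=> rN rA uN Nc.
move: rA; case: r / rN => rA; set r := \rank N in rA *.
pose L := pinvmx (col_base N); pose T := pinvmx (row_base N).
have LNT : L *m N *m T = 1%:M.
  rewrite -[X in _ *m X *m _](mulmx_base N) mulmxA -mulmxA.
  by rewrite mulVpmx ?col_base_full // mulmxVp ?row_base_free // mulmx1.
pose B0 := block_mx (1%:M : 'M_r) 0 (u *m T) (u *m c).
pose B1 := block_mx (L *m T) (L *m c) (u *m N' *m T) (u *m N' *m c).
pose B2 := block_mx (L *m N' *m T) (L *m N' *m c) 0 (0 : 'M_1).
have BE s : s != 0 -> B0 + s *: B1 + s ^+ 2 *: B2 =
    col_mx L (s^-1 *: u) *m (N + s%:M + s ^+ 2 *: N') *m row_mx T c.
  move=> s0; rewrite mul_col_mx mul_col_row /B0 /B1 /B2.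
  rewrite !scale_block_mx !add_block_mx.
  rewrite !mulmxDr !mulmxDl -!scalemxAr -!scalemxAl !mul_mx_scalar -!scalemxAl.
  rewrite LNT uN mul0mx scaler0 -[L *m N *m c]mulmxA Nc mulmx0 !add0r !addr0.
  rewrite mul0mx !scaler0 !add0r addr0 !scalerA mulVf // !scale1r.
  by rewrite !expr2 mulfK.
have /eqP : \det B0 = 0.
  apply: (@det_pencil_off0 _ B0 B1 B2) => s s0; rewrite BE //.
  apply/eqP; apply: contraT; rewrite -unitfE -unitmxE -row_full_unit.
  move=> /eqP rB; suff : (r + 1 <= r)%N by rewrite addn1 ltnn.
  rewrite -[X in (X <= _)%N]rB; apply: leq_trans (mxrankM_maxl _ _) _.
  by apply: leq_trans (mxrankM_maxr _ _) _; exact: rA.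
rewrite det_lblock det1 mul1r det_mx11 => /eqP uc.
by apply/matrixP => i j; rewrite !ord1 uc mxE.
Qed.

End PencilAlgebra.

(** * Matrix units from a pencil of constant rank *)

Section MatrixUnits.
Variables (K : numClosedFieldType) (m : nat).
Implicit Types (N : 'M[K]_m) (s t a b c d : K) (v : 'rV[K]_m).

Definition pencil N N' s t : 'M[K]_m := s ^+ 2 *: N + (s * t)%:M + t ^+ 2 *: N'.

Lemma pencilC N N' s t : pencil N N' s t = pencil N' N t s.
Proof. by rewrite /pencil [s * t]mulrC addrC [s ^+ 2 *: N + _]addrC addrA. Qed.

(** Since the rank does not grow away from (1 : 0), the first-order term of the pencil at N, the
    identity, must carry the left kernel of N into the row space of N. Both have dimension r = m /
    2, so they coincide. *)
Lemma pencil_nilpotent r N N' : (r + r)%N = m ->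
  (forall s t, (s != 0) || (t != 0) -> \rank (pencil N N' s t) = r) ->
  N *m N = 0.
Proof.
move=> rm rk; have rN : \rank N = r.
  have := rk 1 0; rewrite oner_neq0 /pencil expr1n expr0n /= scale1r scale0r mulr0.
  by rewrite addr0 -scalemx1 scale0r addr0; apply.
have rs s : s != 0 -> (\rank (N + s%:M + s ^+ 2 *: N')%R <= r)%N.
  by move=> s0; have := rk 1 s; rewrite oner_neq0 /pencil expr1n scale1r mul1r => ->.
have KC : kermx N *m cokermx N = 0.
  apply/matrixP => i j.
  transitivity ((row i (kermx N) *m col j (cokermx N)) 0 0).
    by rewrite !mxE; apply: eq_bigr => k _; rewrite !mxE.
  rewrite (rank_pencil_kernels rN rs) ?mxE //.
    by rewrite -row_mul mulmx_ker row0.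
  by rewrite colE mulmxA mulmx_coker mul0mx.
have KN : (kermx N <= N)%MS by rewrite submxE KC.
have : (kermx N == N)%MS.
  by rewrite -(geq_leqif (mxrank_leqif_eq KN)) mxrank_ker rN -rm addnK.
by case/andP => _ /sub_kermxP.
Qed.

(** Multiplying s v = - v N - s^2 v N' on the right by N and by N' expresses s v N through v N' N
    and s v N' through v N N'. Both are substituted into s times the same equation. *)
Lemma kernel_anticomm N N' s v : s != 0 -> N *m N = 0 -> N' *m N' = 0 ->
  v *m (N + s%:M + s ^+ 2 *: N') = 0 -> v *m (N *m N' + N' *m N) = v.
Proof.
move=> s0 NN N'N' vA.
have vE : s *: v = - (v *m N) - s ^+ 2 *: (v *m N').
  move: vA; rewrite !mulmxDr mul_mx_scalar -scalemxAr => vA.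
  by apply/eqP; rewrite -subr_eq0 opprD !opprK -vA addrA [s *: v + _]addrC.
have vN : s *: (v *m N) = - s ^+ 2 *: (v *m N' *m N).
  by rewrite scalemxAl vE mulmxBl mulNmx -[v *m N *m N]mulmxA NN
    mulmx0 oppr0 sub0r -scalemxAl scaleNr.
have vN' : s *: (v *m N') = - (v *m N *m N').
  by rewrite scalemxAl vE mulmxBl mulNmx -scalemxAl -[v *m N' *m N']mulmxA
    N'N' mulmx0 scaler0 subr0.
apply: (scalerI (expf_neq0 2 s0)); rewrite mulmxDr !mulmxA scalerDr expr2 -!scalerA vE.
rewrite scalerBr scalerN vN [s *: (s ^+ 2 *: _)]scalerA mulrC -scalerA vN'.
by rewrite scalerN opprK scaleNr opprK addrC expr2 -!scalerA.
Qed.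

(** The anticommutator fixes the kernels at the parameters 1 and -1, two distinct nonzero values.
    These kernels are independent and of dimension r = m / 2, so they span the whole space. *)
Lemma pencil_anticomm r N N' : (r + r)%N = m ->
  (forall s t, (s != 0) || (t != 0) -> \rank (pencil N N' s t) = r) ->
  (forall s t s' t' v, s' * t != t' * s -> v *m pencil N N' s t = 0 ->
     v *m pencil N N' s' t' = 0 -> v = 0) ->
  N *m N' + N' *m N = 1%:M.
Proof.
move=> rm rk dis; have NN := pencil_nilpotent rm rk.
have N'N' : N' *m N' = 0.
  apply: (pencil_nilpotent (N' := N) rm) => s t st.
  by rewrite pencilC; apply: rk; rewrite orbC.
pose D := N *m N' + N' *m N - 1%:M.
pose A t := pencil N N' 1 t.
have AE t : A t = N + t%:M + t ^+ 2 *: N'.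
  by rewrite /A /pencil expr1n scale1r mul1r.
have AD t : t != 0 -> kermx (A t) *m D = 0.
  move=> t0; apply/row_matrixP => i; rewrite row_mul row0 /D mulmxBr mulmx1.
  apply/eqP; rewrite subr_eq0; apply/eqP; apply: (kernel_anticomm t0 NN N'N').
  by rewrite -AE -row_mul mulmx_ker row0.
have n1 : -1 != 0 :> K by rewrite oppr_eq0 oner_neq0.
have cap0 : (kermx (A 1) :&: kermx (A (-1)) = 0)%MS.
  apply/eqP/rowV0P => v; rewrite sub_capmx => /andP[/sub_kermxP v1 /sub_kermxP v2].
  apply: dis v1 v2; rewrite !mulr1 -subr_eq0 opprK.
  by rewrite -[1 + 1]/(2%:R) pnatr_eq0.
have rkA t : t != 0 -> \rank (kermx (A t)) = r.
  by move=> t0; rewrite mxrank_ker rk ?t0 ?orbT // -rm addnK.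
have full : row_full (kermx (A 1) + kermx (A (-1)))%MS.
  by rewrite /row_full mxrank_disjoint_sum // !rkA ?oner_neq0 // rm.
have : (kermx (A 1) + kermx (A (-1)) <= kermx D)%MS.
  by rewrite addsmx_sub; apply/andP; split; apply/sub_kermxP; rewrite AD ?oner_neq0.
move=> /(submx_trans (submx_full 1%:M full)) /sub_kermxP; rewrite mul1mx => /eqP.
by rewrite subr_eq0 => /eqP.
Qed.

(** The image of the 2 x 2 matrix with rows (a, b) and (c, d) when N N', N, N', N' N are taken for
    the units e11, e12, e21, e22. *)
Definition comb4 N N' a b c d : 'M[K]_m :=
  a *: (N *m N') + b *: N + c *: N' + d *: (N' *m N).

Section Relations.
Variables (N N' : 'M[K]_m).
Hypotheses (NN : N *m N = 0) (N'N' : N' *m N' = 0).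
Hypothesis NN'1 : N *m N' + N' *m N = 1%:M.
Local Notation E := (comb4 N N').

Lemma NN'N : N *m N' *m N = N.
Proof.
by rewrite -[RHS]mulmx1 -NN'1 mulmxDr !mulmxA NN mul0mx add0r.
Qed.

Lemma N'NN' : N' *m N *m N' = N'.
Proof.
by rewrite -[RHS]mulmx1 -NN'1 mulmxDr !mulmxA N'N' mul0mx addr0.
Qed.

Lemma comb4M a b c d a' b' c' d' : E a b c d *m E a' b' c' d' =
  E (a * a' + b * c') (a * b' + b * d') (c * a' + d * c') (c * b' + d * d').
Proof.
have r1 : N *m N' *m (N *m N') = N *m N' by rewrite mulmxA NN'N.
have r2 : N *m N' *m N' = 0 by rewrite -mulmxA N'N' mulmx0.
have r3 : N *m N' *m (N' *m N) = 0 by rewrite mulmxA r2 mul0mx.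
have r4 : N *m (N *m N') = 0 by rewrite mulmxA NN mul0mx.
have r5 : N *m (N' *m N) = N by rewrite mulmxA NN'N.
have r6 : N' *m (N *m N') = N' by rewrite mulmxA N'NN'.
have r7 : N' *m (N' *m N) = 0 by rewrite mulmxA N'N' mul0mx.
have r8 : N' *m N *m (N *m N') = 0 by rewrite mulmxA -[_ *m N *m N]mulmxA NN mulmx0 mul0mx.
have r9 : N' *m N *m N = 0 by rewrite -mulmxA NN mulmx0.
have r10 : N' *m N *m (N' *m N) = N' *m N by rewrite mulmxA N'NN'.
rewrite /comb4 !mulmxDl !mulmxDr -!scalemxAl -!scalemxAr !scalerA.
rewrite r1 NN'N r2 r3 r4 NN r5 r6 N'N' r7 r8 r9 N'NN' r10.
move: (N *m N') (N' *m N) => P Q; clear.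
by apply/matrixP => i j; rewrite !mxE; ring.
Qed.

Lemma comb4_id a : E a 0 0 a = a%:M.
Proof. by rewrite /comb4 !scale0r !addr0 -scalerDr NN'1 scalemx1. Qed.

(** Multiplication on both sides by units moves each coefficient in front of N N'. That product is
    nonzero: otherwise N = N N' N = 0 and the anticommutator could not be 1. *)
Lemma comb4_eq0 a b c d : (0 < m)%N -> E a b c d = 0 ->
  [/\ a = 0, b = 0, c = 0 & d = 0].
Proof.
move=> m0 E0; have e110 : N *m N' != 0.
  apply: contraTneq m0 => e0; have N0 : N = 0 by rewrite -NN'N e0 mul0mx.
  have := NN'1; rewrite N0 mul0mx mulmx0 addr0.
  move=> /(congr1 (@mxrank K m m)); rewrite mxrank1 mxrank0 => <-.
  by rewrite ltnn.
have unit1 k : E k 0 0 0 = 0 -> k = 0.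
  rewrite /comb4 !scale0r !addr0 => /eqP; rewrite scaler_eq0 (negPf e110) orbF.
  by move/eqP.
have ext p q r s : E p q 0 0 *m E a b c d *m E r 0 s 0 = 0 by rewrite E0 mulmx0 mul0mx.
have get p q r s : (p * a + q * c) * r + (p * b + q * d) * s = 0.
  apply: unit1; have := ext p q r s; rewrite !comb4M => H; rewrite -[RHS]H.
  by congr E; ring.
split.
- by have := get 1 0 1 0; rewrite !(mul1r, mul0r, mulr0, mulr1, addr0, add0r).
- by have := get 1 0 0 1; rewrite !(mul1r, mul0r, mulr0, mulr1, addr0, add0r).
- by have := get 0 1 1 0; rewrite !(mul1r, mul0r, mulr0, mulr1, addr0, add0r).
- by have := get 0 1 0 1; rewrite !(mul1r, mul0r, mulr0, mulr1, addr0, add0r).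
Qed.

(** As a 2 x 2 matrix the pencil is the column (s, t) times the row (t, s). It has rank one and is
    annihilated on the left by the row (t, -s), which explains the shape of [line_proj]. *)
Lemma pencil_comb4 s t : pencil N N' s t = E (s * t) (s ^+ 2) (t ^+ 2) (s * t).
Proof.
rewrite /pencil /comb4 -scalemx1 -NN'1 scalerDr.
move: (N *m N') (N' *m N) => P Q; clear.
by apply/matrixP => i j; rewrite !mxE; ring.
Qed.

(* The projection onto the kernel of the pencil at (s, t) along its kernel at
   (s', t'), i.e. the 2 x 2 matrix (s', t')^T (t, -s) / (s' t - t' s). *)
Definition line_proj s t s' t' := (s' * t - t' * s)^-1 *:
  E (s' * t) (- (s' * s)) (t' * t) (- (t' * s)).

Lemma line_projC s t s' t' : s' * t != t' * s ->
  line_proj s t s' t' + line_proj s' t' s t = 1%:M.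
Proof.
move=> st; rewrite -comb4_id /line_proj /comb4.
have d0 : s' * t - t' * s != 0 by rewrite subr_eq0.
have -> : s * t' - t * s' = - (s' * t - t' * s) by ring.
move: (N *m N') (N' *m N) => P Q; apply/matrixP => i j; rewrite !mxE.
by field.
Qed.

Lemma line_proj_kernel s t s' t' : line_proj s t s' t' *m pencil N N' s t = 0.
Proof.
rewrite /line_proj pencil_comb4 -scalemxAl comb4M.
set p := comb4 _ _ _ _ _ _; suff -> : p = 0 by rewrite scaler0.
rewrite /p (_ : E _ _ _ _ = E 0 0 0 0); last by congr E; ring.
by rewrite comb4_id; apply/matrixP => i j; rewrite !mxE mul0rn.
Qed.

(** Up to its scalar, the projection factors through the pencil at (s', t'): if t' a + s' b = 1,
    then inserting the row (t', s') times the column (a, b) between the column (s', t') and the row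
    (t, -s) changes nothing. *)
Lemma line_proj_annihil s t s' t' v : (s' != 0) || (t' != 0) ->
  v *m pencil N N' s' t' = 0 -> v *m line_proj s t s' t' = 0.
Proof.
move=> st' vA.
have [a [b ab]] : exists a b, t' * a + s' * b = 1.
  have [t0|t0] := eqVneq t' 0.
    move: st'; rewrite t0 eqxx orbF => s0.
    by exists 0, s'^-1; rewrite mulr0 add0r mulfV.
  by exists t'^-1, 0; rewrite mulr0 addr0 mulfV.
rewrite /line_proj -scalemxAr; set q := E _ _ _ _.
suff -> : q = pencil N N' s' t' *m E (a * t) (- (a * s)) (b * t) (- (b * s)).
  by rewrite mulmxA vA mul0mx scaler0.
rewrite pencil_comb4 comb4M /q.
have E1 : s' = s' * (t' * a + s' * b) by rewrite ab mulr1.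
have E2 : t' = t' * (t' * a + s' * b) by rewrite ab mulr1.
by congr E; [rewrite {1}E1|rewrite {1}E1|rewrite {1}E2|rewrite {1}E2]; ring.
Qed.

End Relations.
End MatrixUnits.

(** * Degenerate forms of a trisymplectic structure *)

Section Conic.
Variable K : numClosedFieldType.

Definition row3 (a b d : K) : 'rV[K]_3 := \row_i [:: a; b; d]`_i.

Definition i0 : 'I_3 := ord0.
Definition i1 : 'I_3 := lift ord0 ord0.
Definition i2 : 'I_3 := lift ord0 (lift ord0 ord0).

Lemma row3P (u : 'rV[K]_3) : u = row3 (u 0 i0) (u 0 i1) (u 0 i2).
Proof.
apply/rowP => i; rewrite mxE.
by case: i => [[|[|[|//]]] lti] /=; congr (u 0 _); apply: val_inj.
Qed.

Lemma row3_eq0 (a b d : K) : row3 a b d = 0 -> [/\ a = 0, b = 0 & d = 0].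
Proof.
move=> /rowP u0; split.
- by have := u0 i0; rewrite !mxE.
- by have := u0 i1; rewrite !mxE.
- by have := u0 i2; rewrite !mxE.
Qed.

Lemma lincomb3_row3 (V : lmodType K) (w : 'I_3 -> V) (a b d : K) :
  lincomb3 w (row3 a b d) = a *: w i0 + b *: w i1 + d *: w i2.
Proof.
by rewrite /lincomb3 !big_ord_recl big_ord0 addr0 !mxE /= addrA.
Qed.

Lemma lincomb3B (V : lmodType K) (w : 'I_3 -> V) u v :
  lincomb3 w (u - v) = lincomb3 w u - lincomb3 w v.
Proof.
rewrite /lincomb3 -sumrB; apply: eq_bigr => i _.
by rewrite !mxE scalerBl.
Qed.

Lemma lincomb3_mulmx (V : lmodType K) (w : 'I_3 -> V) (g : 'M[K]_3) u :
  lincomb3 (fun i => lincomb3 w (row i g)) u = lincomb3 w (u *m g).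
Proof.
rewrite /lincomb3.
transitivity (\sum_i \sum_j (u 0 i * g i j) *: w j).
  apply: eq_bigr => i _; rewrite scaler_sumr; apply: eq_bigr => j _.
  by rewrite mxE scalerA.
by rewrite exchange_big; apply: eq_bigr => j _; rewrite mxE scaler_suml.
Qed.

(** Two isotropic vectors e, f with B(e, f) = 1 and a vector h orthogonal to both, scaled to B(h, h)
    = -2, form a basis in which a e + b h + d f has the value 2 (a d - b^2). *)
Lemma quadric_normal_form (Q : 'M[K]_3) : Q^T = Q -> Q \in unitmx ->
  exists2 g : 'M[K]_3, g \in unitmx &
    forall a b d, (row3 a b d *m g) *m Q *m (row3 a b d *m g)^T = 0 -> a * d = b ^+ 2.
Proof.
move=> QT Qu; pose B (u v : 'rV[K]_3) : K := (u *m Q *m v^T) 0 0.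
have BC u v : B u v = B v u.
  have E : u *m Q *m v^T = (v *m Q *m u^T)^T by rewrite !trmx_mul trmxK QT mulmxA.
  by rewrite /B E mxE.
have BD u v x : B (u + v) x = B u x + B v x by rewrite /B !mulmxDl mxE.
have BZ k u x : B (k *: u) x = k * B u x by rewrite /B -!scalemxAl mxE.
have BDr u v x : B x (u + v) = B x u + B x v by rewrite BC BD !(BC x).
have BZr k u x : B x (k *: u) = k * B x u by rewrite BC BZ (BC x).
have Bnd u : (forall x, B u x = 0) -> u = 0.
  move=> u0; suff : u *m Q = 0 by move=> /(canRL (mulmxK Qu)); rewrite mul0mx.
  apply/rowP => j; rewrite [RHS]mxE; have := u0 (delta_mx 0 j).
  by rewrite /B trmx_delta -colE [in LHS]mxE.
have [e e0 ee] : exists2 e : 'rV[K]_3, e != 0 & B e e = 0.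
  pose p : 'rV[K]_3 := row3 1 0 0; pose q : 'rV[K]_3 := row3 0 1 0.
  have [pp|pp] := eqVneq (B p p) 0.
    exists p => //; apply/eqP => /row3_eq0[/eqP]; by rewrite oner_eq0.
  (* x is a root of B(x p + q, x p + q), a quadratic polynomial in x because B(p, p) is nonzero. *)
  pose s := sqrtC (B p q ^+ 2 - B p p * B q q).
  pose x := (s - B p q) / B p p.
  exists (x *: p + q).
    apply/eqP; rewrite /p /q => /rowP /(_ i1); rewrite !mxE /= mulr0 add0r => /eqP.
    by rewrite oner_eq0.
  rewrite !BD !BDr !BZ !BZr (BC q p) /x.
  have s2 : s ^+ 2 = B p q ^+ 2 - B p p * B q q by rewrite sqrtCK.
  have -> : (s - B p q) / B p p * ((s - B p q) / B p p * B p p) +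
    (s - B p q) / B p p * B p q + ((s - B p q) / B p p * B p q + B q q) =
    (s ^+ 2 - (B p q ^+ 2 - B p p * B q q)) / B p p by field.
  by rewrite s2 subrr mul0r.
have [f ef ff] : exists2 f, B e f = 1 & B f f = 0.
  have [f1 f1e] : exists f1, B e f1 != 0.
    apply: contrapT => H; move/eqP: e0; apply; apply: Bnd => x.
    by apply: contrapT => /eqP Bx; apply: H; exists x.
  have [f2 ef2] : exists f2, B e f2 = 1.
    by exists ((B e f1)^-1 *: f1); rewrite BZr mulVf.
  (* As e is isotropic, subtracting a multiple of it leaves B(e, f2) unchanged, and this multiple
     cancels B(f2, f2). *)
  exists (f2 - (B f2 f2 / 2) *: e).
    by rewrite -scaleNr BDr BZr ef2 ee mulr0 addr0.
  rewrite -scaleNr !BD !BDr !BZ !BZr ef2 (BC f2 e) ef2 ee.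
  by field.
have [h h0 [he hf]] : exists2 h, h != 0 & B h e = 0 /\ B h f = 0.
  pose A : 'M[K]_(3, 1 + 1) := row_mx (Q *m e^T) (Q *m f^T).
  have : kermx A != 0.
    rewrite -mxrank_eq0 mxrank_ker subn_eq0 -ltnNge.
    exact: leq_ltn_trans (rank_leq_col A) _.
  move=> /rowV0Pn[h /sub_kermxP hA h0]; exists h => //.
  move: hA; rewrite mul_mx_row -[0]row_mx0 => /eq_row_mx[].
  by rewrite !mulmxA /B => -> ->; rewrite !mxE.
have indep a b d : a *: e + b *: h + d *: f = 0 -> [/\ a = 0, b = 0 & d = 0].
  move=> u0.
  have B0 x : a * B e x + b * B h x + d * B f x = 0.
    rewrite -!BZ -!BD u0 /B !mul0mx mxE //.
  have a0 : a = 0 by have := B0 f; rewrite ef hf ff !mulr0 mulr1 !addr0.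
  have d0 : d = 0.
    by have := B0 e; rewrite ee he (BC f) ef !mulr0 mulr1 !add0r.
  split=> //; move/eqP: u0; rewrite a0 d0 !scale0r add0r addr0 scaler_eq0.
  by rewrite (negPf h0) orbF => /eqP.
have unit_g (h' : 'rV[K]_3) (k : K) : k != 0 -> h' = k *: h ->
    (\matrix_i [:: e; h'; f]`_i : 'M[K]_3) \in unitmx.
  move=> k0 ->; rewrite -row_free_unit -kermx_eq0; apply/rowV0P => u /sub_kermxP.
  rewrite (row3P u); move: (u 0 i0) (u 0 i1) (u 0 i2) => a b d.
  rewrite mulmx_sum_row !big_ord_recl big_ord0 addr0 !rowK !mxE /= addrA scalerA.
  move=> /indep[-> /eqP + ->]; rewrite mulf_eq0 (negPf k0) orbF => /eqP ->.
  by apply/rowP => i; rewrite !mxE; case: i => [[|[|[|]]] ?].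
(* Otherwise h would be orthogonal to the basis e, h, f, against non-degeneracy. *)
have hh : B h h != 0.
  apply: contraNneq h0 => hh; apply/eqP.
  have gu := unit_g h 1 (oner_neq0 _) (esym (scale1r h)).
  set g := (\matrix_i _) in gu; suff : h *m Q *m g^T = 0.
    have gTu : g^T \in unitmx by rewrite unitmx_tr.
    move=> /(canRL (mulmxK gTu)); rewrite mul0mx => /(canRL (mulmxK Qu)).
    by rewrite mul0mx.
  apply/rowP => j; rewrite [RHS]mxE.
  have -> : (h *m Q *m g^T) 0 j = B h (row j g).
    rewrite /B [LHS]mxE [RHS]mxE; apply: eq_bigr => i _.
    by congr (_ * _); rewrite !mxE.
  by rewrite rowK; case: j => [[|[|[|//]]] ?] /=.
pose k := sqrtC (- 2 / B h h).
have k2 : k ^+ 2 * B h h = - 2 by rewrite sqrtCK divfK.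
have k0 : k != 0.
  apply/eqP => k0; move: k2; rewrite k0 expr0n mul0r => /eqP.
  by rewrite eq_sym oppr_eq0 pnatr_eq0.
exists (\matrix_i [:: e; k *: h; f]`_i); first exact: unit_g k0 erefl.
move=> a b d.
have -> : row3 a b d *m (\matrix_i [:: e; k *: h; f]`_i) =
    a *: e + b *: (k *: h) + d *: f.
  by rewrite mulmx_sum_row !big_ord_recl big_ord0 addr0 !rowK !mxE /= addrA.
move=> uu; have {uu} : B (a *: e + b *: (k *: h) + d *: f)
    (a *: e + b *: (k *: h) + d *: f) = 0 by rewrite /B uu mxE.
rewrite !BD !BDr !BZ !BZr ee ff he hf ef (BC e h) he (BC f h) hf (BC f e) ef => H.
have : 2 * (a * d) + b ^+ 2 * (k ^+ 2 * B h h) = 0 by rewrite -[RHS]H; ring.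
rewrite k2 => /eqP; rewrite mulrN [b ^+ 2 * 2]mulrC -mulrBr mulf_eq0 pnatr_eq0 /=.
by rewrite subr_eq0 => /eqP.
Qed.

Lemma eigenvector_exists m (A : 'M[K]_m) : (0 < m)%N ->
  exists k, exists2 u : 'rV[K]_m, u != 0 & u *m A = k *: u.
Proof.
move=> m0; have [k] : exists k, root (char_poly A) k.
  by apply/closed_rootP; rewrite size_char_poly eqSS -lt0n.
rewrite -eigenvalue_root_char => /eigenvalueP[u uA u0].
by exists k, u.
Qed.

End Conic.

Lemma dim_null_space (K : numClosedFieldType) m (A : 'M[K]_m) :
  \dim (null_space A) = (m - \rank A)%N.
Proof.
rewrite -mxrank_ker; set r := \rank _; pose L := row_base (kermx A).
have rowL u : (u <= L)%MS = (u *m A == 0) by rewrite eq_row_base sub_kermx.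
suff /size_basis : basis_of (null_space A) [tuple row i L | i < r] by [].
rewrite basisEfree row_free_tuple ?row_base_free // size_tuple.
have sub : (<<[tuple row i L | i < r]>> <= null_space A)%VS.
  by apply/span_subvP => _ /mapP[i _ ->]; rewrite mem_null_space -rowL row_sub.
suff sup : (null_space A <= <<[tuple row i L | i < r]>>)%VS.
  by rewrite sub (leq_trans (dimvS sup)) // (leq_trans (dim_span _)) ?size_tuple.
apply/subvP => v; rewrite mem_null_space -rowL => /submxP[u ->].
rewrite mulmx_sum_row memv_suml // => i _.
by apply/memvZ/memv_span/mapP; exists i; rewrite ?mem_enum.
Qed.

(** * Linear algebra on a single tangent space *)

Section Pointwise.
Variables (K : numClosedFieldType) (n : nat) (W : 'I_3 -> 'M[K]_(n.*2)).
Local Notation form a b d := (lincomb3 W (row3 a b d)).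
Hypothesis W_free : forall c, lincomb3 W c = 0 -> c = 0.
Hypothesis W_conic : forall a b d, degenerate (form a b d) -> a * d = b ^+ 2.
Hypothesis W_rank : forall c, c != 0 -> degenerate (lincomb3 W c) ->
  \rank (lincomb3 W c) = n.

(** In dimension 0 all matrices vanish and three forms cannot be independent. *)
Lemma n_gt0 : (0 < n)%N.
Proof.
have [n0|//] := posnP n; exfalso.
have : form 1 0 0 = 0 by apply/matrixP => -[i lti]; exfalso; rewrite n0 in lti.
by move=> /W_free /row3_eq0[/eqP]; rewrite oner_eq0.
Qed.

Lemma dim_gt0 : (0 < n.*2)%N. Proof. by rewrite double_gt0 n_gt0. Qed.

Lemma nondegenerate_unit m (A : 'M[K]_m) : ~ degenerate A -> A \in unitmx.
Proof.
move=> /negP; rewrite /degenerate -leqNgt => rA.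
by rewrite -row_full_unit /row_full eqn_leq rank_leq_col.
Qed.

Lemma kernel_degenerate m (A : 'M[K]_m) (u : 'rV[K]_m) :
  u != 0 -> u *m A = 0 -> degenerate A.
Proof.
move=> u0 uA; apply: contrapT => /nondegenerate_unit Au.
by move/eqP: u0; apply; rewrite -[u](mulmxK Au) uA mul0mx.
Qed.

Lemma middle_unit : W i1 \in unitmx.
Proof.
have -> : W i1 = form 0 1 0 by rewrite lincomb3_row3 !scale0r scale1r add0r addr0.
apply: nondegenerate_unit => /W_conic /eqP.
by rewrite mul0r expr1n eq_sym oner_eq0.
Qed.

(* The tangent line at a point p of the conic meets the conic only at p; an
   eigenvalue of p' p^-1, with p' another point of the tangent, yields a
   degenerate form on this line. *)
Lemma conic_degenerate s t : (s != 0) || (t != 0) ->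
  degenerate (form (s ^+ 2) (s * t) (t ^+ 2)).
Proof.
move=> st; apply: contrapT => /nondegenerate_unit pu; set p := form _ _ _ in pu.
have [s' [t' d0]] : exists s' t', s * t' - s' * t != 0.
  have [s0|s0] := eqVneq s 0.
    move: st; rewrite s0 eqxx /= => t0; exists 1, 0.
    by rewrite mulr0 mul1r sub0r oppr_eq0.
  by exists 0, 1; rewrite mulr1 mul0r subr0.
(* The derivative of (s^2, s t, t^2) in the direction (s', t'), so that p and q span the tangent
   line at p. *)
pose q := form (2 * (s * s')) (s * t' + s' * t) (2 * (t * t')).
have [k [u u0 uq]] := eigenvector_exists (q *m invmx p) dim_gt0.
have uqp : u *m (q - k *: p) = 0.
  rewrite mulmxBr -scalemxAr scalemxAl -uq !mulmxA mulmxKV ?subrr //.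
have qpE : q - k *: p = form (2 * (s * s') - k * s ^+ 2)
    (s * t' + s' * t - k * (s * t)) (2 * (t * t') - k * t ^+ 2).
  rewrite /q /p !lincomb3_row3 !scalerBl !scalerDr !scalerA !opprD.
  move: (W i0) (W i1) (W i2) => X Y Z; clear.
  by apply/matrixP => i j; rewrite !mxE; ring.
have := kernel_degenerate u0 uqp; rewrite qpE => /W_conic E.
(* Along q - k p the value of b^2 - a d is this square, independently of the eigenvalue k. *)
have : (s * t' - s' * t) ^+ 2 = 0.
  have -> : (s * t' - s' * t) ^+ 2 =
    (s * t' + s' * t - k * (s * t)) ^+ 2 -
    (2 * (s * s') - k * s ^+ 2) * (2 * (t * t') - k * t ^+ 2) by ring.
  by rewrite E subrr.
by move/eqP; rewrite expf_eq0 /= (negPf d0).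
Qed.

Definition left_nilp : 'M[K]_(n.*2) := W i0 *m invmx (W i1).
Definition right_nilp : 'M[K]_(n.*2) := W i2 *m invmx (W i1).

Lemma pencilE s t : pencil left_nilp right_nilp s t =
  form (s ^+ 2) (s * t) (t ^+ 2) *m invmx (W i1).
Proof.
rewrite lincomb3_row3 !mulmxDl -!scalemxAl mulmxV ?middle_unit //.
by rewrite scalemx1.
Qed.

Lemma pencil_kernelE s t (v : 'rV[K]_(n.*2)) :
  (v *m form (s ^+ 2) (s * t) (t ^+ 2) == 0) =
  (v *m pencil left_nilp right_nilp s t == 0).
Proof.
rewrite pencilE mulmxA; apply/eqP/eqP => [->|]; first by rewrite mul0mx.
have iu : invmx (W i1) \in unitmx by rewrite unitmx_inv middle_unit.
by move=> /(canRL (mulmxK iu)); rewrite mul0mx.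
Qed.

Lemma sq_neq0 (s t : K) : (s != 0) || (t != 0) ->
  row3 (s ^+ 2) (s * t) (t ^+ 2) != 0.
Proof.
apply: contraTneq => /row3_eq0[/eqP s0 _ /eqP t0].
by move: s0 t0; rewrite !expf_eq0 /= => -> ->.
Qed.

Lemma rank_form s t : (s != 0) || (t != 0) ->
  \rank (form (s ^+ 2) (s * t) (t ^+ 2)) = n.
Proof. by move=> st; apply: W_rank; [exact: sq_neq0|exact: conic_degenerate]. Qed.

Lemma rank_pencil s t : (s != 0) || (t != 0) ->
  \rank (pencil left_nilp right_nilp s t) = n.
Proof.
move=> st; rewrite pencilE mxrankMfree ?rank_form //.
by rewrite row_free_unit unitmx_inv middle_unit.
Qed.

(** A common null vector would make the sum of the two conic forms degenerate; but at this sum a d -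
    b^2 equals (s' t - t' s)^2, so it lies off the conic. *)
Lemma pencil_disjoint s t s' t' (v : 'rV[K]_(n.*2)) : s' * t != t' * s ->
  v *m pencil left_nilp right_nilp s t = 0 ->
  v *m pencil left_nilp right_nilp s' t' = 0 -> v = 0.
Proof.
move=> st /eqP; rewrite -pencil_kernelE => /eqP v1.
move=> /eqP; rewrite -pencil_kernelE => /eqP v2.
apply/eqP; apply: contraT => v0; move/eqP: st; case.
have : v *m form (s ^+ 2 + s' ^+ 2) (s * t + s' * t') (t ^+ 2 + t' ^+ 2) = 0.
  have -> : form (s ^+ 2 + s' ^+ 2) (s * t + s' * t') (t ^+ 2 + t' ^+ 2) =
      form (s ^+ 2) (s * t) (t ^+ 2) + form (s' ^+ 2) (s' * t') (t' ^+ 2).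
    rewrite !lincomb3_row3; move: (W i0) (W i1) (W i2) => X Y Z; clear.
    by apply/matrixP => i j; rewrite !mxE; ring.
  by rewrite mulmxDr v1 v2 addr0.
move=> /(kernel_degenerate v0) /W_conic E; apply/eqP; rewrite -subr_eq0.
have : (s' * t - t' * s) ^+ 2 = 0.
  have -> : (s' * t - t' * s) ^+ 2 = (s ^+ 2 + s' ^+ 2) * (t ^+ 2 + t' ^+ 2) -
    (s * t + s' * t') ^+ 2 by ring.
  by rewrite E subrr.
by move/eqP; rewrite expf_eq0.
Qed.

Lemma nilp_relations : [/\ left_nilp *m left_nilp = 0,
  right_nilp *m right_nilp = 0 &
  left_nilp *m right_nilp + right_nilp *m left_nilp = 1%:M].
Proof.
have nn : (n + n)%N = n.*2 by rewrite addnn.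
split.
- exact: pencil_nilpotent nn rank_pencil.
- apply: (pencil_nilpotent (N' := left_nilp) nn) => s t st.
  by rewrite pencilC rank_pencil // orbC.
- exact: pencil_anticomm nn rank_pencil pencil_disjoint.
Qed.

End Pointwise.

(** * A basis of the forms adapted to the quadric at all points *)

Section AdaptedBasis.
Variables (K : numClosedFieldType) (n : nat) (M : manifold K n.*2).
Variable Omega : set (M -> 'M[K]_(n.*2)).

Lemma lincomb3_eval (w : 'I_3 -> M -> 'M[K]_(n.*2)) c x :
  lincomb3 w c x = lincomb3 (fun i => w i x) c.
Proof. by rewrite /lincomb3 fct_sumE. Qed.

(** [space3] only provides some basis w'. The matrices expressing w' in w and w in w' have product 1
    because w' is free, hence are invertible. Applied to values at x, this makes the evaluation at x
    injective on Omega. *)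
Lemma space3_free (V : lmodType K) (w : 'I_3 -> V) :
  space3 (range (lincomb3 w)) -> forall c, lincomb3 w c = 0 -> c = 0.
Proof.
move=> [w' [w'free E]] c c0.
have h1 i : exists a : 'rV[K]_3, lincomb3 w a = w' i.
  have : range (lincomb3 w) (w' i).
    rewrite E; exists (delta_mx 0 i) => //.
    rewrite /lincomb3 (bigD1 i) //= big1 ?mxE ?eqxx ?scale1r ?addr0 // => j ji.
    by rewrite mxE (negPf ji) andbF scale0r.
  by move=> [a _ <-]; exists a.
have h2 i : exists b : 'rV[K]_3, lincomb3 w' b = w i.
  have : range (lincomb3 w') (w i).
    rewrite -E; exists (delta_mx 0 i) => //.
    rewrite /lincomb3 (bigD1 i) //= big1 ?mxE ?eqxx ?scale1r ?addr0 // => j ji.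
    by rewrite mxE (negPf ji) andbF scale0r.
  by move=> [b _ <-]; exists b.
have [a aP] := choice h1; have [b bP] := choice h2.
pose A := \matrix_i a i; pose B := \matrix_i b i.
have wA u : lincomb3 w' u = lincomb3 w (u *m A).
  by rewrite -lincomb3_mulmx /lincomb3; apply: eq_bigr => i _; rewrite rowK -aP.
have wB u : lincomb3 w u = lincomb3 w' (u *m B).
  by rewrite -lincomb3_mulmx /lincomb3; apply: eq_bigr => i _; rewrite rowK -bP.
have AB : A *m B = 1%:M.
  apply/row_matrixP => i; rewrite !rowE mulmxA mulmx1.
  apply/eqP; rewrite -subr_eq0; apply/eqP; apply: w'free.
  by rewrite lincomb3B -wB -wA subrr.
have Bu : B \in unitmx by case: (mulmx1_unit AB).
have : c *m B = 0 by apply: w'free; rewrite -wB.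
by move=> /(canRL (mulmxK Bu)); rewrite mul0mx.
Qed.

(** The matrix [g] is found from the quadric inside Omega and so does not depend on x: one equation
    a d = b^2 governs the degenerate forms at all points. *)
Lemma adapted_basis : trisymplectic Omega ->
  exists w : 'I_3 -> M -> 'M[K]_(n.*2),
    [/\ forall c, Omega (lincomb3 w c),
        forall x c, lincomb3 (fun i => w i x) c = 0 -> c = 0,
        forall x a b d, degenerate (lincomb3 (fun i => w i x) (row3 a b d)) ->
          a * d = b ^+ 2 &
        forall x c, c != 0 -> degenerate (lincomb3 (fun i => w i x) c) ->
          \rank (lincomb3 (fun i => w i x) c) = n].
Proof.
move=> [_ _ [Z [w0 [Q [[w0free OE] QT Qu ZE]]] pt]].
have [g gu gQ] := quadric_normal_form QT Qu.
pose w i := lincomb3 w0 (row i g).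
have wE c : lincomb3 w c = lincomb3 w0 (c *m g) by exact: lincomb3_mulmx.
have Ow c : Omega (lincomb3 w c) by rewrite OE wE; exists (c *m g).
have evE x : eval_forms Omega x = range (lincomb3 (fun i => w0 i x)).
  rewrite /eval_forms OE; apply/seteqP; split=> a.
    by move=> [_ [c _ <-] <-]; exists c => //; rewrite lincomb3_eval.
  by move=> [c _ <-]; exists (lincomb3 w0 c); [exists c|rewrite lincomb3_eval].
have free0 x c : lincomb3 (fun i => w0 i x) c = 0 -> c = 0.
  by case: (pt x); rewrite evE => /space3_free + _ _ _; apply.
have wxE x c : lincomb3 (fun i => w i x) c = lincomb3 (fun i => w0 i x) (c *m g).
  by rewrite -!lincomb3_eval wE.
have wfree x c : lincomb3 (fun i => w i x) c = 0 -> c = 0.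
  by rewrite wxE => /free0 /(canRL (mulmxK gu)); rewrite mul0mx.
have ev x c : eval_forms Omega x (lincomb3 (fun i => w i x) c).
  by exists (lincomb3 w c); [exact: Ow|rewrite lincomb3_eval].
exists w; split=> //.
- move=> x a b d deg; have [_ _ _ dZ] := pt x.
  have := dZ _ (conj (ev x _) deg); rewrite /eval_forms ZE.
  move=> [_ [c /= cQ <-]]; rewrite lincomb3_eval wxE => E.
  (* The quadric supplies some form of Z with the same value at x; by injectivity of evaluation its
     coefficients are those of the given form. *)
  apply: gQ; suff <- : c = row3 a b d *m g by [].
  apply/eqP; rewrite -subr_eq0; apply/eqP; apply: (free0 x).
  by rewrite lincomb3B E subrr.
- move=> x c c0 deg; have [_ _ rk _] := pt x.
  apply: rk deg; first exact: ev.
  by apply: contra_neq c0; exact: wfree.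
Qed.

End AdaptedBasis.

(** * The web *)

Section Lines.
Variable K : numClosedFieldType.
Implicit Types (L : CP1 K) (u v : 'rV[K]_2).

(** Homogeneous coordinates of the line, fixed once and for all; [vpick] returns a nonzero vector of
    a nonzero space. *)
Definition line_rep L : 'rV[K]_2 := vpick (val L).
Local Notation xc L := (line_rep L 0 0).
Local Notation yc L := (line_rep L 0 1).

Lemma line_rep_neq0 L : line_rep L != 0.
Proof. by rewrite vpick0 -dimv_eq0 (eqP (valP L)). Qed.

Lemma line_repE L : val L = <[line_rep L]>%VS.
Proof.
apply/eqP; rewrite eq_sym eqEdim -memvE memv_pick (eqP (valP L)) dim_vline.
by rewrite line_rep_neq0.
Qed.

Lemma row2_neq0 u : u != 0 -> (u 0 0 != 0) || (u 0 1 != 0).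
Proof.
apply: contraNT; rewrite negb_or !negbK => /andP[/eqP u0 /eqP u1].
apply/eqP/rowP => i; rewrite [RHS]mxE.
by case: i => [[|[|//]]] lti; [rewrite -[RHS]u0|rewrite -[RHS]u1];
  congr (u 0 _); apply: val_inj.
Qed.

Lemma row2_colinear u v : u != 0 -> v 0 0 * u 0 1 = v 0 1 * u 0 0 ->
  v \in <[u]>%VS.
Proof.
move=> /row2_neq0 u0 uv; apply/vlineP.
have row2P (a b : 'rV[K]_2) : a 0 0 = b 0 0 -> a 0 1 = b 0 1 -> a = b.
  move=> e0 e1; apply/rowP => -[[|[|//]]] lti.
    by rewrite (_ : Ordinal lti = 0) //; apply: val_inj.
  by rewrite (_ : Ordinal lti = 1) //; apply: val_inj.
have [x0|x0] := eqVneq (u 0 0) 0.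
  move: u0; rewrite x0 eqxx /= => y0; exists (v 0 1 / u 0 1).
  apply: row2P; rewrite mxE ?divfK // x0 mulr0.
  by move/eqP: uv; rewrite x0 mulr0 mulf_eq0 (negPf y0) orbF => /eqP.
exists (v 0 0 / u 0 0); apply: row2P; rewrite mxE ?divfK //.
by rewrite mulrAC uv mulfK.
Qed.

Lemma line_rep_distinct L L' : L != L' -> xc L' * yc L != yc L' * xc L.
Proof.
apply: contraNN => /eqP E; apply/eqP/val_inj/eqP; rewrite eq_sym eqEdim.
rewrite (eqP (valP L)) (eqP (valP L')) leqnn andbT !line_repE -memvE.
exact: row2_colinear (line_rep_neq0 L) E.
Qed.

(** The chosen representative of the line of u is only proportional to u; [line_projZ] absorbs the
    factor. *)
Lemma line_through u : u != 0 ->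
  exists L, exists2 k, k != 0 & line_rep L = k *: u.
Proof.
move=> u0; have d1 : \dim <[u]> == 1%N by rewrite dim_vline u0.
pose L : CP1 K := exist _ <[u]>%VS d1; exists L.
have : line_rep L \in <[u]>%VS by exact: memv_pick.
move=> /vlineP[k kE]; exists k => //.
by apply: contraTneq (line_rep_neq0 L) => k0; rewrite kE k0 scale0r eqxx.
Qed.

End Lines.

(** * The algebra spanned by the projections *)

Section MatrixUnitsWeb.
Variables (K : numClosedFieldType) (m : nat) (N N' : 'M[K]_m).
Hypothesis m_gt0 : (0 < m)%N.
Hypotheses (NN : N *m N = 0) (N'N' : N' *m N' = 0).
Hypothesis NN'1 : N *m N' + N' *m N = 1%:M.
Local Notation E := (comb4 N N').

Definition matrix_units : {vspace 'M[K]_m} :=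
  <<[tuple of [:: N *m N'; N; N'; N' *m N]]>>.

Lemma mem_matrix_units C : C \in matrix_units <-> exists a b c d, C = E a b c d.
Proof.
split=> [|[a [b [c [d ->]]]]].
  rewrite /matrix_units !span_cons span_nil addv0.
  move=> /memv_addP[_ /vlineP[a ->] [_ /memv_addP[_ /vlineP[b ->]
    [_ /memv_addP[_ /vlineP[c ->] [_ /vlineP[d ->] ->]] ->]] ->]].
  by exists a, b, c, d; rewrite /comb4 !addrA.
by rewrite !memvD // memvZ // memv_span // !inE eqxx ?orbT.
Qed.

Lemma matrix_units_basis :
  basis_of matrix_units [tuple [:: N *m N'; N; N'; N' *m N]`_i | i < 4].
Proof.
have -> : [tuple [:: N *m N'; N; N'; N' *m N]`_i | i < 4] =
    [tuple of [:: N *m N'; N; N'; N' *m N]].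
  by apply: eq_from_tnth => i; rewrite tnth_mktuple (tnth_nth 0).
rewrite /basis_of eqxx /=; apply/freeP => k.
rewrite !big_ord_recl big_ord0 /= addr0 !addrA.
move=> /(comb4_eq0 NN N'N' NN'1 m_gt0)[k0 k1 k2 k3].
move=> [[|[|[|[|//]]]] lti]; [rewrite -[RHS]k0|rewrite -[RHS]k1|
  rewrite -[RHS]k2|rewrite -[RHS]k3]; by congr (k _); apply: val_inj.
Qed.

(** The two complementary line projections split v into a component in S and one in S', and
    [daddv_pi] keeps the first. *)
Lemma daddv_pi_line_proj (S S' : {vspace 'rV[K]_m}) s t s' t' :
  s' * t != t' * s ->
  (forall v, (v \in S) = (v *m pencil N N' s t == 0)) ->
  (forall v, (v \in S') = (v *m pencil N N' s' t' == 0)) ->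
  (S :&: S' = 0)%VS ->
  lin1_mx (daddv_pi S S') = line_proj N N' s t s' t'.
Proof.
move=> st SE S'E dis; apply/row_matrixP => i; rewrite !rowE mul_rV_lin1.
move: (delta_mx _ _) => v.
have vS : v *m line_proj N N' s t s' t' \in S.
  by rewrite SE -mulmxA line_proj_kernel // mulmx0.
have vS' : v *m line_proj N N' s' t' s t \in S'.
  by rewrite S'E -mulmxA line_proj_kernel // mulmx0.
rewrite -[in LHS](mulmx1 v) -(line_projC NN'1 st) mulmxDr linearD /=.
rewrite (daddv_pi_id dis vS); move: vS'; move: (v *m line_proj _ _ s' t' s t).
move=> v' vS'; suff -> : daddv_pi S S' v' = 0 by rewrite addr0.
have := daddv_pi_add dis (subvP (addvSr S S') _ vS').
have dis' : (S' :&: S = 0)%VS by rewrite capvC.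
by rewrite (daddv_pi_id dis' vS') -[RHS]add0r => /addIr.
Qed.

Lemma matrix_units_Mat2 : isomorphic_Mat2 matrix_units.
Proof.
pose f (A : 'M[K]_2) : 'M[K]_m := E (A 0 0) (A 0 1) (A 1 0) (A 1 1).
have f_lin : linear f.
  move=> k A B; rewrite /f /comb4 !mxE.
  move: (N *m N') (N' *m N) => P Q; clear.
  by apply/matrixP => i j; rewrite !mxE; ring.
pose flM := GRing.isLinear.Build K _ _ _ f f_lin.
pose fl : {linear 'M[K]_2 -> 'M[K]_m} := HB.pack f flM.
have ord2P (i : 'I_2) : i = 0 \/ i = 1.
  by case: i => [[|[|//]] lti]; [left|right]; apply: val_inj.
exists fl; split=> [A B AB|A B||C].
- apply/eqP; rewrite -subr_eq0; apply/eqP.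
  have : fl (A - B) = 0 by rewrite linearB AB subrr.
  move=> /(comb4_eq0 NN N'N' NN'1 m_gt0)[e00 e01 e10 e11].
  apply/matrixP => i j; rewrite [RHS]mxE.
  by case: (ord2P i) => ->; case: (ord2P j) => ->.
- rewrite /= /f comb4M //; congr E; rewrite !mxE !big_ord_recl big_ord0 addr0;
    by congr (_ * _ + A _ _ * B _ _); apply: val_inj.
- by rewrite /= /f !mxE /= comb4_id.
- split=> [/mem_matrix_units[a [b [c [d ->]]]]|[A ->]].
    exists (\matrix_(i, j) (nth [::] [:: [:: a; b]; [:: c; d]] i)`_j).
    by rewrite /= /f !mxE.
  by apply/mem_matrix_units; do 4!eexists.
Qed.

Lemma matrix_unitsM a b : a \in matrix_units -> b \in matrix_units ->
  a *m b \in matrix_units.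
Proof.
move=> /mem_matrix_units[a1 [a2 [a3 [a4 ->]]]].
move=> /mem_matrix_units[b1 [b2 [b3 [b4 ->]]]].
by apply/mem_matrix_units; rewrite comb4M //; do 4!eexists.
Qed.

Lemma mem_line_proj s t s' t' : line_proj N N' s t s' t' \in matrix_units.
Proof.
by rewrite memvZ //; apply/mem_matrix_units; do 4!eexists.
Qed.

Lemma line_projZ k k' s t s' t' : k != 0 -> k' != 0 ->
  line_proj N N' (k * s) (k * t) (k' * s') (k' * t') = line_proj N N' s t s' t'.
Proof.
move=> k0 k'0; rewrite /line_proj.
have -> : k' * s' * (k * t) - k' * t' * (k * s) = k * k' * (s' * t - t' * s).
  by ring.
have -> : E (k' * s' * (k * t)) (- (k' * s' * (k * s))) (k' * t' * (k * t))
    (- (k' * t' * (k * s))) =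
    (k * k') *: E (s' * t) (- (s' * s)) (t' * t) (- (t' * s)).
  rewrite /comb4; move: (N *m N') (N' *m N) => P Q; clear.
  by apply/matrixP => i j; rewrite !mxE; ring.
by rewrite scalerA invfM mulrAC mulVf ?mul1r // mulf_neq0.
Qed.

(** Three points suffice: between (0 : 1) and (1 : 0) the projections are N N' and N' N, and those
    along the kernel at (1 : 1) are N N' + N' and N + N' N. *)
Lemma line_proj_span (F : {vspace 'M[K]_m}) :
  (forall s t s' t', s' * t != t' * s -> line_proj N N' s t s' t' \in F) ->
  (matrix_units <= F)%VS.
Proof.
move=> FP; apply/subvP => C /mem_matrix_units[a [b [c [d ->]]]].
have n1 : (1 : K) != 0 := oner_neq0 _.
pose simps := (mulr0, mul0r, mulr1, mul1r, subr0, sub0r, oppr0, invrN1, invr1,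
  scale0r, scale1r, scaleN1r, addr0, add0r, opprK).
have P11 : N *m N' \in F.
  have := FP 0 1 1 0; rewrite /line_proj /comb4 !simps; apply; exact: n1.
have P22 : N' *m N \in F.
  have := FP 1 0 0 1; rewrite /line_proj /comb4 !simps eq_sym; apply; exact: n1.
have P21 : N' \in F.
  have := FP 0 1 1 1; rewrite /line_proj /comb4 !simps => /(_ n1).
  by move=> /memvB /(_ P11); rewrite addrC addKr.
have P12 : N \in F.
  have := FP 1 0 1 1; rewrite /line_proj /comb4 !simps eq_sym => /(_ n1).
  by rewrite -opprD opprK => /memvB /(_ P22); rewrite addrK.
by rewrite /comb4 !memvD // memvZ.
Qed.

End MatrixUnitsWeb.

(** * Assembly of the web *)

Section WebOfTrisymplectic.
Variables (K : numClosedFieldType) (n : nat) (M : manifold K n.*2).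
Hypothesis jacobian_diff : forall (f : 'rV[K]_(n.*2) -> 'rV[K]_(n.*2)) p,
  (\forall y \near p, differentiable f y) -> differentiable (jacobian f) p.

(** S_t is the null-space of the form with coefficients (s^2, s t, t^2), where (s, t) represents t.
    This single form lies in Omega, so it is closed and yields involutivity, and its kernel at each
    x is that of the pencil, to which the algebra applies. *)
Lemma trisymplectic_web (Omega : set (M -> 'M[K]_(n.*2))) :
  trisymplectic Omega ->
  exists S : CP1 K -> M -> {vspace 'rV[K]_(n.*2)},
    SL2_web S /\
    forall t, exists2 w, Omega w & forall x, S t x = null_space (w x).
Proof.
move=> tri; have [_ holo _] := tri.
have [w [Ow w_free w_conic w_rank]] := adapted_basis tri.
pose conic s t : M -> 'M[K]_(n.*2) := lincomb3 w (row3 (s ^+ 2) (s * t) (t ^+ 2)).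
pose S (L : CP1 K) x := null_space (conic (line_rep L 0 0) (line_rep L 0 1) x).
pose N x := left_nilp (fun i => w i x); pose N' x := right_nilp (fun i => w i x).
have OwI i : Omega (w i).
  suff -> : w i = lincomb3 w (delta_mx 0 i) by exact: Ow.
  rewrite /lincomb3 (bigD1 i) //= big1 ?mxE ?eqxx ?scale1r ?addr0 // => j ji.
  by rewrite mxE (negPf ji) andbF scale0r.
have rel x := nilp_relations (w_free x) (w_conic x) (w_rank x).
have m_gt0 x : (0 < n.*2)%N := dim_gt0 (w_free x).
have NN x : N x *m N x = 0 by case: (rel x).
have N'N' x : N' x *m N' x = 0 by case: (rel x).
have NN'1 x : N x *m N' x + N' x *m N x = 1%:M by case: (rel x).
have mid_unit x : w i1 x \in unitmx.
  exact: (middle_unit (w_conic x)).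
have Nh : holomorphic_endo N.
  by apply: holomorphic_endo_quotient mid_unit; exact: (holo _ (OwI _)).1.
have N'h : holomorphic_endo N'.
  by apply: holomorphic_endo_quotient mid_unit; exact: (holo _ (OwI _)).1.
have NN'h := holomorphic_endoM Nh N'h; have N'Nh := holomorphic_endoM N'h Nh.
have projh s t s' t' : holomorphic_endo (fun x => line_proj (N x) (N' x) s t s' t').
  exact: holomorphic_endoZ _ (holomorphic_endoD (holomorphic_endoD
    (holomorphic_endoD (holomorphic_endoZ _ NN'h) (holomorphic_endoZ _ Nh))
    (holomorphic_endoZ _ N'h)) (holomorphic_endoZ _ N'Nh)).
have memS L x v : (v \in S L x) =
    (v *m pencil (N x) (N' x) (line_rep L 0 0) (line_rep L 0 1) == 0).
  rewrite mem_null_space /conic lincomb3_eval.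
  exact: (pencil_kernelE (w_conic x)).
have dimS L x : \dim (S L x) = n.
  rewrite dim_null_space /conic lincomb3_eval.
  rewrite (rank_form (w_free x) (w_conic x) (w_rank x)).
    by rewrite -addnn addnK.
  exact/row2_neq0/line_rep_neq0.
have capS L L' x : L != L' -> (S L x :&: S L' x = 0)%VS.
  move=> LL'; apply/eqP; rewrite -subv0; apply/subvP => v.
  rewrite memv_cap !memS => /andP[/eqP v1 /eqP v2]; rewrite memv0; apply/eqP.
  exact: (pencil_disjoint (w_conic x)) (line_rep_distinct LL') v1 v2.
have projE L L' x : L != L' -> web_proj S L L' x = line_proj (N x) (N' x)
    (line_rep L 0 0) (line_rep L 0 1) (line_rep L' 0 0) (line_rep L' 0 1).
  move=> LL'; apply: daddv_pi_line_proj => //; [exact: line_rep_distinct|].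
  exact: capS.
exists S; split; last first.
  by move=> L; exists (conic (line_rep L 0 0) (line_rep L 0 1)); first exact: Ow.
split=> //.
- move=> L; set s := line_rep L 0 0; set t := line_rep L 0 1.
  (* A second point of CP1, the same for all x, provides a holomorphic projector onto [S L] defined
     on the whole of M. *)
  have [s' [t' d0]] : exists s' t', s' * t != t' * s.
    have /orP[s0|t0] := row2_neq0 (line_rep_neq0 L).
      by exists 0, 1; rewrite mul0r mul1r eq_sym.
    by exists 1, 0; rewrite mul0r mul1r.
  apply: (subbundle_image jacobian_diff (projh s t s' t')) (dimS L) _ _ => x v.
    by rewrite memS -mulmxA line_proj_kernel // mulmx0.
  rewrite memS => /eqP vS.
  have st : (s != 0) || (t != 0) by exact/row2_neq0/line_rep_neq0.
  rewrite -[RHS]mulmx1 -(line_projC (NN'1 x) d0) mulmxDr.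
  by rewrite (line_proj_annihil (NN x) (N'N' x) (NN'1 x) _ _ st vS) addr0.
- move=> L; have [ho cl] := holo _ (Ow (row3 (line_rep L 0 0 ^+ 2)
    (line_rep L 0 0 * line_rep L 0 1) (line_rep L 0 1 ^+ 2))).
  exact: involutive_null_space ho cl _.
- exists (fun x => matrix_units (N x) (N' x)).
    (* The frame N N', N, N', N' N is global, so the bundle of algebras is trivial. *)
    move=> x0; exists setT; split=> //; first exact: openT.
    exists (fun i x => [:: N x *m N' x; N x; N' x; N' x *m N x]`_i); split.
      by move=> [[|[|[|[|//]]]] lti] /=.
    by move=> x _; exact: matrix_units_basis (m_gt0 x) (NN x) (N'N' x) (NN'1 x).
  move=> x; split.
  + split=> [_ [L [L' [LL' ->]]]|F FP].
      by rewrite projE // mem_line_proj.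
    apply: line_proj_span => s t s' t' d0.
    (* The projections of the web are written with chosen representatives of lines, whereas
       [line_proj_span] ranges over all pairs of coordinates; u and u' carry the latter to lines. *)
    pose u : 'rV[K]_2 := \row_i [:: s; t]`_i.
    pose u' : 'rV[K]_2 := \row_i [:: s'; t']`_i.
    have u0 : u != 0.
      apply: contraNneq d0 => /rowP z; have := z 0; have := z 1.
      by rewrite !mxE /= => -> ->; rewrite !mulr0.
    have u'0 : u' != 0.
      apply: contraNneq d0 => /rowP z; have := z 0; have := z 1.
      by rewrite !mxE /= => -> ->; rewrite !mul0r.
    have [L [k k0 kE]] := line_through u0; have [L' [k' k'0 kE']] := line_through u'0.
    have LL' : L != L'.
      apply: contraNneq d0 => LL'; move: kE'; rewrite -LL' kE => E.
      have Es : k * s = k' * s' by have /rowP/(_ 0) := E; rewrite !mxE.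
      have Et : k * t = k' * t' by have /rowP/(_ 1) := E; rewrite !mxE.
      apply/eqP/(mulfI (mulf_neq0 k0 k'0)).
      transitivity (k' * s' * (k * t)); first by ring.
      by rewrite -Es Et; ring.
    have := FP _ (ex_intro _ L (ex_intro _ L' (conj LL' erefl))).
    by rewrite projE // kE kE' !mxE /= line_projZ.
  + exact: matrix_unitsM (NN x) (N'N' x) (NN'1 x).
  + exact: matrix_units_Mat2 (m_gt0 x) (NN x) (N'N' x) (NN'1 x).
Qed.

End WebOfTrisymplectic.

Theorem theorem4 (R : realType) (n : nat) (M : manifold R[i] n.*2)
    (Omega : set (M -> 'M[R[i]]_(n.*2))) :
  trisymplectic Omega ->
  exists S : CP1 R[i] -> M -> {vspace 'rV[R[i]]_(n.*2)},
    SL2_web S /\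
    forall t, exists2 w, Omega w & forall x, S t x = null_space (w x).
Proof.
apply: trisymplectic_web => f p.
exact: HolomorphicDerivative.jacobian_differentiable.
Qed.
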